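(* Let $n\ge 2$ and $T>0$. There exist a function $\bar\rho\in C_c^\infty(\mathbb{R}^n)$ which is the density of a probability measure on $\mathbb{R}^n$, and a continuous, compactly supported velocity field $\bar v\in C_c(\mathbb{R}^n;\mathbb{R}^n)$, such that the Cauchy problem for the pressureless gas system $$\partial_t\rho+\operatorname{div}(\rho v)=0,\qquad \partial_t(\rho v)+\operatorname{div}(\rho v\otimes v)=0,\qquad \rho(0,x)=\bar\rho(x),\quad v(0,x)=\bar v(x),$$ on $[0,T]$ admits two distinct sticky weak solutions (in the sense defined in the context); that is, there are two flow mappings, each providing a sticky weak solution with initial data $(\bar\rho,\bar v)$, whose associated pairs $(\rho,v)$ are distinct.
   Context: Let $\mathcal{L}_n$ be Lebesgue measure on $\mathbb{R}^n$, and let $D\subset\mathbb{R}^n$ be an open set with $\mathcal{L}_n(D)=1$; points $y\in D$ are Lagrangian labels. Identify $\bar\rho$ with the measure $\bar\rho(x)\,dx$. The initial data are assumed to satisfy $\bar\rho\in\mathcal{P}_2(\mathbb{R}^n)$ (probability measures with finite second moment) and $\bar v\in L^2(\bar\rho)$. Let $T>0$. A flow mapping is a map $X:[0,T]\times D\to\mathbb{R}^n$ with forward time derivatives $X_t$ satisfying $\sup_{0\le t\le T}\int_D|X_t(t,y)|^2\,dy<\infty$. Function spaces (for vector-valued functions, understood componentwise): - $J(X)$ is the completion of $C_c^1([0,T]\times\mathbb{R}^n)$ with respect to the norm $\|\theta\|_J=\big[\int_0^T\int_D\theta(t,X(t,y))^2\,dy\,dt\big]^{1/2}$. - For each $t\in[0,T]$,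 $J(X,t)$ is the completion of $C_c^1(\mathbb{R}^n)$ with respect to the norm $\|\phi\|_{J,t}=\big[\int_D\phi(X(t,y))^2\,dy\big]^{1/2}$. - $K(X)=\{\theta\circ X:\theta\in J(X)\}\subset L^2([0,T]\times D)$, where $(\theta\circ X)(t,y)=\theta(t,X(t,y))$, and $K(X,t)=\{\phi\circ X(t,\cdot):\phi\in J(X,t)\}\subset L^2(D)$. It is known that for every $g\in L^2(D)$ there is a unique $v\in J(X)$ such that for every $t\in[0,T]$: $v(t,\cdot)\in J(X,t)$, $\|v(t,\cdot)\|_{J,t}\le\|g\|_{L^2}$, and $v\circ X(t,\cdot)-g\perp K(X,t)$ in $L^2(D)$. Define the linear map $W(X):L^2(D)\to J(X)$ by $W(X)g=v$. Definition (sticky weak solution). A flow mapping $X:[0,T]\times D\to\mathbb{R}^n$ provides a sticky weak solution to the Cauchy problem with initial data $(\bar\rho,\bar v)$ if: 1. (weak solution) $X_t=(W(X)X_t(0,\cdot))\circ X$ in $L^2([0,T]\times D)$; 2. (initial data) for every $\phi\in J(X,0)$, $\int_D\phi(X(0,y))\,dy=\int_{\mathbb{R}^n}\phi(x)\,d\bar\rho(x)$ and $\int_D X_t(0,y)\,\phi(X(0,y))\,dy=\int_{\mathbb{R}^n}\bar v(x)\phi(x)\,d\bar\rho(x)$; 3. (sticky property) for every $y_1,y_2\in D$ and $t_0\in[0,T]$ with $X(t_0,y_1)=X(t_0,y_2)$, one has $X(t,y_1)=X(t,y_2)$ for all $t\in[t_0,T]$. The pair $(\rho,v)$ associated with such an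 $X$ is $\rho(t,\cdot)=X(t,\cdot)_{\#}\mathcal{L}_n$ (push-forward of Lebesgue measure on $D$ under $y\mapsto X(t,y)$) and $v=W(X)X_t(0,\cdot)$; it is a distributional solution of the pressureless gas system. *)

(* Defs.v *)
From HB Require Import structures.
From mathcomp Require Import all_boot all_order all_algebra.
From mathcomp Require Import all_classical all_reals all_analysis.

Set Implicit Arguments.
Unset Strict Implicit.
Unset Printing Implicit Defensive.
Import Order.TTheory GRing.Theory Num.Theory.
Import numFieldNormedType.Exports.
Local Open Scope classical_set_scope.
Local Open Scope ring_scope.

(* 'rV[R]_n carries the product of the Borel sigma-algebras of its coordinates,
   i.e. the Borel sigma-algebra of R^n, as the library does for n.-tuple. *)
Definition rV_display : measure_display -> measure_display.
Proof. exact. Qed.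

Section measurable_rV.
Context {R : realType} (n : nat).

Let coord (i : 'I_n) (x : 'rV[R]_n) : measurableTypeR R := x ord0 i.

Let rV_set0 : g_sigma_preimage coord set0.
Proof. exact: sigma_algebra0. Qed.

Let rV_setC A : g_sigma_preimage coord A -> g_sigma_preimage coord (~` A).
Proof. exact: sigma_algebraC. Qed.

Let rV_bigcup (F : _^nat) : (forall i, g_sigma_preimage coord (F i)) ->
  g_sigma_preimage coord (\bigcup_i (F i)).
Proof. exact: sigma_algebra_bigcup. Qed.

HB.instance Definition _ :=
  @isMeasurable.Build (rV_display default_measure_display)
  'rV[R]_n (g_sigma_preimage coord) rV_set0 rV_setC rV_bigcup.

End measurable_rV.

Section measurable_rV_fun.
Context {R : realType}.

Lemma measurable_rV_coord n (i : 'I_n) :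
  measurable_fun [set: 'rV[R]_n] (fun x => x ord0 i : measurableTypeR R).
Proof.
move=> _ Y mY; rewrite setTI; apply: sub_sigma_algebra => /=.
rewrite -bigcup_seq/=; exists i => /=; first by rewrite mem_index_enum.
by exists Y => //; rewrite setTI.
Qed.

Lemma measurable_fun_rVP n d (T : measurableType d) (f : T -> 'rV[R]_n) :
  (forall i, measurable_fun setT (fun x => f x ord0 i : measurableTypeR R)) ->
  measurable_fun setT f.
Proof.
move=> mf _ A mA.
pose co (i : 'I_n) (x : 'rV[R]_n) : measurableTypeR R := x ord0 i.
suff : g_sigma_preimage (fun i => co i \o f) `<=` measurable.
  by rewrite g_sigma_preimage_comp; apply; exists A.
apply: smallest_sub; first exact: sigma_algebra_measurable.
rewrite -bigcup_seq; apply: bigcup_sub => i _.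
by move=> B [C mC <-]; exact: mf.
Qed.

Definition rV_cons n (p : measurableTypeR R * 'rV[R]_n) : 'rV[R]_n.+1 :=
  row_mx (p.1%:M : 'rV[R]_1) p.2.

Definition rV_uncons n (x : 'rV[R]_n.+1) : measurableTypeR R * 'rV[R]_n :=
  (x ord0 ord0, \row_i x ord0 (lift ord0 i)).

Lemma rV_consE0 n (p : measurableTypeR R * 'rV[R]_n) :
  rV_cons p ord0 ord0 = p.1.
Proof.
rewrite /rV_cons mxE; case: splitP => // j _.
by rewrite mxE [j]ord1 eqxx mulr1n.
Qed.

Lemma rV_consES n (p : measurableTypeR R * 'rV[R]_n) i :
  rV_cons p ord0 (lift ord0 i) = p.2 ord0 i.
Proof.
rewrite /rV_cons mxE; case: splitP => [j|j [/val_inj ->//]].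
by rewrite ord1.
Qed.

Lemma rV_consK n : cancel (@rV_cons n) (@rV_uncons n).
Proof.
move=> [x y]; rewrite /rV_uncons rV_consE0/=; congr pair.
by apply/rowP => i; rewrite mxE rV_consES.
Qed.

Lemma measurable_rV_cons n : measurable_fun setT (@rV_cons n).
Proof.
apply: measurable_fun_rVP => i.
case: (unliftP ord0 i) => [j|] ->.
  under eq_fun do rewrite rV_consES.
  exact: (measurableT_comp (measurable_rV_coord j) measurable_snd).
under eq_fun do rewrite rV_consE0.
exact: measurable_fst.
Qed.

Lemma measurable_rV_uncons n : measurable_fun setT (@rV_uncons n).
Proof.
apply/measurable_fun_pairP; split; first exact: measurable_rV_coord.
apply: measurable_fun_rVP => i /=.
under eq_fun do rewrite mxE.
exact: measurable_rV_coord.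
Qed.


Section rV_lebesgue_step.
Context n (mu : {sigma_finite_measure set 'rV[R]_n -> \bar R}).
Local Open Scope ereal_scope.

Definition rV_lebesgue_step : set 'rV[R]_n.+1 -> \bar R :=
  pushforward ((@lebesgue_measure R) \x mu) (@rV_cons n).

Let step0 : rV_lebesgue_step set0 = 0.
Proof. by rewrite /rV_lebesgue_step /pushforward preimage_set0 measure0. Qed.

Let step_ge0 A : 0 <= rV_lebesgue_step A.
Proof. by rewrite /rV_lebesgue_step /pushforward measure_ge0. Qed.

Let step_sigma_additive : semi_sigma_additive rV_lebesgue_step.
Proof.
move=> F mF tF mUF; rewrite /rV_lebesgue_step /pushforward preimage_bigcup.
have mp B : measurable B -> measurable (@rV_cons n @^-1` B).
  by move=> mB; rewrite -[X in measurable X]setTI; exact: measurable_rV_cons.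
apply: measure_semi_sigma_additive.
- by move=> k; exact: mp.
- apply/trivIsetP => /= i j _ _ ij; rewrite -preimage_setI.
  by move/trivIsetP : tF => /(_ _ _ _ _ ij) ->//; rewrite preimage_set0.
- by rewrite -preimage_bigcup; exact: mp.
Qed.

HB.instance Definition _ := isMeasure.Build _ _ _ rV_lebesgue_step
  step0 step_ge0 step_sigma_additive.

Let step_sigma_finite : sigma_finite setT rV_lebesgue_step.
Proof.
have /sigma_finiteP[F [TF ndF Foo]] := sigma_finiteT (@lebesgue_measure R).
have /sigma_finiteP[G [TG ndG Goo]] := sigma_finiteT mu.
exists (fun k => @rV_uncons n @^-1` (F k `*` G k)).
  rewrite -preimage_bigcup [X in _ @^-1` X](_ : _ = setT) ?preimage_setT//.
  apply/seteqP; split => // -[x y] _.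
  have [i _ Fix] : (\bigcup_k F k) x by rewrite -TF.
  have [j _ Gjy] : (\bigcup_k G k) y by rewrite -TG.
  exists (maxn i j) => //; split => /=.
    by move: x Fix; exact/subsetPset/ndF/leq_maxl.
  by move: y Gjy; exact/subsetPset/ndG/leq_maxr.
move=> k; have [mF Fk] := Foo k; have [mG Gk] := Goo k.
have mFG : measurable (F k `*` G k) by exact: measurableX.
split.
  by rewrite -[X in measurable X]setTI; exact: measurable_rV_uncons.
rewrite /rV_lebesgue_step /pushforward.
rewrite [X in (_ \x _)%E X](_ : _ = F k `*` G k); last first.
  by rewrite -[RHS](@preimage_id _) -(funext (@rV_consK n)).
by rewrite product_measure1E// lte_mul_pinfty// ge0_fin_numE.
Qed.

HB.instance Definition _ := Measure_isSigmaFinite.Build _ _ _ rV_lebesgue_step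
  step_sigma_finite.

End rV_lebesgue_step.

(* Lebesgue measure on the Borel sets of R^n, as the n-fold product of
   lebesgue_measure. *)
Fixpoint rV_lebesgue n : {sigma_finite_measure set 'rV[R]_n -> \bar R} :=
  match n with
  | 0 => dirac (0 : 'rV[R]_0)
  | m.+1 => rV_lebesgue_step (rV_lebesgue m)
  end.

Lemma rV_lebesgue_box n (A : 'I_n -> set (measurableTypeR R)) :
  (forall i, measurable (A i)) ->
  rV_lebesgue n [set x | forall i, A i (x ord0 i)] =
  (\prod_(i < n) lebesgue_measure (A i))%E.
Proof.
elim: n => [|n IHn] in A * => mA.
  rewrite big_ord0/= diracE mem_set//; by case.
rewrite big_ord_recl /= /rV_lebesgue_step /pushforward.
rewrite [X in (_ \x _)%E X](_ : _ = A ord0 `*`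
    [set x : 'rV[R]_n | forall i : 'I_n, A (lift ord0 i) (x ord0 i)]); last first.
  apply/seteqP; split => [p /= Ap|p /= [A0 Ap] i].
    split=> [|i]; first by rewrite -rV_consE0.
    by rewrite -rV_consES.
  by case: (unliftP ord0 i) => [j|] ->; rewrite ?rV_consES ?rV_consE0.
rewrite product_measure1E//.
  by congr (_ * _)%E; exact: (IHn (fun i => A (lift ord0 i))).
pose F i := (fun x : 'rV[R]_n => x ord0 i : measurableTypeR R) @^-1`
  A (lift ord0 i).
have -> : [set x : 'rV[R]_n | forall i : 'I_n, A (lift ord0 i) (x ord0 i)] =
    \bigcap_(i in [set: 'I_n]) F i.
  by apply/seteqP; split => x /= h i //; [move=> _|]; exact: h.
apply: (@fin_bigcap_measurable _ _ _ [set: 'I_n] F) => [|i _]; first exact: finite_finset.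
by rewrite -[X in measurable X]setTI; exact: measurable_rV_coord.
Qed.

End measurable_rV_fun.

Section function_classes.
Context {R : realType}.

Definition compactly_supported (V : topologicalType) (W : zmodType)
  (f : V -> W) := compact (closure [set x | f x != 0]).

(* For V of finite dimension, this is the usual class C^k(V). *)
Fixpoint Ck (V : normedModType R) (k : nat) (f : V -> R) : Prop :=
  match k with
  | 0 => continuous f
  | k'.+1 => (forall x, differentiable f x) /\
             (forall u : V, Ck k' (fun x => 'D_u f x))
  end.

Definition smooth (V : normedModType R) (f : V -> R) := forall k, Ck k f.

Definition L2norm d (S : measurableType d) (mu : set S -> \bar R) (A : set S)
    (f : S -> R) : \bar R :=
  sqrte (\int[mu]_(x in A) ((f x) ^+ 2)%:E).

End function_classes.

Section sticky_weak_solutions.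
Context {R : realType} {n : nat}.
Variables (T : R) (D : set 'rV[R]_n).
Implicit Types (t : R) (x y : 'rV[R]_n) (X : R -> 'rV[R]_n -> 'rV[R]_n).

Local Notation Leb := (rV_lebesgue n).

Definition spacetime_lebesgue : set (measurableTypeR R * 'rV[R]_n) -> \bar R :=
  ((@lebesgue_measure R) \x Leb)%E.

(* A map X : [0,T] x D -> R^n is a total function whose values outside
   [0,T] x D are irrelevant. The forward derivative is only used for t < T,
   since X(T + h) is not defined for h > 0. *)
Definition forward_quotient X t y (h : R) : 'rV[R]_n :=
  h^-1 *: (X (t + h) y - X t y).

Definition forward_derivative X t y : 'rV[R]_n :=
  lim (forward_quotient X t y h @[h --> 0^'+]).

(* Measurability in y is implicit in the integrals over D. Continuity of the
   trajectories makes X_t the actual velocity, X(t) = X(0) + \int_0^t X_t;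
   without it, trajectories with X_t = 0 could still jump. *)
Record flow_mapping X : Prop := {
  flow_measurable : forall t, 0 <= t <= T -> measurable_fun D (X t) ;
  flow_continuous : forall y, D y -> {within `[0, T], continuous (X ^~ y)} ;
  flow_derivable : forall t y, 0 <= t < T -> D y ->
    cvg (forward_quotient X t y h @[h --> 0^'+]) ;
  flow_energy : exists C : R, forall t, 0 <= t < T ->
    (\int[Leb]_(y in D)
       (\sum_(i < n) (forward_derivative X t y ord0 i) ^+ 2)%:E <= C%:E)%E
}.

Definition normJ X (theta : R -> 'rV[R]_n -> R) : \bar R :=
  L2norm spacetime_lebesgue (`[0, T] `*` D)
    (fun p => theta p.1 (X p.1 p.2)).

Definition normJt X t (phi : 'rV[R]_n -> R) : \bar R :=
  L2norm Leb D (fun y => phi (X t y)).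

(* The completions J(X) and J(X,t) are realized by Borel functions that are
   limits of C^1_c functions; two of them represent the same element when the
   norm of their difference is 0. C^1_c([0,T] x R^n) consists of the
   restrictions of functions in C^1_c(R x R^n). *)
Definition J X : set (R -> 'rV[R]_n -> R) := [set theta |
  measurable_fun (`[0, T] `*` [set: 'rV[R]_n])
    (fun p : measurableTypeR R * 'rV[R]_n => theta p.1 p.2 : measurableTypeR R)
  /\ exists phi : nat -> R * 'rV[R]_n -> R,
    (forall k, Ck 1 (phi k) /\ compactly_supported (phi k)) /\
    normJ X (fun t x => theta t x - phi k (t, x)) @[k --> \oo] --> 0%E].

Definition Jt X t : set ('rV[R]_n -> R) := [set psi |
  measurable_fun [set: 'rV[R]_n] (psi : 'rV[R]_n -> measurableTypeR R)
  /\ exists phi : nat -> 'rV[R]_n -> R,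
    (forall k, Ck 1 (phi k) /\ compactly_supported (phi k)) /\
    normJt X t (fun x => psi x - phi k x) @[k --> \oo] --> 0%E].

Definition Kt X t : set ('rV[R]_n -> R) := [set phi \o X t | phi in Jt X t].

(* v represents W(X) g. *)
Definition isW X (g : 'rV[R]_n -> R) (v : R -> 'rV[R]_n -> R) : Prop :=
  J X v /\ forall t, 0 <= t <= T ->
    [/\ Jt X t (v t),
        (normJt X t (v t) <= L2norm Leb D g)%E &
        forall w, Kt X t w ->
          (\int[Leb]_(y in D) ((v t (X t y) - g y) * w y)%:E = 0)%E].

(* v represents W(X) X_t(0,.), where W(X) acts componentwise. *)
Definition associated_velocity X (v : R -> 'rV[R]_n -> 'rV[R]_n) : Prop :=
  forall i : 'I_n, isW X (fun y => forward_derivative X 0 y ord0 i)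
                         (fun t x => v t x ord0 i).

Definition associated_density X t : set 'rV[R]_n -> \bar R :=
  fun A => Leb (D `&` X t @^-1` A).

Definition weak_solution X : Prop := exists v, associated_velocity X v /\
  {ae spacetime_lebesgue, forall p, (`[0, T] `*` D) p ->
     forward_derivative X p.1 p.2 = v p.1 (X p.1 p.2)}.

Definition initial_data (rhob : 'rV[R]_n -> R) (vb : 'rV[R]_n -> 'rV[R]_n) X :
    Prop := forall phi, Jt X 0 phi ->
  (\int[Leb]_(y in D) (phi (X 0%R y))%:E =
   \int[Leb]_x (phi x * rhob x)%:E)%E /\
  forall i : 'I_n,
    (\int[Leb]_(y in D) (forward_derivative X 0%R y ord0 i * phi (X 0%R y))%:E =
     \int[Leb]_x (vb x ord0 i * phi x * rhob x)%:E)%E.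

Definition sticky X : Prop := forall y1 y2 t0, D y1 -> D y2 ->
  0 <= t0 <= T -> X t0 y1 = X t0 y2 ->
  forall t, t0 <= t <= T -> X t y1 = X t y2.

Definition sticky_weak_solution rhob vb X : Prop :=
  [/\ flow_mapping X, weak_solution X, initial_data rhob vb X & sticky X].

(* Equality of the pairs (rho1, v1) and (rho2, v2); once the densities agree,
   J(X1) and J(X2) have the same norm. *)
Definition same_pair X1 (v1 : R -> 'rV[R]_n -> 'rV[R]_n)
    X2 (v2 : R -> 'rV[R]_n -> 'rV[R]_n) : Prop :=
  (forall t, 0 <= t <= T -> forall A, measurable A ->
     associated_density X1 t A = associated_density X2 t A) /\
  (forall i : 'I_n, normJ X1 (fun t x => v1 t x ord0 i - v2 t x ord0 i) = 0%E).

End sticky_weak_solutions.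

(* Main.v *)
Require Import Defs.
From HB Require Import structures.
From mathcomp Require Import all_boot all_order all_algebra.
From mathcomp Require Import all_classical all_reals all_analysis.
From mathcomp Require Import measurable_realfun.
From mathcomp Require Import ring lra.
Set Implicit Arguments.
Unset Strict Implicit.
Unset Printing Implicit Defensive.
Import Order.TTheory GRing.Theory Num.Theory.
Import numFieldNormedType.Exports.
Local Open Scope classical_set_scope.
Local Open Scope ring_scope.

(** Uniqueness fails because collisions can accumulate at time 0, so that no first
    collision decides between two continuations.

    The initial density consists of infinitely many disjoint smooth bumps, the
    blobs, which shrink towards the origin as their index [k] grows.  Each blob
    contracts to a point by time [tau k] while its centre moves with constant
    velocity.  In the free flow ([free_path]) this goes on for ever: the points
    never meet ([centres_never_meet]), and the sticky condition is void between
    different blobs.  In the merging flow ([merging_path]) all blobs of index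
    greater than [k] travel together as one cluster shortly before time
    [hit k = T / 2 ^ k]; at that time blob [k] hits the cluster and joins it.
    The two requirements that blob and cluster arrive at the same point
    ([cluster_arrival]) and that momentum is conserved ([cluster_momentum])
    determine the velocities and centres of all blobs once the collisions are
    placed along a planar curve.  That the resulting centres never meet in the
    free motion is the delicate point: for consecutive blobs it holds because the
    cluster has positive mass, whence [2 < gain k].  Whether the cascade of
    collisions has begun cannot be read off the initial data, so both flows solve
    the same Cauchy problem; at time [T] the merging flow has all its mass in one
    point and the free flow has not ([flows_differ]).

    The masses decay faster than any power of the radii ([mass_flat]), so the
    density is smooth also at the origin, where the blobs accumulate
    ([smooth_blob_sum]); the velocities tend to 0, so the velocity field is
    continuous there ([continuous_blob_sum]).

    The labels form an arbitrary open set of measure 1.  Cutting it into dyadic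
    cubes and mapping each affinely onto the unit cube gives a uniform label
    ([unit_label_uniform]); its first coordinate selects the blob, and quantile
    functions turn its coordinates into a position in the blob ([integral_blob]).

    Both flows are instances of [blob_flow], for which the weak formulation is an
    orthogonality relation that can be checked blob by blob
    ([orthogonal_blob_velocity]).  A blob that is still gathering keeps its initial
    velocity and contributes nothing; on a gathered blob test functions are
    constant and the internal motion has mean zero, which leaves the momentum
    exchanged with the other blobs, and these contributions cancel
    ([merging_momentum]).  Membership of the velocity in the completions of the
    test functions follows from the approximation of bounded Borel functions in
    L2 ([L2_approximation]). *)

(** * Differentiable functions and the flat exponential *)

Section Ck_calculus.
Context {R : realType}.

Section Ck_normed.
Context {V : normedModType R}.
Implicit Types f g : V -> R.

Lemma CkW k f : Ck k.+1 f -> Ck k f.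
Proof.
elim: k f => [|k IH] f [df Df].
  by move=> x; exact: differentiable_continuous.
by split => // u; exact/IH/Df.
Qed.

Lemma Ck_cst k (c : R) : Ck k (cst c : V -> R).
Proof.
elim: k c => [|k IH] c; first by move=> x; exact: cst_continuous.
split => [x|u]; first exact: differentiable_cst.
rewrite (_ : (fun x => _) = cst 0); first exact: IH.
by apply/funext => x; exact: derive_cst.
Qed.

Lemma CkD k f g : Ck k f -> Ck k g -> Ck k (fun x => f x + g x).
Proof.
elim: k f g => [|k IH] f g Cf Cg.
  by move=> x; apply: (@continuousD _ R^o); [exact: Cf|exact: Cg].
have [df Df] := Cf; have [dg Dg] := Cg; split => [x|u].
  exact: (differentiableD (df x) (dg x)).
rewrite (_ : (fun x => _) = (fun x => 'D_u f x + 'D_u g x)); first exact: IH (Df u) (Dg u).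
by apply/funext => x; apply: (deriveD (f := f) (g := g)); exact: diff_derivable.
Qed.

Lemma CkM k f g : Ck k f -> Ck k g -> Ck k (fun x => f x * g x).
Proof.
elim: k f g => [|k IH] f g Cf Cg.
  by move=> x; apply: continuousM; [exact: Cf|exact: Cg].
have [df Df] := Cf; have [dg Dg] := Cg; split => [x|u].
  exact: (differentiableM (df x) (dg x)).
rewrite (_ : (fun x => _) = (fun x => f x * 'D_u g x + g x * 'D_u f x)).
  by apply: CkD; apply: IH; [exact: CkW|exact: Dg|exact: CkW|exact: Df].
apply/funext => x; apply: (deriveM (f := f) (g := g)); exact: diff_derivable.
Qed.

Lemma Ck_sum k (I : Type) (s : seq I) (P : pred I) (f : I -> V -> R) :
  (forall i, P i -> Ck k (f i)) -> Ck k (fun x => \sum_(i <- s | P i) f i x).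
Proof.
move=> Cf; elim: s => [|i s IH].
  by under eq_fun do rewrite big_nil; exact: Ck_cst.
under eq_fun do rewrite big_cons.
by case: (boolP (P i)) => // Pi; apply: CkD => //; exact: Cf.
Qed.

Lemma Ck_prod k (I : Type) (s : seq I) (P : pred I) (f : I -> V -> R) :
  (forall i, P i -> Ck k (f i)) -> Ck k (fun x => \prod_(i <- s | P i) f i x).
Proof.
move=> Cf; elim: s => [|i s IH].
  by under eq_fun do rewrite big_nil; exact: Ck_cst.
under eq_fun do rewrite big_cons.
by case: (boolP (P i)) => // Pi; apply: CkM => //; exact: Cf.
Qed.

Lemma Ck_comp k (h : R -> R) f :
  smooth (h : R^o -> R) -> Ck k f -> Ck k (h \o f).
Proof.
elim: k h f => [|k IH] h f Ch Cf.
  by move=> x; apply: continuous_comp; [exact: Cf|exact: (Ch 0%N)].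
have [df Df] := Cf; split => [x|u].
  by apply: differentiable_comp => //; have [] := Ch 1%N.
rewrite (_ : (fun x => _) = (fun x => ((fun y => 'D_1 h y) \o f) x * 'D_u f x)).
  apply: CkM; last exact: Df.
  apply: IH; last exact: CkW.
  by move=> j; have [_] := Ch j.+1; exact.
apply/funext => x /=.
have dh : differentiable (h : R^o -> R) (f x) by have [] := Ch 1%N.
rewrite deriveE; last exact: differentiable_comp.
rewrite diff_comp//= -(deriveE u (df x)) -[X in 'd h _ X]mulr1.
by rewrite [LHS]linearZ -(deriveE (1 : R^o) dh) mulrC.
Qed.

Lemma Ck_linear k (f : {linear V -> R}) : continuous f -> Ck k (f : V -> R).
Proof.
move=> cf; case: k => [//|k]; split => [x|u].
  exact: linear_differentiable.
rewrite (_ : (fun x => _) = cst (f u)); first exact: Ck_cst.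
apply/funext => x; rewrite deriveE; last exact: linear_differentiable.
by rewrite diff_lin.
Qed.

(** A quadratic bound already forces a vanishing differential; it is how
    functions that are flat at a point are differentiated there. *)
Lemma quadratic_is_diff (f : V -> R) a C :
  (\forall x \near a, `|f x| <= C * `|x - a| ^+ 2) -> is_diff a f (cst 0).
Proof.
move=> fC.
have fa : f a = 0.
  have /= := nbhs_singleton fC; rewrite subrr normr0 expr0n mulr0 normr_le0.
  by move/eqP.
pose z : {linear V -> R} := \0.
have zc : continuous z by move=> x; exact: cst_continuous.
have fo : f \o shift a = cst (f a) + z +o_ (0 : V) id.
  apply/eqaddoP => _/posnumP[e].
  have C0 : 0 < `|C| + 1 by rewrite ltr_wpDl.
  have fC0 : \forall h \near (0 : V), `|f (h + a)| <= C * `|h| ^+ 2.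
    move: fC; rewrite (near_shift 0 a)/=; apply: filterS => h /=.
    by rewrite subr0 addrK.
  near=> h.
  have hC : `|h| <= e%:num / (`|C| + 1).
    near: h; apply: cvgr0_norm_le; last by rewrite divr_gt0.
    exact: cvg_id.
  rewrite (_ : (_ - _) h = f (h + a)); last first.
    by rewrite !fctE /= fa addr0 subr0.
  apply: (@le_trans _ _ (C * `|h| ^+ 2)); first by near: h.
  apply: (@le_trans _ _ ((`|C| + 1) * `|h| ^+ 2)).
    by rewrite ler_wpM2r ?sqr_ge0// (le_trans (ler_norm _))// lerDl.
  by rewrite expr2 mulrA ler_wpM2r// mulrC -ler_pdivlMr.
have da := diff_unique zc fo.
apply: DiffDef; last by rewrite da; apply/funext.
by apply/diff_locallyP; rewrite da; split.
Unshelve. all: by end_near. Qed.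

Lemma Ck_near_is_diff k f a :
  (exists2 g, Ck k.+1 g & \forall x \near a, f x = g x) -> differentiable f a.
Proof.
case=> g [dg _] fg.
have nfg : (\forall h \near (0 : V), f (h + a) = g (h + a)).
  by move: fg; rewrite (near_shift 0 a)/=; apply: filterS => h /=; rewrite subr0.
have fo : f \o shift a = cst (f a) + 'd g a +o_ (0 : V) id.
  have /diff_locally/eqaddoP go := dg a.
  apply/eqaddoP => e e0; have := go e e0.
  apply: filterS2 nfg => h fgh; rewrite /= !fctE /= fgh.
  by rewrite (nbhs_singleton fg).
have dfc := @diff_continuous _ _ _ _ _ (dg a).
apply/diff_locallyP; have -> := diff_unique dfc fo; split => //.
Qed.

End Ck_normed.

Lemma Ck_comp_linear {V W : normedModType R} k (l : {linear V -> W}) (f : W -> R) :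
  continuous l -> Ck k f -> Ck k (f \o l).
Proof.
move=> cl; elim: k f => [|k IH] f Cf.
  by move=> x; apply: continuous_comp; [exact: cl|exact: Cf].
have [df Df] := Cf; split => [x|u].
  by apply: differentiable_comp => //; exact: linear_differentiable.
rewrite (_ : (fun x => _) = (fun y => 'D_(l u) f y) \o l); first exact/IH/Df.
have dl x : differentiable l x by exact: linear_differentiable.
apply/funext => x; rewrite deriveE; last exact: differentiable_comp.
by rewrite diff_comp// diff_lin//= deriveE.
Qed.

Lemma Ck_coord n k (i : 'I_n) : Ck k (fun x : 'rV[R]_n => x ord0 i).
Proof.
have @f : {linear 'rV[R]_n -> R}.
  by exists (fun N : 'rV[R]_n => N ord0 i); do 2![eexists]; do ?[constructor];
     rewrite ?mxE// => ? *; rewrite ?mxE//; move=> ?; rewrite !mxE.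
by rewrite (_ : (fun _ => _) = f)//; apply: Ck_linear; exact: coord_continuous.
Qed.

Lemma smooth_affine (a b : R) : smooth (fun x : R^o => a * x + b).
Proof.
move=> k; apply: CkD; last exact: Ck_cst.
apply: (CkM (f := cst a)); first exact: Ck_cst.
by apply: (@Ck_linear _ k idfun) => x; exact: cvg_id.
Qed.

End Ck_calculus.

Section flat_function.
Context {R : realType}.

(** The derivatives of [exp (-1/x)] are combinations of these functions, so
    the family as a whole is smooth. *)
Definition flat_exp (j : nat) (x : R) : R :=
  if 0 < x then x^-1 ^+ j * expR (- x^-1) else 0.

Lemma flat_exp_ge0 j x : 0 <= flat_exp j x.
Proof.
rewrite /flat_exp; case: ifPn => // x0.
by rewrite mulr_ge0 ?expR_ge0// exprn_ge0// invr_ge0 ltW.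
Qed.

Lemma flat_exp_gt0 j x : (0 < flat_exp j x) = (0 < x).
Proof.
rewrite /flat_exp; case: ifPn => [x0|]; last by rewrite ltxx; move/negbTE.
by rewrite mulr_gt0 ?expR_gt0// exprn_gt0// invr_gt0.
Qed.

(** Term [j + 2] of the exponential series at [x^-1] beats [x^-1 ^+ j]. *)
Lemma flat_exp_sqr j x : flat_exp j x <= (j.+2)`!%:R * x ^+ 2.
Proof.
rewrite /flat_exp; case: ifPn => [x0|_]; last by rewrite mulr_ge0// sqr_ge0.
have y0 : 0 <= x^-1 by rewrite invr_ge0 ltW.
have := expR_ge1Dxn j.+1 y0; set F : R := _%:R => h.
have F0 : 0 < F by rewrite ltr0n fact_gt0.
have e0 := expR_gt0 x^-1.
rewrite expRN ler_pdivrMr//.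
have : x^-1 ^+ j.+2 / F <= expR x^-1 by rewrite (le_trans _ h)// lerDr.
rewrite ler_pdivrMr// => h2.
rewrite mulrAC -ler_pdivrMr ?exprn_gt0// -exprVn -exprD addn2.
by rewrite mulrC.
Qed.

(** At 0 the quadratic bound gives the derivative. *)
Lemma is_derive_flat_exp j x :
  is_derive x (1 : R) (flat_exp j) (flat_exp j.+2 x - j%:R * flat_exp j.+1 x).
Proof.
have [x0|x0|x0] := ltgtP x 0.
- apply: (@near_eq_is_derive _ _ _ (cst 0)); last first.
    apply: is_derive_eq; rewrite /flat_exp !ifF; last 2 first.
    + by apply/negbTE; rewrite -leNgt ltW.
    + by apply/negbTE; rewrite -leNgt ltW.
    by rewrite mulr0 subr0.
  near=> y; rewrite /flat_exp ifF//; apply/negbTE; rewrite -leNgt ltW//.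
  by near: y; exact: lt_nbhsl.
- have xn0 : x != 0 by rewrite gt_eqF.
  apply: (@near_eq_is_derive _ _ _ (fun y : R => y^-1 ^+ j * expR (- y^-1))).
    near=> y; rewrite /flat_exp ifT//.
    by near: y; exact: lt_nbhsr.
  have dV : is_derive x (1:R) (fun y : R => y^-1) (- x^-1 ^+ 2).
    have := @is_deriveV R (@id R) x 1 1 xn0 _.
    rewrite (_ : - x ^- 2 *: (1 : R) = - x^-1 ^+ 2); last first.
      by rewrite -[LHS]/(_ * _) mulr1 exprVn.
    by apply.
  have dE : is_derive x (1 : R) (fun y : R => expR (- y^-1)) (x^-1 ^+ 2 * expR (- x^-1)).
    have dNV := @is_deriveN _ _ _ _ x 1 _ dV.
    have := @is_derive1_comp _ expR _ x _ _ (is_derive_expR _) dNV.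
    by move/is_derive_eq; apply; rewrite opprK mulrC.
  have dX : is_derive x (1 : R) (fun y : R => y^-1 ^+ j) (- (j%:R * x^-1 ^+ j.+1)).
    case: j => [|j].
      apply: is_derive_eq; last by rewrite mul0r oppr0.
      by under eq_fun do rewrite expr0; exact: is_derive_cst.
    rewrite (_ : (fun y => _) = (fun y : R => y^-1) ^+ j.+1); last first.
      by apply/funext => y; rewrite exprfctE.
    have := @is_deriveX _ _ _ j.+1 x 1 _ dV.
    move/is_derive_eq; apply; rewrite -[LHS]/(_ * _) /= mulrN -mulrA -exprD addn2.
    by [].
  have := @is_deriveM _ _ _ _ x 1 _ _ dX dE.
  move/is_derive_eq; apply.
  rewrite /flat_exp !ifT// -[X in X + _]/(_ * _) -[X in _ + X]/(_ * _).
  by rewrite !exprS; ring.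
- rewrite x0 /flat_exp !ltxx mulr0 subr0.
  have := @quadratic_is_diff R R^o (flat_exp j) 0 (j.+2)`!%:R.
  case.
    near=> y; rewrite ger0_norm ?flat_exp_ge0// subr0 real_normK ?num_real//.
    exact: flat_exp_sqr.
  move=> df dv; apply: DeriveDef; first exact: diff_derivable.
  by rewrite deriveE// dv.
Unshelve. all: by end_near. Qed.

Lemma smooth_flat_exp j : smooth (flat_exp j : R^o -> R).
Proof.
move=> k; elim: k j => [|k IH] j.
  move=> x; apply: differentiable_continuous; apply/derivable1_diffP.
  by have [] := is_derive_flat_exp j x.
split => [x|u].
  by apply/derivable1_diffP; have [] := is_derive_flat_exp j x.
rewrite (_ : (fun x => _) =
  fun x => u * (flat_exp j.+2 x + (- j%:R) * flat_exp j.+1 x)).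
  apply: (CkM (f := cst u)); first exact: Ck_cst.
  apply: CkD; first exact: IH.
  by apply: (CkM (f := cst _)); [exact: Ck_cst|exact: IH].
apply/funext => x; have [df dv] := is_derive_flat_exp j x.
have df' : differentiable (flat_exp j : R^o -> R) x by exact/derivable1_diffP.
rewrite deriveE// -[X in 'd _ _ X]mulr1 [LHS]linearZ -(deriveE (1 : R^o) df').
by rewrite dv mulNr.
Qed.

End flat_function.

(** * Gluing functions along disjoint blobs *)

Section glue.
Context {T : Type} {V : zmodType}.
Implicit Types (S : nat -> set T) (f : nat -> T -> V).

Definition glue S f (x : T) : V :=
  let k := xget 0%N (fun k => S k x) in if `[< S k x >] then f k x else 0.

Lemma glueE S f k x : (forall i j, S i x -> S j x -> i = j) -> S k x ->
  glue S f x = f k x.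
Proof.
move=> tS Skx; rewrite /glue.
have -> : xget 0%N (fun k => S k x) = k by case: xgetP => [j _ Sj|/(_ k)//]; exact: tS Sj Skx.
by rewrite asboolT.
Qed.

Lemma glue0 S f x : (forall k, ~ S k x) -> glue S f x = 0.
Proof. by move=> nS; rewrite /glue asboolF. Qed.

Lemma glueP S f x : (exists2 k, S k x & glue S f x = f k x) \/
  ((forall k, ~ S k x) /\ glue S f x = 0).
Proof.
rewrite /glue; case: xgetP => [k kE Skx|nS].
  by left; exists k => //; rewrite asboolT.
by right; split => [k /nS//|]; rewrite asboolF//; exact: nS.
Qed.

Lemma glue_sum S f x N : (forall i j, S i x -> S j x -> i = j) ->
  (forall k, ~ S k x -> f k x = 0) -> (forall k, S k x -> (k < N)%N) ->
  glue S f x = \sum_(k < N) f k x.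
Proof.
move=> tS f0 SN; have [[k Skx ->]|[nS ->]] := glueP S f x; last first.
  by rewrite big1// => k _; exact/f0/nS.
rewrite (bigD1 (Ordinal (SN _ Skx)))//= big1 ?addr0// => j jk; apply: f0 => Sj.
by move/eqP: jk; apply; apply: val_inj; exact: tS.
Qed.

End glue.

Lemma measurable_glue {R : realType} d (T : measurableType d) (D : set T)
    (S : nat -> set T) (f : nat -> T -> R) : measurable D ->
  (forall k, measurable (D `&` S k)) -> (forall k, measurable_fun D (f k)) ->
  (forall x i j, D x -> S i x -> S j x -> i = j) ->
  measurable_fun D (glue S f).
Proof.
move=> mD mS mf tS _ Y mY.
rewrite (_ : D `&` _ = \bigcup_k ((D `&` S k) `&` (D `&` f k @^-1` Y)) `|`
    (if `[< Y 0 >] then D `\` \bigcup_k (D `&` S k) else set0)); last first.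
  apply/seteqP; split => x.
    move=> [Dx]; rewrite /preimage/=.
    have [[k Skx ->] Yx|[nS ->] Y0] := glueP S f x; first by left; exists k.
    by right; rewrite asboolT//; split => // -[k _ [_ /nS]].
  case=> [[k _ [[Dx Skx] [_ Yx]]]|].
    by split => //=; rewrite (glueE _ (fun i j => tS x i j Dx) Skx).
  case: asboolP => // Y0 [Dx nS]; split => //=; rewrite glue0// => k Skx.
  by apply: nS; exists k.
apply: measurableU.
  by apply: bigcupT_measurable => k; apply: measurableI => //; exact: mf.
case: asboolP => // _; apply: measurableD => //.
exact: bigcupT_measurable.
Qed.

Lemma measurable_select {R : realType} d (S : measurableType d) (idx : S -> nat)
    (f : nat -> S -> R) : (forall k, measurable [set p | idx p = k]) ->
  (forall k, measurable_fun setT (f k)) -> measurable_fun setT (fun p => f (idx p) p).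
Proof.
move=> mi mf; rewrite (_ : (fun p => _) = glue (fun k => [set p | idx p = k]) f).
  by apply: measurable_glue => //= [k|p j k _ <- <-//]; rewrite setTI.
by apply/funext => p; rewrite (glueE _ (k := idx p))//= => j k <- <-.
Qed.

Lemma closed_norm_le {R : realType} n (M : R) :
  closed [set x : 'rV[R]_n | `|x| <= M].
Proof.
apply: (@closed_comp _ _ (Num.norm : 'rV[R]_n -> R) [set y | y <= M]).
  by move=> x _; exact: norm_continuous.
exact: closed_le.
Qed.

Lemma compact_norm_le {R : realType} n (M : R) :
  compact [set x : 'rV[R]_n | `|x| <= M].
Proof.
apply: bounded_closed_compact; last exact: closed_norm_le.
exists M; split; first exact: num_real.
by move=> y My x /= xM; rewrite (le_trans xM)// ltW.
Qed.

Section blob_sums.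
Context {R : realType} {n : nat}.
Variables (a : nat -> 'rV[R]_n) (r : nat -> R) (c0 C0 : R).
Local Notation S := (fun k => [set x | `|x - a k| < 2 * r k]).
Hypothesis r0 : forall k, 0 < r k.
Hypothesis cvr : r @ \oo --> (0 : R).
Hypothesis c00 : 0 < c0.
Hypothesis S_far : forall k x, S k x -> c0 * r k <= `|x|.
Hypothesis S_near : forall k x, S k x -> `|x| <= C0 * r k.
Hypothesis S_disj : forall x i j, S i x -> S j x -> i = j.

Lemma blob_not0 k : ~ S k 0.
Proof.
by move=> /S_far; rewrite normr0 leNgt mulr_gt0.
Qed.

(** Blob [k] lies within [C0 * r k] of the origin, so near any other point only
    finitely many blobs are seen. *)
Lemma blob_index_bounded (x : 'rV[R]_n) : x != 0 ->
  exists N, \forall z \near x, forall k, S k z -> (k < N)%N.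
Proof.
move=> x0; have nx : 0 < `|x| / 2 by rewrite divr_gt0 ?normr_gt0.
have C10 : 0 < `|C0| + 1 by rewrite ltr_wpDl.
have /cvgrPdist_lt/(_ (`|x| / 2 / (`|C0| + 1))) := cvr.
rewrite divr_gt0// => /(_ isT) [N _ rN].
exists N; near=> z => k Skz; rewrite ltnNge; apply/negP => Nk.
have := rN k Nk; rewrite sub0r normrN gtr0_norm// ltr_pdivlMr// => h1.
have h2 := S_near Skz.
have h3 : `|x| / 2 < `|z|.
  have : `|x - z| < `|x| / 2.
    by near: z; apply: cvgr_dist_lt => //; exact: cvg_id.
  have := lerB_dist x z; lra.
have : C0 * r k <= r k * (`|C0| + 1).
  rewrite mulrC ler_wpM2l//; first exact: ltW.
  by rewrite (le_trans (ler_norm C0))// lerDl.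
lra.
Unshelve. all: by end_near. Qed.

Section smooth_blobs.

Definition rapidly_decreasing (c : nat -> R) :=
  forall N : nat, exists C, forall k, `|c k| <= C * r k ^+ N.

Lemma rapidly_decreasing_div c : rapidly_decreasing c ->
  rapidly_decreasing (fun k => c k / r k).
Proof.
move=> rc N; have [C hC] := rc N.+1; exists C => k.
by rewrite normrM normfV (gtr0_norm (r0 k)) ler_pdivrMr// -mulrA -exprSr.
Qed.

Definition unit_supported (G : 'rV[R]_n -> R) := forall x, 1 < `|x| -> G x = 0.

Definition blob_term (c : nat -> R) (G : 'rV[R]_n -> R) k x :=
  c k * G ((r k)^-1 *: (x - a k)).

Lemma blob_term0 c G k x : unit_supported G -> ~ S k x -> blob_term c G k x = 0.
Proof.
move=> sG /negP; rewrite -leNgt => h; rewrite /blob_term sG ?mulr0//.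
rewrite normrZ normfV (gtr0_norm (r0 k)) mulrC ltr_pdivlMr//.
by have := r0 k; lra.
Qed.

Lemma is_diff_blob_chart k x :
  is_diff x (fun x => (r k)^-1 *: (x - a k)) ( *:%R (r k)^-1).
Proof.
have h : is_diff x (id - cst (a k)) (id - 0) by exact: is_diffB.
have := @is_diff_comp _ _ _ _ _ _ _ _ x h (is_diff_scaler (r k)^-1 (x - a k)).
rewrite (_ : _ \o (id - 0) = *:%R (r k)^-1)//.
by apply/funext => y /=; rewrite !fctE subr0.
Qed.

Lemma Ck_blob_term m c G k : smooth G -> Ck m (blob_term c G k).
Proof.
move=> sG; apply: (CkM (f := cst _)); first exact: Ck_cst.
elim: m G sG => [|m IH] G sG.
  move=> x; apply: continuous_comp; last exact: (sG 0%N).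
  by case: (is_diff_blob_chart k x) => /differentiable_continuous.
have da := is_diff_blob_chart k.
split => [x|u].
  by apply: differentiable_comp => //; have [] := sG 1%N.
rewrite (_ : (fun x => _) =
    fun x => (r k)^-1 * (fun y => 'D_u G y) ((r k)^-1 *: (x - a k))).
  apply: (CkM (f := cst _)); first exact: Ck_cst.
  by apply: (IH ('D_u G)) => j; have [_] := sG j.+1; exact.
apply/funext => x.
have dG : differentiable G ((r k)^-1 *: (x - a k)) by have [] := sG 1%N.
rewrite deriveE; last by apply: differentiable_comp.
rewrite (@diff_comp _ _ _ _ (fun x => (r k)^-1 *: (x - a k)) G)//= diff_val.
by rewrite linearZ/= deriveE.
Qed.

Lemma derive_blob_term c G k u x : smooth G ->
  'D_u (blob_term c G k) x = blob_term (fun k => c k / r k) ('D_u G) k x.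
Proof.
move=> sG.
have da := is_diff_blob_chart k x.
have dG : differentiable G ((r k)^-1 *: (x - a k)) by have [] := sG 1%N.
have dGa : differentiable (fun x => G ((r k)^-1 *: (x - a k))) x.
  by apply: (@differentiable_comp _ _ _ _ (fun x => (r k)^-1 *: (x - a k)) G).
rewrite /blob_term.
rewrite (_ : (fun x => _) = c k *: (fun x => G ((r k)^-1 *: (x - a k))))//.
rewrite deriveZ; last exact: diff_derivable.
rewrite deriveE//.
rewrite (@diff_comp _ _ _ _ (fun x => (r k)^-1 *: (x - a k)) G)//= diff_val.
by rewrite linearZ/= deriveE// -[LHS]/(_ * (_ * _)) mulrA.
Qed.

Lemma unit_supported_derive G u : unit_supported G ->
  unit_supported ('D_u G).
Proof.
move=> sG x x1; rewrite (@near_eq_derive _ _ _ G (cst 0) x u) ?derive_cst//.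
near=> y; apply: sG; near: y.
by apply: (cvgr_gt `|x|) => //; apply: cvg_norm; exact: cvg_id.
Unshelve. all: by end_near. Qed.

Lemma unit_supported_bounded G : continuous G -> unit_supported G ->
  exists B, forall x, `|G x| <= B.
Proof.
move=> cG sG.
have [|||c _ hc] := @EVT_max_rV R n (fun x => `|G x|) [set x | `|x| <= 1].
- by exists 0 => /=; rewrite normr0.
- exact: compact_norm_le.
- apply: continuous_subspaceT => x.
  by apply: (continuous_comp (cG x)); exact: norm_continuous.
exists `|G c| => x; have [x1|x1] := leP `|x| 1; last by rewrite sG// normr0.
by apply: hc; rewrite inE.
Qed.

(** At the origin: blob [k] stays [c0 * r k] away and its term is of size
    [r k ^+ 2], so the sum is at most quadratic.  Elsewhere it is locally finite. *)
Lemma differentiable_blob_sum c G x u : rapidly_decreasing c -> smooth G ->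
  unit_supported G -> differentiable (glue S (blob_term c G)) x /\
  'D_u (glue S (blob_term c G)) x =
    glue S (blob_term (fun k => c k / r k) ('D_u G)) x.
Proof.
move=> rc sG uG; have [->|x0] := eqVneq x 0.
  have [B hB] := unit_supported_bounded (sG 0%N) uG.
  have [C hC] := rc 2%N.
  have B0 : 0 <= B by apply: le_trans (hB 0).
  have C_0 : 0 <= C.
    by have := le_trans (normr_ge0 _) (hC 0%N); rewrite pmulr_lge0// exprn_gt0.
  have h : is_diff 0 (glue S (blob_term c G)) (cst 0).
    apply: (@quadratic_is_diff _ _ _ _ (C * B / c0 ^+ 2)).
    near=> z; rewrite subr0.
    have [[k Sk ->]|[_ ->]] := glueP S (blob_term c G) z; last first.
      by rewrite normr0 !mulr_ge0// ?invr_ge0 sqr_ge0.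
    rewrite /blob_term normrM.
    apply: (@le_trans _ _ (C * r k ^+ 2 * B)).
      by rewrite ler_pM.
    have := S_far Sk => hz.
    have hz2 : (c0 * r k) ^+ 2 <= `|z| ^+ 2.
      by rewrite ler_pXn2r// nnegrE// mulr_ge0// ltW.
    rewrite mulrAC -!mulrA ler_wpM2l// ler_wpM2l// mulrC ler_pdivlMr ?exprn_gt0//.
    by rewrite -exprMn mulrC.
  case: (h) => h1 h2; split => //; rewrite deriveE// h2 glue0// => k.
  exact: blob_not0.
have [N hN] := blob_index_bounded x0.
have fsum c' G' : unit_supported G' -> \forall z \near x,
    glue S (blob_term c' G') z = \sum_(k < N) blob_term c' G' k z.
  move=> uG'; near=> z; apply: glue_sum.
  - by move=> i j; exact: S_disj.
  - by move=> k; exact: blob_term0.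
  - by near: z.
have Ct k : Ck 1 (blob_term c G k) by exact: Ck_blob_term.
split.
  apply: Ck_near_is_diff; exists (fun z => \sum_(k < N) blob_term c G k z).
    by apply: Ck_sum => k _; exact: Ct.
  exact: fsum.
rewrite (near_eq_derive u (fsum c G uG)).
rewrite (nbhs_singleton (fsum _ _ (unit_supported_derive u uG))).
rewrite (_ : (fun z => _) = \sum_(k < N) blob_term c G k); last first.
  by apply/funext => z; rewrite fct_sumE.
rewrite derive_sum; last by move=> k; apply: diff_derivable; have [] := Ct k.
by apply: eq_bigr => k _; exact: derive_blob_term.
Unshelve. all: by end_near. Qed.

(** The derivatives are sums of the same kind with [c k / r k] in place of [c k],
    and rapid decrease survives this division. *)
Lemma smooth_blob_sum c G : rapidly_decreasing c -> smooth G ->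
  unit_supported G -> smooth (glue S (blob_term c G)).
Proof.
move=> rc sG uG m; elim: m c G rc sG uG => [|m IH] c G rc sG uG.
  move=> x; apply: differentiable_continuous.
  by have [] := differentiable_blob_sum x 0 rc sG uG.
split => [x|u]; first by have [] := differentiable_blob_sum x 0 rc sG uG.
rewrite (_ : (fun x => _) = glue S (blob_term (fun k => c k / r k) ('D_u G))).
  apply: IH; first exact: rapidly_decreasing_div.
    by move=> j; have [_] := sG j.+1; exact.
  exact: unit_supported_derive.
by apply/funext => x; have [_] := differentiable_blob_sum x u rc sG uG.
Qed.

End smooth_blobs.

(** Blobs of vectors of size [O(b k)] with [b k] tending to 0 add up to a
    field that is continuous at the accumulation point as well. *)
Lemma continuous_blob_sum (w : nat -> 'rV[R]_n -> 'rV[R]_n) (b : nat -> R) :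
  b @ \oo --> (0 : R) -> (forall k, continuous (w k)) ->
  (forall k x, ~ S k x -> w k x = 0) ->
  (forall k x, S k x -> `|w k x| <= b k) ->
  continuous (glue S w).
Proof.
move=> cvb cw w0 wb x; have [->|x0] := eqVneq x 0; last first.
  have [N hN] := blob_index_bounded x0.
  have fsum : \forall z \near x, \sum_(k < N) w k z = glue S w z.
    near=> z; apply/esym/glue_sum.
    - by move=> i j; exact: S_disj.
    - by move=> k; exact: w0.
    - by near: z.
  rewrite /continuous_at -(nbhs_singleton fsum).
  apply: cvg_trans; first exact: (near_eq_cvg fsum).
  have cs M : continuous (fun z => \sum_(k < M) w k z).
    elim: M => [|M IH] z.
      rewrite (_ : (fun z => _) = cst 0); first exact: cst_continuous.
      by apply/funext => y; rewrite big_ord0.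
    rewrite (_ : (fun z => _) = fun y => \sum_(k < M) w k y + w M y).
      by apply: continuousD; [exact: IH|exact: cw].
    by apply/funext => y; rewrite big_ord_recr.
  exact: cs.
rewrite /continuous_at glue0; last by move=> k; exact: blob_not0.
apply/(@cvgr0Pnorm_lt _ _ _ (nbhs (0 : 'rV[R]_n))) => e e0.
have /cvgrPdist_lt/(_ e e0) [N _ bN] := cvb.
near=> z; have [[k Sk ->]|[_ ->]] := glueP S w z; last by rewrite normr0.
have [Nk|kN] := leqP N k.
  apply: le_lt_trans (wb _ _ Sk) _; apply: le_lt_trans (ler_norm _) _.
  by have := bN _ Nk; rewrite sub0r normrN.
exfalso; have := S_far Sk; apply/negP; rewrite -ltNge.
suff : `|z| < c0 * \big[Order.min/r 0%N]_(k < N) r k.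
  move=> /lt_le_trans; apply; rewrite ler_pM2l//.
  by apply/bigmin_leP; right; exists (Ordinal kN).
near: z; apply: (cvgr0_norm_lt (fun x => x)); first exact: cvg_id.
rewrite mulr_gt0//; elim/big_ind : _ => // p q p0 q0.
by rewrite lt_min p0.
Unshelve. all: by end_near. Qed.

Lemma compactly_supported_blob_sum (W : zmodType) (f : nat -> 'rV[R]_n -> W) :
  compactly_supported (glue S f).
Proof.
have [M hM] : exists M, forall k, r k <= M.
  have /cvgP/cvg_seq_bounded/bounded_fun_has_ubound [M hM] := cvr.
  by exists M => k; apply: hM; exists k.
have C00 : 0 <= C0 \/ forall x k, ~ S k x.
  have [C_0|C_0] := leP 0 C0; [by left|right => x k Sk].
  have := le_trans (normr_ge0 _) (S_near Sk).
  by rewrite leNgt nmulr_rlt0// r0.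
apply: subclosed_compact (@compact_norm_le _ _ (C0 * M)) _.
  exact: closed_closure.
have /closure_id -> := @closed_norm_le R n (C0 * M).
apply: closure_subset => x /=.
have [[k Sk _] _|[_ ->]] := glueP S f x; last by rewrite eqxx.
case: C00 => [C_0|/(_ x k)//]; apply: le_trans (S_near Sk) _.
by rewrite ler_wpM2l.
Qed.

End blob_sums.

(** * L2 approximation by test functions *)

Section L2_approximation.
Context {R : realType} d (S : measurableType d).
Variables (mu : {measure set S -> \bar R}) (D : set S).
Hypotheses (mD : measurable D) (muD : (mu D < +oo)%E).
Context {V : normedModType R} {N : nat}.
Variables (c : 'I_N -> V -> R) (H : S -> V).
Hypothesis Cc : forall i, Ck 1 (c i).
Hypothesis mH : forall i, measurable_fun D (fun p => c i (H p)).
Implicit Types (f phi : V -> R) (A : set V).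

(** Compactness of the support, in the form that the induction needs: the sets
    on which all [c i] are bounded are assumed compact at the very end. *)
Definition c_bounded phi := exists M, forall v, phi v != 0 ->
  forall i, `|c i v| <= M.

Definition L2_approximable f := measurable_fun D (f \o H) /\
  forall e : R, 0 < e -> exists phi,
    [/\ Ck 1 phi, c_bounded phi, measurable_fun D (phi \o H) &
     (\int[mu]_(p in D) ((f (H p) - phi (H p)) ^+ 2)%:E <= e%:E)%E].

Lemma measurable_sqr_sub (f g : S -> R) : measurable_fun D f ->
  measurable_fun D g -> measurable_fun D (fun p => ((f p - g p) ^+ 2)%:E).
Proof.
move=> mf mg; apply/measurable_EFinP; apply: measurable_funX.
exact: measurable_funB.
Qed.

Lemma L2_triangle (f g h : S -> R) (a b : R) : measurable_fun D f ->
  measurable_fun D g -> measurable_fun D h ->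
  (\int[mu]_(p in D) ((f p - g p) ^+ 2)%:E <= a%:E)%E ->
  (\int[mu]_(p in D) ((g p - h p) ^+ 2)%:E <= b%:E)%E ->
  (\int[mu]_(p in D) ((f p - h p) ^+ 2)%:E <= (2 * a + 2 * b)%:E)%E.
Proof.
move=> mf mg mh fg gh.
apply: (@le_trans _ _ (\int[mu]_(p in D)
    (2%:E * ((f p - g p) ^+ 2)%:E + 2%:E * ((g p - h p) ^+ 2)%:E))%E).
  apply: ge0_le_integral => //.
  - by move=> p _; rewrite lee_fin sqr_ge0.
  - exact: measurable_sqr_sub.
  - by apply: emeasurable_funD; apply: measurable_funeM; exact: measurable_sqr_sub.
  - move=> p _; rewrite -!EFinM -EFinD lee_fin.
    have := sqr_ge0 ((f p - g p) - (g p - h p)).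
    rewrite -subr_ge0 => h0; rewrite -subr_ge0; apply: le_trans h0 _.
    by rewrite le_eqVlt; apply/orP; left; apply/eqP; ring.
rewrite ge0_integralD//; last 4 first.
- by move=> p _; rewrite mule_ge0// lee_fin// sqr_ge0.
- by apply: measurable_funeM; exact: measurable_sqr_sub.
- by move=> p _; rewrite mule_ge0// lee_fin// sqr_ge0.
- by apply: measurable_funeM; exact: measurable_sqr_sub.
rewrite !ge0_integralZl_EFin//; last 4 first.
- by move=> p _; rewrite lee_fin sqr_ge0.
- exact: measurable_sqr_sub.
- by move=> p _; rewrite lee_fin sqr_ge0.
- exact: measurable_sqr_sub.
rewrite [leRHS](_ : _ = (2%:E * a%:E + 2%:E * b%:E)%E); last by rewrite -!EFinM.
by apply: leeD; rewrite lee_pmul2l.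
Qed.

Lemma L2_approximable_test phi : Ck 1 phi -> c_bounded phi ->
  measurable_fun D (phi \o H) -> L2_approximable phi.
Proof.
move=> Cp bp mp; split => // e e0; exists phi; split => //.
under eq_integral do rewrite subrr expr0n/=.
by rewrite integral0 lee_fin ltW.
Qed.

(** Dominated convergence. *)
Lemma L2_approximable_lim (f_ : nat -> V -> R) f (C : R) :
  (forall k, L2_approximable (f_ k)) -> measurable_fun D (f \o H) ->
  (forall k p, D p -> `|f (H p) - f_ k (H p)| <= C) ->
  (forall p, D p -> (fun k => f_ k (H p)) @ \oo --> f (H p)) ->
  L2_approximable f.
Proof.
move=> af mf bf cf; split => // e e0.
have mf_ k : measurable_fun D (f_ k \o H) by have [] := af k.
have [|||||_ h _] := @dominated_convergence _ _ _ mu D mD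
  (fun k p => ((f (H p) - f_ k (H p)) ^+ 2)%:E) (cst 0%E) (cst (C ^+ 2)%:E).
- by move=> k; exact: measurable_sqr_sub (mf_ k).
- exact: measurable_cst.
- apply: aeW => p Dp; apply: cvg_EFin; first by near=> k.
  rewrite (_ : _ \o _ = fun k => (f (H p) - f_ k (H p)) ^+ 2)//.
  rewrite [X in _ --> X](_ : _ = (f (H p) - f (H p)) * (f (H p) - f (H p))); last first.
    by rewrite subrr mulr0.
  under eq_fun do rewrite expr2.
  by apply: cvgM; (apply: cvgB; [exact: cvg_cst|exact: cf]).
- apply/integrableP; split; first exact: measurable_cst.
  under eq_integral do rewrite /= ger0_norm ?sqr_ge0//.
  by rewrite integral_cst// lte_mul_pinfty// lee_fin sqr_ge0.
- apply: aeW => p k Dp; rewrite /= lee_fin ger0_norm ?sqr_ge0//.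
  have ab := bf k p Dp; rewrite -real_normK ?num_real//.
  by rewrite ler_pXn2r// nnegrE// (le_trans (normr_ge0 _) ab).
move: h; under eq_fun do under eq_integral do rewrite sube0 gee0_abs ?lee_fin ?sqr_ge0//.
move=> /fine_cvgP[hf /cvgrPdist_lt/(_ (e / 4))].
rewrite divr_gt0// => /(_ isT) hl.
have [k [hk1 hk2]] : exists k, (\int[mu]_(p in D) ((f (H p) - f_ k (H p)) ^+ 2)%:E)%E
    \is a fin_num /\
    `|0 - fine (\int[mu]_(p in D) ((f (H p) - f_ k (H p)) ^+ 2)%:E)%E| < e / 4.
  have [M _ hM] := filterI hf hl.
  by exists M; have [] := hM M (leqnn M).
have e4 : 0 < e / 4 by rewrite divr_gt0.
have [_ /(_ _ e4)[phi [Cp bp mp hphi]]] := af k.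
exists phi; split => //.
have := L2_triangle mf (mf_ k) mp _ hphi; move/(_ (e / 4)).
rewrite (_ : 2 * (e / 4) + 2 * (e / 4) = e); last by field.
apply; rewrite -(fineK hk1) lee_fin; apply: le_trans (ltW hk2).
by rewrite sub0r normrN ler_norm.
Unshelve. all: by end_near. Qed.

Lemma c_boundedD f g : c_bounded f -> c_bounded g ->
  c_bounded (fun v => f v + g v).
Proof.
move=> [M hM] [K hK]; exists (Num.max M K) => v fg i; rewrite le_max.
have [f0|f0] := eqVneq (f v) 0; last by rewrite hM.
by rewrite hK ?orbT//; move: fg; rewrite f0 add0r.
Qed.

Lemma c_boundedZ a f : c_bounded f -> c_bounded (fun v => a * f v).
Proof.
by move=> [M hM]; exists M => v; rewrite mulf_eq0 negb_or => /andP[_]; exact: hM.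
Qed.

Lemma L2_approximableD f g : L2_approximable f -> L2_approximable g ->
  L2_approximable (fun v => f v + g v).
Proof.
move=> [mf af] [mg ag]; split; first exact: measurable_funD.
move=> e e0; have e4 : 0 < e / 4 by rewrite divr_gt0.
have [phi [Cp bp mp hp]] := af _ e4; have [psi [Cq bq mq hq]] := ag _ e4.
exists (fun v => phi v + psi v); split.
- exact: CkD.
- exact: c_boundedD.
- exact: measurable_funD.
have := @L2_triangle (fun p => f (H p) + g (H p)) (fun p => phi (H p) + g (H p))
  (fun p => phi (H p) + psi (H p)) (e / 4) (e / 4) _ _ _ _ _.
rewrite (_ : 2 * (e / 4) + 2 * (e / 4) = e); last by field.
apply; [exact: measurable_funD|exact: measurable_funD|exact: measurable_funD| |].
- apply: le_trans hp; rewrite le_eqVlt; apply/orP; left; apply/eqP.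
  by apply: eq_integral => p _; congr (_ ^+ 2)%:E; ring.
- apply: le_trans hq; rewrite le_eqVlt; apply/orP; left; apply/eqP.
  by apply: eq_integral => p _; congr (_ ^+ 2)%:E; ring.
Qed.

Lemma L2_approximableZ a f : L2_approximable f ->
  L2_approximable (fun v => a * f v).
Proof.
move=> [mf af]; split; first by apply: measurable_funM.
move=> e e0; have a0 : 0 < a ^+ 2 + 1 by rewrite ltr_wpDl// sqr_ge0.
have e4 : 0 < e / (a ^+ 2 + 1) by rewrite divr_gt0.
have [phi [Cp bp mp hp]] := af _ e4.
exists (fun v => a * phi v); split.
- by apply: (CkM (f := cst a)) => //; exact: Ck_cst.
- exact: c_boundedZ.
- by apply: measurable_funM.
under eq_integral.
  move=> p _; rewrite -mulrBr exprMn EFinM; over.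
rewrite ge0_integralZl_EFin ?sqr_ge0//; last 2 first.
- by move=> p _; rewrite lee_fin sqr_ge0.
- exact: measurable_sqr_sub.
apply: (@le_trans _ _ ((a ^+ 2)%:E * (e / (a ^+ 2 + 1))%:E)%E).
  by apply: lee_wpmul2l => //; rewrite lee_fin sqr_ge0.
rewrite -EFinM lee_fin mulrCA -[leRHS]mulr1 ler_wpM2l ?(ltW e0)//.
by rewrite ler_pdivrMr// mul1r lerDl.
Qed.

Definition coordinate_box (lo hi : 'I_N -> R) : set V :=
  [set v | forall i, lo i < c i v < hi i].

Definition coordinate_boxes : set (set V) :=
  [set A | exists lo hi, A = coordinate_box lo hi].

Lemma coordinate_boxI : setI_closed coordinate_boxes.
Proof.
move=> _ _ [l1 [h1 ->]] [l2 [h2 ->]].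
exists (fun i => Num.max (l1 i) (l2 i)), (fun i => Num.min (h1 i) (h2 i)).
apply/seteqP; split => v /=.
  move=> [b1 b2] i; rewrite gt_max lt_min.
  by have /andP[-> ->] := b1 i; have /andP[-> ->] := b2 i.
move=> b; split => i; have := b i; rewrite gt_max lt_min;
  by move=> /andP[/andP[? ?] /andP[? ?]]; apply/andP.
Qed.

Let cut (lo hi : 'I_N -> R) (v : V) : R :=
  \prod_(i < N) (flat_exp 0 (c i v - lo i) * flat_exp 0 (hi i - c i v)).

Lemma Ck_flat_cut k (i : 'I_N) a b : Ck k (c i) ->
  Ck k (fun v => flat_exp 0 (a * c i v + b)).
Proof.
move=> Ci; apply: (Ck_comp (h := flat_exp 0)); first exact: smooth_flat_exp.
apply: CkD; last exact: Ck_cst.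
by apply: (CkM (f := cst a)) => //; exact: Ck_cst.
Qed.

Lemma Ck_cut lo hi : Ck 1 (cut lo hi).
Proof.
apply: Ck_prod => i _; apply: CkM.
  have := @Ck_flat_cut 1 i 1 (- lo i) (Cc i).
  by under eq_fun do rewrite mul1r.
have := @Ck_flat_cut 1 i (-1) (hi i) (Cc i).
by under eq_fun do rewrite mulN1r addrC.
Qed.

Lemma cut_gt0 lo hi v : coordinate_box lo hi v -> 0 < cut lo hi v.
Proof.
move=> b; apply: prodr_gt0 => i _; have /andP[? ?] := b i.
by rewrite mulr_gt0// flat_exp_gt0 subr_gt0.
Qed.

Lemma cut_ge0 lo hi v : 0 <= cut lo hi v.
Proof. by apply: prodr_ge0 => i _; rewrite mulr_ge0// flat_exp_ge0. Qed.

Lemma cut0 lo hi v : ~ coordinate_box lo hi v -> cut lo hi v = 0.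
Proof.
move=> /existsNP[i /negP]; rewrite negb_and -!leNgt => h.
apply/eqP; rewrite /cut (bigD1 i)//= !mulf_eq0; apply/orP; left.
rewrite !eq_le !flat_exp_ge0 !andbT !leNgt !flat_exp_gt0 -!leNgt !subr_le0.
exact: h.
Qed.

Lemma measurable_cut lo hi : measurable_fun D (cut lo hi \o H).
Proof.
rewrite (_ : _ \o _ = fun p => \prod_(i < N)
  (flat_exp 0 (c i (H p) - lo i) * flat_exp 0 (hi i - c i (H p))))//.
have mfl : measurable_fun setT (flat_exp 0 : R -> R).
  by apply: continuous_measurable_fun; exact: (smooth_flat_exp 0 0).
apply: measurable_prod => i _; apply: measurable_funM.
  apply: (measurableT_comp mfl); apply: measurable_funB => //.
by apply: (measurableT_comp mfl); apply: measurable_funB => //.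
Qed.

(** [1 - expR (- k * cut)] is of class C^1, has values in [0, 1] and tends to the
    indicator function of the box as [k] grows. *)
Lemma L2_approximable_box lo hi :
  L2_approximable \1_(coordinate_box lo hi).
Proof.
pose phi k v : R := 1 - expR (- (k%:R * cut lo hi v)).
have phi01 k v : 0 <= phi k v <= 1.
  apply/andP; split; rewrite /phi; last by rewrite gerBl expR_ge0.
  by rewrite subr_ge0 expR_le1 oppr_le0 mulr_ge0// cut_ge0.
have mphi k : measurable_fun D (phi k \o H).
  apply: measurable_funB => //; apply: measurableT_comp => //.
  by apply: measurableT_comp => //; apply: measurable_funM => //; exact: measurable_cut.
have lphi v : phi k v @[k --> \oo] --> (\1_(coordinate_box lo hi) v : R).
  rewrite indicE; have [vb|vb] := pselect (coordinate_box lo hi v).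
    rewrite mem_set//= /phi -[X in _ --> X]subr0.
    apply: cvgB; first exact: cvg_cst.
    under eq_fun do rewrite -mulrN expRM_natl.
    by apply: cvg_expr; rewrite ger0_norm ?expR_ge0// expR_lt1 oppr_lt0 cut_gt0.
  rewrite memNset//= /phi cut0//.
  by under eq_fun do rewrite mulr0 oppr0 expR0 subrr; exact: cvg_cst.
apply: (@L2_approximable_lim phi _ 1).
- move=> k; apply: L2_approximable_test => //.
    rewrite /phi.
    have sexp : smooth (fun y : R^o => 1 + (-1) * expR (- k%:R * y + 0)).
      move=> j; apply: CkD; first exact: Ck_cst.
      apply: (CkM (f := cst (-1))); first exact: Ck_cst.
      apply: (Ck_comp (h := expR)); last exact: smooth_affine.
      elim=> [|i IH]; first exact: continuous_expR.
      split => [x|u]; first exact/derivable1_diffP/derivable_expR.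
      rewrite (_ : (fun x => _) = fun x => u * expR x).
        by apply: (CkM (f := cst u)) => //; exact: Ck_cst.
      apply/funext => x.
      have dx : differentiable (expR : R^o -> R) x.
        exact/derivable1_diffP/derivable_expR.
      rewrite deriveE// -[X in 'd _ _ X]mulr1 [LHS]linearZ.
      by rewrite -(deriveE (1 : R^o) dx) derive_val.
    have := Ck_comp sexp (Ck_cut lo hi).
    rewrite (_ : _ \o _ = fun v => 1 - expR (- (k%:R * cut lo hi v)))//.
    by apply/funext => v /=; rewrite mulN1r addr0 mulNr.
  exists (\sum_(i < N) (`|lo i| + `|hi i|)) => v.
  rewrite /phi; have [vb _ i|vb] := pselect (coordinate_box lo hi v); last first.
    by rewrite cut0// mulr0 oppr0 expR0 subrr eqxx.
  have /andP[h1 h2] := vb i.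
  rewrite (bigD1 i)//=; apply: (@le_trans _ _ (`|lo i| + `|hi i|)); last first.
    by rewrite lerDl sumr_ge0// => j _; rewrite addr_ge0.
  have := ler_norm (hi i); have := ler_norm (- lo i); rewrite normrN => a1 a2.
  rewrite ler_norml; apply/andP; split.
    by have := normr_ge0 (hi i); lra.
  by have := normr_ge0 (lo i); lra.
- rewrite (_ : _ \o H = fun p => limn (fun k => phi k (H p))); last first.
    by apply/funext => p /=; apply/esym/cvg_lim.
  apply: (measurable_fun_cvg (h := fun k => phi k \o H)).
    exact: mphi.
  by move=> p _; apply: cvgP; exact: lphi.
- move=> k p Dp; have /andP[h0 h1] := phi01 k (H p); rewrite indicE.
  by rewrite ler_norml; case: (_ \in _) => /=; apply/andP; split; lra.
- by move=> p _; exact: lphi.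
Qed.

Lemma L2_approximable_cst a : L2_approximable (cst a).
Proof.
rewrite (_ : cst a = fun v => a * (cst 1) v); last first.
  by apply/funext => v; rewrite /= mulr1.
apply: L2_approximableZ.
apply: (@L2_approximable_lim
  (fun k => \1_(coordinate_box (fun=> - k%:R) (fun=> k%:R))) _ 1).
- by move=> k; exact: L2_approximable_box.
- exact: measurable_cst.
- by move=> k p _; rewrite indicE/=; case: (_ \in _);
    rewrite ?subrr ?subr0 ?normr0 ?normr1.
- move=> p _ /=; apply: cvg_near_cst; near=> k.
  rewrite indicE mem_set//= => i; rewrite -ltr_norml.
  apply: (@le_lt_trans _ _ (\sum_(j < N) `|c j (H p)|)).
    by rewrite (bigD1 i)//= lerDl sumr_ge0.
  by near: k; exact: nbhs_infty_gtr.
Unshelve. all: by end_near. Qed.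

(** Dynkin's lemma: boxes form a pi-system, and complements and disjoint unions
    preserve approximability. *)
Lemma L2_approximable_indic A : <<s coordinate_boxes >> A ->
  L2_approximable \1_A.
Proof.
rewrite -(setI_closed_g_dynkin_g_sigma_algebra coordinate_boxI).
suff : <<d coordinate_boxes >> `<=` [set A | L2_approximable \1_A] by exact.
apply: smallest_sub; last first.
  by move=> _ [lo [hi ->]]; exact: L2_approximable_box.
have aC B : L2_approximable \1_B -> L2_approximable \1_(~` B).
  move=> aB; rewrite (_ : \1_(~` B) = fun v => cst 1 v + (-1) * \1_B v); last first.
    apply/funext => v; rewrite /= !indicE in_setC.
    by case: (_ \in _); rewrite /= ?mulr1 ?mulr0 ?subrr ?addr0.
  apply: L2_approximableD; first exact: L2_approximable_cst.
  exact: L2_approximableZ.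
split => [|B|F tF aF] /=.
- by rewrite indicT; exact: L2_approximable_cst.
- exact: aC.
- have aS k : L2_approximable (fun v => \sum_(i < k) \1_(F i) v).
    elim: k => [|k IH].
      rewrite (_ : (fun _ => _) = cst 0); first exact: L2_approximable_cst.
      by apply/funext => v; rewrite big_ord0.
    rewrite (_ : (fun _ => _) =
      fun v => (\sum_(i < k) \1_(F i) v) + \1_(F k) v); last first.
      by apply/funext => v; rewrite big_ord_recr.
    exact: (@L2_approximableD (fun v => \sum_(i < k) \1_(F i) v) \1_(F k) IH (aF k)).
  have lS v : \sum_(i < k) \1_(F i) v @[k --> \oo] --> (\1_(\bigcup_k F k) v : R).
    rewrite indicE; have [[j _ Fj]|nF] := pselect ((\bigcup_k F k) v).
      rewrite mem_set/=; last by exists j.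
      apply: cvg_near_cst; exists j.+1 => // k /= jk.
      rewrite (bigD1 (Ordinal jk))//= indicE mem_set//= big1 ?addr0// => i ij.
      rewrite indicE memNset//= => Fi; move/eqP : ij; apply; apply: val_inj => /=.
      by apply: (tF i j) => //; exists v.
    rewrite memNset//= (_ : (fun _ => _) = cst 0); first exact: cvg_cst.
    apply/funext => k; rewrite big1// => i _; rewrite indicE memNset//= => Fi.
    by apply: nF; exists i.
  have S01 k v : 0 <= (\sum_(i < k) \1_(F i) v : R) <= 1.
    rewrite sumr_ge0//=; have [[j _ Fj]|nF] := pselect ((\bigcup_k F k) v).
      have [jk|kj] := ltnP j k.
        rewrite (bigD1 (Ordinal jk))//= indicE mem_set//= big1 ?addr0// => i ij.
        rewrite indicE memNset//= => Fi; move/eqP : ij; apply; apply: val_inj => /=.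
        by apply: (tF i j) => //; exists v.
      rewrite big1// => i _; rewrite indicE memNset//= => Fi.
      have ij : nat_of_ord i = j by apply: (tF i j) => //; exists v.
      by have := ltn_ord i; rewrite ij ltnNge kj.
    rewrite big1// => i _; rewrite indicE memNset//= => Fi.
    by apply: nF; exists i.
  apply: (@L2_approximable_lim (fun k v => \sum_(i < k) \1_(F i) v) _ 1).
  + exact: aS.
  + rewrite (_ : _ \o H = fun p => limn (fun k => \sum_(i < k) \1_(F i) (H p) : R)).
      apply: (measurable_fun_cvg (h := fun k p => \sum_(i < k) \1_(F i) (H p) : R)).
        by move=> k; have [] := aS k.
      by move=> p _; apply: cvgP; exact: lS.
    by apply/funext => p /=; apply/esym/cvg_lim.
  + move=> k p Dp; have /andP[h0 h1] := S01 k (H p); rewrite indicE.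
    by rewrite ler_norml; case: (_ \in _) => /=; apply/andP; split; lra.
  + by move=> p _; exact: lS.
Qed.

Definition box_measurable f :=
  measurable_fun [set: g_sigma_algebraType coordinate_boxes] f.

Lemma box_measurable_coord i : box_measurable (c i).
Proof.
move=> mT; apply: (measurability _ (RGenInftyO.measurableE R)) => //.
move=> _ [_ [y ->] <-]; rewrite setTI.
rewrite (_ : _ @^-1` _ = \bigcup_k coordinate_box (fun=> - k%:R)
    (fun j => if j == i then y else k%:R)).
  apply: bigcupT_measurable => k; apply: sub_sigma_algebra.
  by exists (fun=> - k%:R), (fun j => if j == i then y else k%:R).
apply/seteqP; split => [v /=|v [k _ /(_ i)]]; last first.
  by rewrite eqxx /= in_itv/= => /andP[].
rewrite in_itv/= => vy.
have [k hk] : exists k : nat, \sum_(j < N) `|c j v| < k%:R.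
  by exists (Num.truncn (\sum_(j < N) `|c j v|)).+1; exact: truncnS_gt.
exists k => // j.
have : `|c j v| < k%:R.
  by apply: le_lt_trans hk; rewrite (bigD1 j)//= lerDl sumr_ge0.
rewrite ltr_norml => /andP[-> h]; case: eqP => [->|_]//.
Qed.

(** Replacing [f] by [f - (C / 2) sgn f] halves its bound, so bounded functions
    are uniform limits of combinations of approximable indicators. *)
Lemma L2_approximable_halving m f (C : R) : 0 <= C -> box_measurable f ->
  (forall v, `|f v| <= C) ->
  exists2 f', L2_approximable f' & forall v, `|f v - f' v| <= C / 2 ^+ m.
Proof.
elim: m f C => [|m IH] f C C0 mf fC.
  exists (cst 0); first exact: L2_approximable_cst.
  by move=> v; rewrite expr0 divr1 subr0.
pose A := [set v | 0 <= f v].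
have mA : <<s coordinate_boxes >> A.
  have := mf measurableT [set y | 0 <= y].
  rewrite setTI; apply.
  rewrite (_ : [set y | _] = `[0, +oo[%classic); first exact: measurable_itv.
  by apply/seteqP; split => y /=; rewrite in_itv/= andbT.
pose s v : R := C * \1_A v + (- (C / 2)).
have as_ : L2_approximable s.
  apply: L2_approximableD; last exact: L2_approximable_cst.
  by apply: L2_approximableZ; exact: L2_approximable_indic.
have ms : box_measurable s.
  apply: measurable_funD => //; apply: measurable_funM => //.
have [||v|f' af' hf'] := IH (fun v => f v - s v) (C / 2).
- by rewrite divr_ge0.
- exact: measurable_funB.
- have := fC v; rewrite /s indicE !ler_norml.
  have [Av|nAv] := pselect (A v).
    by rewrite mem_set//= => /andP[h1 h2]; move: Av; rewrite /A/= => ?; apply/andP; split; lra.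
  rewrite (memNset nAv)/=; move: nAv; rewrite /A/= => /negP.
  by rewrite -ltNge => ? /andP[h1 h2]; apply/andP; split; lra.
exists (fun v => f' v + s v); first exact: L2_approximableD.
move=> v; have := hf' v; rewrite exprS invfM mulrA.
by rewrite (_ : f v - s v - f' v = f v - (f' v + s v))//; ring.
Qed.

Lemma L2_approximable_bounded f (C : R) : box_measurable f ->
  measurable_fun D (f \o H) -> (forall v, `|f v| <= C) -> L2_approximable f.
Proof.
move=> mf mfH fC; have C0 : 0 <= C.
  have [v|nv] := pselect (exists v : V, True); last first.
    by have := fC 0; exact: le_trans.
  by have [v' _] := v; apply: le_trans (fC v').
have /choice [f_ hf_] : forall m, exists f', L2_approximable f' /\
    forall v, `|f v - f' v| <= C / 2 ^+ m.
  by move=> m; have [f' a b] := L2_approximable_halving m C0 mf fC; exists f'.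
apply: (@L2_approximable_lim f_ _ C).
- by move=> k; have [] := hf_ k.
- by [].
- move=> k p _; have [_ h] := hf_ k; apply: le_trans (h _) _.
  by rewrite ler_pdivrMr ?exprn_gt0// ler_peMr// exprn_ege1// ler1n.
- move=> p _; apply/cvgrPdist_le => e e0.
  have : C / 2 ^+ k @[k --> \oo] --> (0 : R).
    rewrite -[X in _ --> X](mulr0 C); apply: cvgM; first exact: cvg_cst.
    by under eq_fun do rewrite -exprVn; apply: cvg_expr; rewrite gtr0_norm ?invf_lt1 ?invr_gt0// ltr1n.
  move/cvgrPdist_le => /(_ e e0); apply: filterS => k.
  rewrite sub0r normrN => h; have [_ h2] := hf_ k; apply: le_trans (h2 _) _.
  exact: le_trans (ler_norm _) h.
Qed.

Hypothesis compact_c : forall M, compact [set v : V | forall i, `|c i v| <= M].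

(** Stated for coordinates [c] on an arbitrary normed space, so that it covers
    both R^n and space-time. *)
Lemma L2_approximation f (C : R) : box_measurable f -> measurable_fun D (f \o H) ->
  (forall v, `|f v| <= C) ->
  exists phi : nat -> V -> R,
    (forall k, Ck 1 (phi k) /\ compactly_supported (phi k)) /\
    L2norm mu D (fun p => f (H p) - phi k (H p)) @[k --> \oo] --> 0%E.
Proof.
move=> mf mfH fC; have [_ af] := L2_approximable_bounded mf mfH fC.
have /choice [phi hphi] : forall k : nat, exists phi,
    [/\ Ck 1 phi, c_bounded phi, measurable_fun D (phi \o H) &
     (\int[mu]_(p in D) ((f (H p) - phi (H p)) ^+ 2)%:E <=
       (k.+1%:R^-1 ^+ 2)%:E)%E].
  by move=> k; apply: af; rewrite exprn_gt0// invr_gt0.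
exists phi; split => [k|].
  have [Cp [M hM] _ _] := hphi k; split => //.
  have cl : closed [set v : V | forall i, `|c i v| <= M].
    rewrite (_ : [set v | _] =
      \bigcap_(i in [set: 'I_N]) (fun v => `|c i v|) @^-1` [set y | y <= M]).
      apply: closed_bigI => i _; apply: closed_comp; last exact: closed_le.
      move=> x _; apply: (continuous_comp (CkW (Cc i) x)).
      exact: norm_continuous.
    by apply/seteqP; split => v /= h i //; [move=> _; exact: h|exact: h].
  rewrite /compactly_supported.
  apply: (subclosed_compact _ (@compact_c M)); first exact: closed_closure.
  by have /closure_id -> := cl; apply: closure_subset => v /= /hM.
have L2le k : (0 <= L2norm mu D (fun p => f (H p) - phi k (H p))%R <= (k.+1%:R^-1)%:E)%E.
  have [_ _ mp hp] := hphi k; rewrite /L2norm.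
  have i0 : (0 <= \int[mu]_(p in D) ((f (H p) - phi k (H p)) ^+ 2)%:E)%E.
    by apply: integral_ge0 => p _; rewrite lee_fin sqr_ge0.
  move: hp i0; case: (integral _ _ _) => [r|//|//]; rewrite !lee_fin => rk r0.
  rewrite /= sqrtr_ge0/=.
  rewrite -[leRHS]ger0_norm ?invr_ge0// -sqrtr_sqr.
  by rewrite ler_sqrt// sqr_ge0.
apply: (@squeeze_cvge _ _ _ _ (cst 0%E) _ (fun k => (k.+1%:R^-1)%:E)).
- by near=> k; exact: L2le.
- exact: cvg_cst.
- by apply: cvg_EFin; [near=> k|exact: cvg_harmonic].
Unshelve. all: by end_near. Qed.

End L2_approximation.

(** * The cascade: masses, centres and velocities *)

Section cascade_numbers.
Context {R : realType}.
Variable T : R.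
Hypothesis T0 : 0 < T.

(** The time at which blob [k] joins the cluster of all blobs of greater index. *)
Definition hit (k : nat) : R := T / 2 ^+ k.
(** The mass of all blobs of index at least [k]; the quadratic exponent makes it
    decay faster than any power of [hit k]. *)
Definition tail_mass (k : nat) : R := (2 ^+ (k * (k + 3)))^-1.
Definition mass (k : nat) : R := tail_mass k - tail_mass k.+1.
(** The speed ratio [vel0 k / hit k] minus 1: what blob [k] needs to lift the
    velocity of the cluster it hits from [clu0 k.+1] to [clu0 k]. *)
Definition gain (k : nat) : R := 2 + 3 / 2 * (tail_mass k.+1 / mass k).

Lemma hit_gt0 k : 0 < hit k.
Proof. by rewrite divr_gt0// exprn_gt0. Qed.

Lemma hit0 : hit 0 = T.
Proof. by rewrite /hit expr0 divr1. Qed.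

Lemma hitS k : hit k = 2 * hit k.+1.
Proof. by rewrite /hit exprS; field; rewrite expf_neq0. Qed.

Lemma hit_half j k : (j < k)%N -> 2 * hit k <= hit j.
Proof.
elim: k => // k IH; rewrite ltnS leq_eqVlt => /orP[/eqP ->|jk].
  by rewrite -hitS.
by apply: le_trans (IH jk); rewrite -hitS; have := hit_gt0 k; lra.
Qed.

Lemma hit_le j k : (j <= k)%N -> hit k <= hit j.
Proof.
rewrite leq_eqVlt => /orP[/eqP ->//|/hit_half].
by have := hit_gt0 k; lra.
Qed.

Lemma hit_lt_index j k : hit j < hit k -> (k < j)%N.
Proof. by rewrite ltNge => jk; rewrite ltnNge; apply: contra jk; exact: hit_le. Qed.

Lemma hit_quarter j k : (j < k)%N -> hit j = 2 * hit k \/ 4 * hit k <= hit j.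
Proof.
case: k => // k; rewrite ltnS leq_eqVlt => /orP[/eqP ->|jk].
  by left; rewrite -hitS.
right; have := hit_half jk; have := hitS k; lra.
Qed.

Lemma cvg_hit : hit @ \oo --> (0 : R).
Proof.
rewrite /hit -[X in _ --> X](mulr0 T).
apply: cvgM; first exact: cvg_cst.
under eq_fun do rewrite -exprVn.
by apply: cvg_expr; rewrite gtr0_norm ?invf_lt1 ?invr_gt0// ltr1n.
Qed.

Lemma hit_stage t : 0 < t <= T -> exists j, hit j <= t < 2 * hit j.
Proof.
move=> /andP[t0 tT].
have [k hk] : exists k, hit k <= t.
  have /cvgrPdist_lt/(_ t t0)[N _ hN] := cvg_hit.
  exists N; have := hN N (leqnn N); rewrite sub0r normrN gtr0_norm ?hit_gt0//.
  exact: ltW.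
case: (ex_minnP (ex_intro (fun k => hit k <= t) k hk)) => j hj jmin.
exists j; rewrite hj/=; case: j hj jmin => [_ _|j hj jmin].
  by rewrite hit0; lra.
by rewrite -hitS ltNge; apply/negP => /jmin; rewrite ltnn.
Qed.

Lemma hit_stage_uniq t i j : hit i <= t < 2 * hit i -> hit j <= t < 2 * hit j ->
  i = j.
Proof.
move=> /andP[h1 h2] /andP[h3 h4]; apply/eqP; rewrite eqn_leq; apply/andP; split;
  rewrite leqNgt; apply/negP => /hit_half; lra.
Qed.

Lemma tail_mass_gt0 k : 0 < tail_mass k.
Proof. by rewrite invr_gt0 exprn_gt0. Qed.

Lemma tail_mass0 : tail_mass 0 = 1.
Proof. by rewrite /tail_mass mul0n expr0 invr1. Qed.

Lemma tail_mass_decay k : 16 * tail_mass k.+1 <= tail_mass k.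
Proof.
rewrite /tail_mass (_ : k.+1 * (k.+1 + 3) = k * (k + 3) + 2 * k + 4)%N; last by ring.
rewrite 2!exprD 2!invfM.
set a := (2 ^+ (k * (k + 3)))^-1; set b := (2 ^+ (2 * k))^-1.
have a0 : 0 < a by rewrite invr_gt0 exprn_gt0.
have b1 : b <= 1 by rewrite invf_le1 ?exprn_gt0// exprn_ege1// ler1n.
have b0 : 0 < b by rewrite invr_gt0 exprn_gt0.
rewrite (_ : 16 * _ = a * b); last by rewrite /GRing.exp/=; field.
by rewrite ler_piMr// ltW.
Qed.

Lemma mass_ge k : 15 * tail_mass k.+1 <= mass k.
Proof. by have := tail_mass_decay k; rewrite /mass; lra. Qed.

Lemma mass_gt0 k : 0 < mass k.
Proof. by have := mass_ge k; have := tail_mass_gt0 k.+1; lra. Qed.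

Lemma mass_le_tail k : mass k <= tail_mass k.
Proof. by rewrite /mass gerBl ltW// tail_mass_gt0. Qed.

Lemma mass_gain k : mass k * gain k = 2 * mass k + 3 / 2 * tail_mass k.+1.
Proof. by rewrite /gain; field; rewrite gt_eqF// mass_gt0. Qed.

Lemma gain_bounds k : 2 < gain k <= 2 + 10^-1.
Proof.
have m0 := mass_gt0 k; have := mass_ge k; have := tail_mass_gt0 k.+1 => t0 h.
rewrite /gain ltrDl mulr_gt0 ?divr_gt0//= lerD2l.
have : tail_mass k.+1 / mass k <= 15^-1 by rewrite ler_pdivrMr//; lra.
lra.
Qed.

Lemma cvg_tail_mass : tail_mass @ \oo --> (0 : R).
Proof.
apply: (@squeeze_cvgr _ _ _ _ (cst 0) (fun k => 2^-1 ^+ k)).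
- near=> k; rewrite ltW ?tail_mass_gt0//= exprVn lef_pV2 ?posrE ?exprn_gt0//.
  by rewrite ler_eXn2l ?ltr1n// leq_pmulr// addn3.
- exact: cvg_cst.
- by apply: cvg_expr; rewrite gtr0_norm ?invf_lt1 ?invr_gt0// ltr1n.
Unshelve. all: by end_near. Qed.

(** For every [N], the exponent [k * (k + 3)] outgrows [N * k]. *)
Lemma mass_flat N : exists C, forall k, mass k <= C * hit k ^+ N.
Proof.
exists (2 ^+ (N * N) / T ^+ N) => k; apply: le_trans (mass_le_tail k) _.
rewrite /hit expr_div_n mulrA divfK ?expf_neq0 ?gt_eqF//.
rewrite /tail_mass -exprM ler_pdivlMr ?exprn_gt0// mulrC.
rewrite ler_pdivrMr ?exprn_gt0// -exprD ler_eXn2l ?ltr1n//.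
have [kN|Nk] := leqP k N.
  by apply: (@leq_trans (N * N)); rewrite ?leq_mul2r ?kN ?orbT// leq_addr.
apply: (@leq_trans (k * (k + 3))); last by rewrite leq_addl.
by rewrite leq_mul2l (leq_trans (ltnW Nk)) ?orbT// leq_addr.
Qed.

(** Coordinates of the initial centre and velocity of blob [k] and of the velocity
    of the cluster after blob [k] has joined.  This cluster runs from the point
    [(hit k ^+ 2, hit k ^+ 3)] at time [hit k] to the corresponding point of the
    preceding blob at time [2 * hit k]; the velocity of the blob comes from the
    momentum balance and its centre from the place and time of the collision. *)
Definition ctr0 k : R := - (gain k * hit k ^+ 2).
Definition ctr1 k : R := - ((7 / 2 * gain k - 1) * hit k ^+ 3).
Definition vel0 k : R := (gain k + 1) * hit k.
Definition vel1 k : R := 7 / 2 * gain k * hit k ^+ 2.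
Definition clu0 k : R := 3 * hit k.
Definition clu1 k : R := 7 * hit k ^+ 2.
(** Radius and gathering time are small enough for the blobs to stay apart while
    they gather, and for each to have gathered before it joins the cluster. *)
Definition rad k : R := hit k ^+ 2 / 8.
Definition tau k : R := hit k / 4.
Definition shrink k (t : R) : R := Num.max 0 (1 - t / tau k).

Lemma rad_gt0 k : 0 < rad k.
Proof. by rewrite divr_gt0// exprn_gt0// hit_gt0. Qed.

Lemma tau_gt0 k : 0 < tau k.
Proof. by rewrite divr_gt0// hit_gt0. Qed.

Lemma tau_lt_hit k : tau k < hit k.
Proof. by rewrite /tau; have := hit_gt0 k; lra. Qed.

Lemma shrink_ge0 k t : 0 <= shrink k t.
Proof. by rewrite le_max lexx. Qed.

Lemma shrink_gathered k t : tau k <= t -> shrink k t = 0.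
Proof.
move=> h; apply/max_idPl; rewrite subr_le0 ler_pdivlMr ?tau_gt0//.
by rewrite mul1r.
Qed.

Lemma shrink_gathering k t : t < tau k -> shrink k t = 1 - t / tau k.
Proof.
by move=> h; apply/max_idPr; rewrite subr_ge0 ler_pdivrMr ?tau_gt0// mul1r ltW.
Qed.

Lemma shrink_le1 k t : 0 <= t -> shrink k t <= 1.
Proof.
move=> t0; rewrite ge_max ler01/= gerBl divr_ge0//.
by rewrite ltW// tau_gt0.
Qed.

Lemma momentum0 k :
  mass k * vel0 k = tail_mass k * clu0 k - tail_mass k.+1 * clu0 k.+1.
Proof.
rewrite /vel0 /clu0 hitS mulrA mulrDr mass_gain mulr1 /mass.
by field.
Qed.

Lemma momentum1 k :
  mass k * vel1 k = tail_mass k * clu1 k - tail_mass k.+1 * clu1 k.+1.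
Proof.
rewrite /vel1 /clu1 hitS.
rewrite (_ : mass k * _ = 7 / 2 * (mass k * gain k) * (2 * hit k.+1) ^+ 2); last by ring.
by rewrite mass_gain /mass; field.
Qed.

Lemma position_hit0 k : ctr0 k + hit k * vel0 k = hit k ^+ 2.
Proof. by rewrite /ctr0 /vel0; ring. Qed.

Lemma position_hit1 k : ctr1 k + hit k * vel1 k = hit k ^+ 3.
Proof. by rewrite /ctr1 /vel1; ring. Qed.

(** If two centres met, the differences of their initial positions and of their
    velocities would be parallel.  For consecutive blobs the determinant of these
    differences is a multiple of [(gain k - 2) * (2 * gain j - 1)]; for all others
    it is positive because [hit j / hit k] is at least 4. *)
Lemma centres_never_meet j k (t : R) : j != k ->
  ctr0 j + t * vel0 j = ctr0 k + t * vel0 k ->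
  ctr1 j + t * vel1 j = ctr1 k + t * vel1 k -> False.
Proof.
wlog jk : j k / (j < k)%N.
  move=> wl jk h0 h1; case: (ltngtP j k) => [jk'|kj|/eqP]; last by rewrite (negbTE jk).
    exact: (wl j k).
  by apply: (wl k j) => //; rewrite eq_sym.
move=> _ h0 h1.
have det0 : (ctr0 k - ctr0 j) * (vel1 k - vel1 j)
          - (ctr1 k - ctr1 j) * (vel0 k - vel0 j) = 0.
  have -> : ctr0 k - ctr0 j = - t * (vel0 k - vel0 j).
    by apply/eqP; rewrite -subr_eq0; apply/eqP; move: h0; lra.
  have -> : ctr1 k - ctr1 j = - t * (vel1 k - vel1 j).
    by apply/eqP; rewrite -subr_eq0; apply/eqP; move: h1; lra.
  by ring.
have x0 := hit_gt0 k; have /andP[A1 A2] := gain_bounds k.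
have /andP[B1 B2] := gain_bounds j.
(* [F] is the determinant in units of [hit k ^+ 4]. *)
pose s := hit j / hit k; have yE : hit j = s * hit k by rewrite divfK// gt_eqF.
pose F := - (7 / 2) * (gain k - s ^+ 2 * gain j) ^+ 2 +
  (7 / 2 * (gain k - s ^+ 3 * gain j) - 1 + s ^+ 3) *
  (gain k - s * gain j + 1 - s).
have F0 : F = 0.
  have h4 : hit k ^+ 4 != 0 by rewrite expf_neq0// gt_eqF.
  apply: (mulIf h4); rewrite mul0r -det0 /F /ctr0 /ctr1 /vel0 /vel1 yE.
  by field.
have [s2|s4] : s = 2 \/ 4 <= s.
  have [h|h] := hit_quarter jk; first by left; rewrite /s h mulfK// gt_eqF.
  by right; rewrite /s ler_pdivlMr.
  have : F = - (7 / 2) * ((gain k - 2) * (2 * gain j - 1)).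
    by rewrite /F s2; field.
  rewrite F0; have : 0 < (gain k - 2) * (2 * gain j - 1) by rewrite mulr_gt0//; lra.
  lra.
move: F0 s4; rewrite /F; clear -A1 A2 B1 B2.
set A := gain k in A1 A2 *; set B := gain j in B1 B2 *; move=> F0 s4.
have {}F0 : (5 / 2 * B - 1) * s ^+ 4 - (7 / 2 * B - 1) * (A + 1) * s ^+ 3
    + 7 * (A * B) * s ^+ 2 - (7 / 2 * A - 1) * (B + 1) * s + (5 / 2 * A - 1) = 0.
  by rewrite -F0; field.
have s0 : 0 < s by lra.
(* Coefficientwise, [F] is at least [4 s^4 - 197/10 s^3 + 28 s^2 - 197/10 s + 4],
   which is positive for [s >= 4]. *)
have c4 : 4 * s ^+ 4 <= (5 / 2 * B - 1) * s ^+ 4.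
  by rewrite ler_wpM2r ?exprn_ge0//; lra.
have cub (u v : R) : 2 < u <= 2 + 10^-1 -> 2 < v <= 2 + 10^-1 ->
    (7 / 2 * u - 1) * (v + 1) <= 197 / 10.
  move=> /andP[? ?] /andP[? ?]; apply: (@le_trans _ _ (635 / 100 * (31 / 10))); last lra.
  by apply: ler_pM; lra.
have c3 : (7 / 2 * B - 1) * (A + 1) * s ^+ 3 <= 197 / 10 * s ^+ 3.
  by rewrite ler_wpM2r ?cub ?A1 ?B1// exprn_ge0// ltW.
have c1 : (7 / 2 * A - 1) * (B + 1) * s <= 197 / 10 * s.
  by rewrite ler_wpM2r ?cub ?A1 ?B1// ltW.
have c2 : 28 * s ^+ 2 <= 7 * (A * B) * s ^+ 2.
  rewrite ler_wpM2r ?exprn_ge0//; first exact: ltW.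
  have : 2 * 2 <= A * B by apply: ler_pM; lra.
  lra.
have d : 13 * s ^+ 2 <= (4 * s ^+ 2 - 197 / 10 * s + 28) * s ^+ 2.
  rewrite ler_wpM2r ?exprn_ge0//; first exact: ltW.
  have : 0 <= (s - 4) ^+ 2 by exact: sqr_ge0.
  rewrite sqrrB expr2; lra.
have e : 4 * s <= s ^+ 2 by rewrite expr2 ler_wpM2r// ltW.
move: F0 c4 c3 c1 c2 d; rewrite (_ : (4 * s ^+ 2 - 197 / 10 * s + 28) * s ^+ 2 =
  4 * s ^+ 4 - 197 / 10 * s ^+ 3 + 28 * s ^+ 2); last by field.
lra.
Qed.

(** The first coordinates separate two blobs as long as the outer one has not
    shrunk to a point. *)
Lemma blobs_separated j k (t u w : R) : (j < k)%N -> 0 <= t < tau j ->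
  `|u - (ctr0 j + t * vel0 j)| <= shrink j t * rad j ->
  `|w - (ctr0 k + t * vel0 k)| <= shrink k t * rad k -> u < w.
Proof.
move=> jk /andP[t0 tj].
have hjk := hit_half jk; have y0 := hit_gt0 j; have x0 := hit_gt0 k.
have /andP[A1 A2] := gain_bounds k; have /andP[B1 B2] := gain_bounds j.
have sj1 := shrink_le1 j t0; have sk1 := shrink_le1 k t0.
have sr i : shrink i t * rad i <= hit i ^+ 2 / 8.
  by rewrite -[leRHS]mul1r ler_wpM2r ?shrink_le1// ltW// rad_gt0.
rewrite !ler_norml => /andP[_ uj] /andP[wk _].
have u1 : u <= - (11 / 10) * hit j ^+ 2.
  have := sr j; have : t * vel0 j <= (hit j / 4) * ((31 / 10) * hit j).
    by apply: ler_pM => //; [apply: mulr_ge0; lra|exact: ltW|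
      rewrite ler_wpM2r//; lra].
  have : 2 * hit j ^+ 2 <= gain j * hit j ^+ 2 by rewrite ler_wpM2r ?sqr_ge0//; lra.
  move: uj; rewrite /ctr0; have := sqr_ge0 (hit j); rewrite (expr2 (hit j)); lra.
have [tk|kt] := ltP t (tau k).
  have : - (223 / 100) * hit k ^+ 2 <= w.
    have := sr k; have : 0 <= t * vel0 k by apply: mulr_ge0 => //; apply: mulr_ge0; lra.
    have : gain k * hit k ^+ 2 <= (2 + 10^-1) * hit k ^+ 2.
      by rewrite ler_wpM2r ?sqr_ge0//; lra.
    move: wk; rewrite /ctr0; have := sqr_ge0 (hit k); lra.
  have : (2 * hit k) ^+ 2 <= hit j ^+ 2 by rewrite ler_pXn2r// nnegrE; lra.
  rewrite exprMn; have : 0 < hit k ^+ 2 by rewrite exprn_gt0.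
  lra.
have : - (136 / 100) * hit k ^+ 2 <= w.
  move: wk; rewrite (shrink_gathered kt) mul0r oppr0.
  have : (hit k / 4) * (3 * hit k) <= t * vel0 k.
    by apply: ler_pM => //; [lra|lra|rewrite ler_wpM2r//; lra].
  rewrite /ctr0 /vel0; have := sqr_ge0 (hit k).
  have : gain k * hit k ^+ 2 <= (2 + 10^-1) * hit k ^+ 2.
    by rewrite ler_wpM2r ?sqr_ge0//; lra.
  rewrite (expr2 (hit k)); lra.
have : (2 * hit k) ^+ 2 <= hit j ^+ 2 by rewrite ler_pXn2r// nnegrE; lra.
rewrite exprMn; have : 0 < hit k ^+ 2 by rewrite exprn_gt0.
lra.
Qed.

(** Blob [k] has not arrived yet.  If it is next to be hit, it runs behind the
    cluster because it is faster and arrives at the same time; otherwise its first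
    coordinate is still negative. *)
Lemma cluster_ahead j k (t u : R) : hit j <= t < 2 * hit j -> t < hit k ->
  `|u - (ctr0 k + t * vel0 k)| <= shrink k t * rad k ->
  u < hit j ^+ 2 + (t - hit j) * clu0 j.
Proof.
move=> /andP[jt tj] tk.
have kj : (k < j)%N by apply: hit_lt_index; lra.
have y0 := hit_gt0 k; have x0 := hit_gt0 j.
have /andP[A1 A2] := gain_bounds k.
have p0 : ctr0 k + t * vel0 k = hit k ^+ 2 - (hit k - t) * vel0 k.
  by rewrite -position_hit0; ring.
have v3 : 3 * hit k <= vel0 k by rewrite ler_wpM2r//; lra.
have [yx|yx] := hit_quarter kj.
  rewrite shrink_gathered ?mul0r; last by rewrite /tau; lra.
  rewrite normr_le0 subr_eq0 => /eqP ->; rewrite p0 /clu0.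
  have : (hit k - t) * (3 * hit k) <= (hit k - t) * vel0 k.
    by rewrite ler_wpM2l//; lra.
  rewrite yx => h; have : 0 < (2 * hit j - t) * hit j by rewrite mulr_gt0//; lra.
  move: h; rewrite !expr2; lra.
have c0 : 0 < hit j ^+ 2 + (t - hit j) * clu0 j.
  by rewrite ltr_wpDr ?exprn_gt0// mulr_ge0 ?subr_ge0// /clu0 mulr_ge0// ltW.
move=> hu; apply: le_lt_trans c0.
move: hu; rewrite ler_norml => /andP[_ hu].
have h1 : (hit k / 2) * (3 * hit k) <= (hit k - t) * vel0 k.
  by apply: ler_pM => //; lra.
have h2 : shrink k t * rad k <= hit k ^+ 2 / 8.
  by rewrite -[leRHS]mul1r ler_wpM2r ?shrink_le1//; [rewrite ltW// rad_gt0|lra].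
have : 0 < hit k ^+ 2 by rewrite exprn_gt0.
move: h1 h2 hu; rewrite p0 !expr2; lra.
Qed.

Lemma initial_blobs_separated j k (u w : R) : (j < k)%N ->
  `|u - ctr0 j| < 2 * rad j -> `|w - ctr0 k| < 2 * rad k -> u < w.
Proof.
move=> jk; have hjk := hit_half jk; have y0 := hit_gt0 j; have x0 := hit_gt0 k.
have /andP[A1 A2] := gain_bounds k; have /andP[B1 B2] := gain_bounds j.
rewrite !ltr_norml => /andP[_ uj] /andP[wk _].
have : (2 * hit k) ^+ 2 <= hit j ^+ 2 by rewrite ler_pXn2r// nnegrE; lra.
rewrite exprMn; have : 0 < hit k ^+ 2 by rewrite exprn_gt0.
have : gain k * hit k ^+ 2 <= (2 + 10^-1) * hit k ^+ 2.
  by rewrite ler_wpM2r ?sqr_ge0//; lra.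
have : 2 * hit j ^+ 2 <= gain j * hit j ^+ 2 by rewrite ler_wpM2r ?sqr_ge0//; lra.
move: uj wk; rewrite /ctr0 /rad; lra.
Qed.

Lemma initial_blob_far k (u : R) : `|u - ctr0 k| < 2 * rad k -> 14 * rad k <= `|u|.
Proof.
have x0 := hit_gt0 k; have /andP[A1 A2] := gain_bounds k.
rewrite ltr_norml => /andP[_ uj]; rewrite -normrN; apply: le_trans (ler_norm _).
have : 2 * hit k ^+ 2 <= gain k * hit k ^+ 2 by rewrite ler_wpM2r ?sqr_ge0//; lra.
by move: uj; rewrite /ctr0 /rad; lra.
Qed.

End cascade_numbers.

(** * Lebesgue measure on R^n and uniform labels on an open set *)

Section rV_measure.
Context {R : realType} {n : nat}.

Definition rV_box (B : 'I_n -> set R) : set 'rV[R]_n :=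
  [set x | forall i, B i (x ord0 i)].

Definition measurable_boxes : set (set 'rV[R]_n) :=
  [set A | exists2 B : 'I_n -> set (measurableTypeR R),
     (forall i, measurable (B i)) & A = rV_box B].

Lemma rV_boxE (B : 'I_n -> set R) :
  rV_box B = \bigcap_(i in [set: 'I_n]) (fun x : 'rV[R]_n => x ord0 i) @^-1` B i.
Proof. by apply/seteqP; split => x /= h i //; [move=> _; exact: h|exact: h]. Qed.

Lemma measurable_rV_box (B : 'I_n -> set (measurableTypeR R)) :
  (forall i, measurable (B i)) -> measurable (rV_box B).
Proof.
move=> mB; rewrite rV_boxE.
apply: (@fin_bigcap_measurable _ _ _ [set: 'I_n]); first exact: finite_finset.
by move=> i _; rewrite -[X in measurable X]setTI; exact: measurable_rV_coord.
Qed.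

Lemma measurable_boxesI : setI_closed measurable_boxes.
Proof.
move=> _ _ [B mB ->] [C mC ->]; exists (fun i => B i `&` C i).
  by move=> i; exact: measurableI.
apply/seteqP; split => x /=; first by move=> [b c] i; split.
by move=> h; split => i; have [] := h i.
Qed.

Lemma measurable_boxes_generate (A : set 'rV[R]_n) :
  measurable A -> <<s measurable_boxes >> A.
Proof.
have mid : measurable_fun [set: g_sigma_algebraType measurable_boxes]
    (fun x : 'rV[R]_n => x).
  apply: measurable_fun_rVP => i _ Y mY; rewrite setTI.
  apply: sub_sigma_algebra.
  exists (fun j => if j == i then Y else setT).
    by move=> j; case: ifP.
  apply/seteqP; split => x /=.
    by move=> Yx j; case: eqP => [->|].
  by move=> /(_ i); rewrite eqxx.
by move=> mA; have := mid measurableT A mA; rewrite setTI.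
Qed.

(** Boxes form a pi-system that generates the Borel sets. *)
Lemma rV_measure_unique (m1 m2 : {measure set 'rV[R]_n -> \bar R}) :
  (m1 setT < +oo)%E ->
  (forall B : 'I_n -> set (measurableTypeR R), (forall i, measurable (B i)) ->
     m1 (rV_box B) = m2 (rV_box B)) ->
  forall A, measurable A -> m1 A = m2 A.
Proof.
move=> m1T mB A mA.
apply: (@g_sigma_algebra_measure_unique _ _ _ measurable_boxes _ (fun=> setT)) => //.
- by move=> _ [B mb ->]; exact: measurable_rV_box.
- move=> _; exists (fun=> setT) => //.
  by apply/seteqP; split.
- by rewrite bigcup_const//; exists 0%N.
- exact: measurable_boxesI.
- by move=> _ [B mb ->]; exact: mB.
- exact: measurable_boxes_generate.
Qed.

End rV_measure.

(** [pushforward] with the measure structure that its measurability proof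
    provides. *)
Definition image_measure {R : realType} d1 d2 (T1 : measurableType d1)
    (T2 : measurableType d2) (mu : {measure set T1 -> \bar R}) (f : T1 -> T2)
    (mf : measurable_fun setT f) : {measure set T2 -> \bar R}.
Proof. by refine (pushforward mu f : {measure set T2 -> \bar R}). Defined.

Section affine_lebesgue.
Context {R : realType}.
Local Notation leb := (@lebesgue_measure R).

Lemma measurable_affine (c b : R) :
  measurable_fun [set: measurableTypeR R] (fun s : R => c * s + b : measurableTypeR R).
Proof. by apply: measurable_funD => //; apply: measurable_funM. Qed.

Lemma lebesgue_measure_affine (c b : R) (A : set (measurableTypeR R)) : 0 < c ->
  measurable A -> leb ((fun s => c * s + b) @^-1` A) = (c^-1%:E * leb A)%E.
Proof.
move=> c0 mA; have c0' : 0 <= c by exact: ltW.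
pose m := mscale (NngNum c0') (image_measure leb (measurable_affine c b)).
have -> : leb A = m A.
  apply: lebesgue_measure_unique => // _ [[p q] _ <-].
  rewrite [RHS](_ : _ =
    (c%:E * leb ((fun s => (c * s + b)%R) @^-1` `]p, q]%classic))%E)//.
  rewrite (_ : _ @^-1` _ = `]((p - b) / c), ((q - b) / c)]%classic); last first.
    apply/seteqP; split => s /=; rewrite !in_itv/=;
      by rewrite ltr_pdivrMr// ler_pdivlMr// ltrBlDr lerBrDr mulrC.
  rewrite !lebesgue_measure_itv/= !lte_fin ltr_pM2r ?invr_gt0// ltrD2r.
  case: ifPn => _; last by rewrite mule0.
  by rewrite -!EFinB -EFinM; congr (_%:E); field; rewrite gt_eqF.
by rewrite /m /mscale/= muleA -EFinM mulVf ?gt_eqF// mul1e.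
Qed.

End affine_lebesgue.

Section dyadic_cubes.
Context {R : realType} {n : nat}.
Implicit Types (y : 'rV[R]_n) (l : nat) (z : {ffun 'I_n -> int}).

Definition dyadic_index l y : {ffun 'I_n -> int} :=
  [ffun i => Num.ceil (2 ^+ l * y ord0 i) - 1].

Definition dyadic_cube l z : set 'rV[R]_n := [set y | dyadic_index l y = z].

Lemma dyadic_cubeP l z y : dyadic_cube l z y <->
  forall i, 0 < 2 ^+ l * y ord0 i - (z i)%:~R <= 1.
Proof.
split=> [yz i|h].
  have := ceil_itv (2 ^+ l * y ord0 i).
  have -> : z i = Num.ceil (2 ^+ l * y ord0 i) - 1 by rewrite -yz ffunE.
  by rewrite rmorphB/= => /andP[h1 h2]; apply/andP; split; lra.
apply/ffunP => i; rewrite ffunE; have /andP[h1 h2] := h i.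
apply/eqP; rewrite subr_eq; apply/eqP; apply: ceil_def.
by rewrite rmorphB rmorphD/=; apply/andP; split; lra.
Qed.

Lemma dyadic_index_coarser l y y' : dyadic_index l.+1 y = dyadic_index l.+1 y' ->
  dyadic_index l y = dyadic_index l y'.
Proof.
move=> yy'; apply/esym/dyadic_cubeP => i.
have /dyadic_cubeP/(_ i) h : dyadic_cube l (dyadic_index l y) y by [].
have /dyadic_cubeP/(_ i) h1 : dyadic_cube l.+1 (dyadic_index l.+1 y) y by [].
have /dyadic_cubeP/(_ i) h2 : dyadic_cube l.+1 (dyadic_index l.+1 y) y' by [].
move: h h1 h2; set m := dyadic_index l y i; set m' := dyadic_index l.+1 y i.
rewrite !exprS -!mulrA; set a := 2 ^+ l * y ord0 i; set b := 2 ^+ l * y' ord0 i.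
move=> /andP[h1 h2] /andP[h3 h4] /andP[h5 h6].
have i1 : 2 * m <= m'.
  rewrite -ltzD1 -(ltr_int R) rmorphM rmorphD/=; lra.
have i2 : m' + 1 <= 2 * m + 2.
  rewrite -ltzD1 -(ltr_int R) !rmorphD/= rmorphM/=; lra.
have j1 : (2 : R) * m%:~R <= m'%:~R by move: i1; rewrite -(ler_int R) rmorphM.
have j2 : (m'%:~R : R) + 1 <= 2 * m%:~R + 2.
  by move: i2; rewrite -(ler_int R) !rmorphD/= rmorphM.
by apply/andP; split; lra.
Qed.

Lemma dyadic_index_coarser_le l l' y y' : (l' <= l)%N ->
  dyadic_index l y = dyadic_index l y' -> dyadic_index l' y = dyadic_index l' y'.
Proof.
elim: l => [|l IH]; first by rewrite leqn0 => /eqP ->.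
rewrite leq_eqVlt => /orP[/eqP ->//|l'l] /dyadic_index_coarser; exact: IH.
Qed.

Variable D : set 'rV[R]_n.
Hypothesis oD : open D.

Lemma dyadic_cube_in_open y : D y ->
  exists l, dyadic_cube l (dyadic_index l y) `<=` D.
Proof.
move=> Dy; have /nbhs_ballP[e /= e0 he] : nbhs y D by exact: open_nbhs_nbhs.
have [l hl] : exists l : nat, (2 ^+ l)^-1 < e.
  have : (2^-1 : R) ^+ k @[k --> \oo] --> (0 : R).
    by apply: cvg_expr; rewrite gtr0_norm ?invf_lt1 ?invr_gt0// ltr1n.
  move/cvgrPdist_lt => /(_ e e0)[N _ hN]; exists N.
  by have := hN N (leqnn N); rewrite sub0r normrN exprVn gtr0_norm// invr_gt0 exprn_gt0.
exists l => y' /dyadic_cubeP h'; apply: he; split => // i j; rewrite [i]ord1.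
have /dyadic_cubeP h : dyadic_cube l (dyadic_index l y) y by [].
have p0 : (0 : R) < 2 ^+ l by rewrite exprn_gt0.
apply: le_lt_trans hl; rewrite -[leRHS]mul1r ler_pdivlMr//.
rewrite -(ger0_norm (ltW p0)) -normrM mulrC mulrBr ler_norml.
by have /andP[? ?] := h j; have /andP[? ?] := h' j; apply/andP; split; lra.
Qed.

(** The dyadic cubes of side at most 1 that are contained in [D] and maximal with
    this property: a partition of [D] into half-open cubes. *)
Definition dyadic_piece (p : nat * {ffun 'I_n -> int}) : set 'rV[R]_n :=
  [set y | [/\ dyadic_index p.1 y = p.2, dyadic_cube p.1 p.2 `<=` D &
     forall l, (l < p.1)%N -> ~ dyadic_cube l (dyadic_index l y) `<=` D]].

Lemma dyadic_piece_cover : D = \bigcup_p dyadic_piece p.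
Proof.
apply/seteqP; split => [y Dy|y [p _ [yp pD _]]]; last exact: pD.
have [l0 h0] := dyadic_cube_in_open Dy.
pose P l := `[< dyadic_cube l (dyadic_index l y) `<=` D >].
have exP : exists l, P l by exists l0; apply/asboolP.
case: (ex_minnP exP) => l /asboolP Pl lmin.
exists (l, dyadic_index l y) => //; split => // l' l'l Pl'.
by have := lmin l' (asboolT Pl'); rewrite leqNgt l'l.
Qed.

Lemma dyadic_piece_disjoint p q y : dyadic_piece p y -> dyadic_piece q y -> p = q.
Proof.
case: p q => [l z] [l' z'] [/= yz zD zmin] [/= yz' zD' zmin'].
suff ll' : l = l' by rewrite -yz -yz' ll'.
apply/eqP; rewrite eqn_leq; apply/andP; split; rewrite leqNgt; apply/negP => h.
  by apply: (zmin _ h); rewrite yz'.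
by apply: (zmin' _ h); rewrite yz.
Qed.

Lemma dyadic_pieceE p : dyadic_piece p = set0 \/
  dyadic_piece p = dyadic_cube p.1 p.2.
Proof.
have [->|/set0P[y [yp pD pmin]]] := eqVneq (dyadic_piece p) set0; first by left.
right; apply/seteqP; split => [y' []//|y' y'p]; split => // l lp h.
by apply: (pmin l lp); rewrite (dyadic_index_coarser_le (ltnW lp) (etrans yp (esym y'p))).
Qed.

End dyadic_cubes.

Section uniform_labels.
Context {R : realType} {n : nat}.
Variable D : set 'rV[R]_n.
Hypothesis oD : open D.
Local Notation Leb := (rV_lebesgue n).
Local Notation leb := (@lebesgue_measure R).

Let index := (nat * {ffun 'I_n -> int})%type.

Definition dyadic_seq (k : nat) : set 'rV[R]_n :=
  if pickle_inv k is Some p then dyadic_piece D p else set0.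

Definition dyadic_chart (k : nat) (i : 'I_n) (s : R) : R :=
  if pickle_inv k is Some p then
    2 ^+ (p : index).1 * s + (- (p.2 i)%:~R) else s.

Definition unit_label (y : 'rV[R]_n) : 'rV[R]_n :=
  \row_i glue dyadic_seq (fun k y => dyadic_chart k i (y ord0 i)) y.

Lemma dyadic_seq_disjoint y i j : dyadic_seq i y -> dyadic_seq j y -> i = j.
Proof.
rewrite /dyadic_seq; have := @pickle_invK index i; have := @pickle_invK index j.
case: (pickle_inv i) => [p|//] /=; case: (pickle_inv j) => [q|//] /= <- <- py qy.
by rewrite (dyadic_piece_disjoint py qy).
Qed.

Lemma dyadic_seq_cover : D = \bigcup_k dyadic_seq k.
Proof.
rewrite [LHS](dyadic_piece_cover oD); apply/seteqP; split => [y [p _ py]|y [k _]].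
  by exists (pickle p) => //; rewrite /dyadic_seq pickleK_inv.
by rewrite /dyadic_seq; case: pickle_inv => [p py|//]; exists p.
Qed.

Lemma dyadic_seq_box k : dyadic_seq k = set0 \/ exists2 p : index,
  pickle_inv k = Some p &
  dyadic_seq k = rV_box (fun i => dyadic_chart k i @^-1` `]0%R, 1%R]%classic).
Proof.
rewrite /dyadic_seq /dyadic_chart; case: pickle_inv => [p|]; last by left.
have [->|->] := dyadic_pieceE D p; [by left|right; exists p => //].
apply/seteqP; split => y.
  by move=> /dyadic_cubeP h i; rewrite /= in_itv/=; exact: h.
by move=> h; apply/dyadic_cubeP => i; have := h i; rewrite /= in_itv.
Qed.

Lemma measurable_dyadic_chart k i :
  measurable_fun [set: measurableTypeR R] (dyadic_chart k i : R -> measurableTypeR R).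
Proof.
rewrite /dyadic_chart; case: pickle_inv => [p|]; last exact: measurable_id.
exact: measurable_affine.
Qed.

Lemma measurable_dyadic_seq k : measurable (dyadic_seq k).
Proof.
have [->//|[p _ ->]] := dyadic_seq_box k.
apply: measurable_rV_box => i; rewrite -[X in measurable X]setTI.
exact: measurable_dyadic_chart.
Qed.

Lemma measurable_open_rV : measurable D.
Proof.
by rewrite dyadic_seq_cover; apply: bigcupT_measurable; exact: measurable_dyadic_seq.
Qed.

Lemma measurable_unit_label : measurable_fun setT unit_label.
Proof.
apply: measurable_fun_rVP => i; under eq_fun do rewrite mxE.
apply: measurable_glue => //.
- by move=> k; rewrite setTI; exact: measurable_dyadic_seq.
- move=> k; apply: (measurableT_comp (measurable_dyadic_chart k i)).
  exact: measurable_rV_coord.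
- by move=> x j k _; exact: dyadic_seq_disjoint.
Qed.

Lemma unit_labelE k y i : dyadic_seq k y ->
  unit_label y ord0 i = dyadic_chart k i (y ord0 i).
Proof.
by move=> ky; rewrite mxE; apply: glueE => // p q; exact: dyadic_seq_disjoint.
Qed.

Lemma dyadic_seq_uniform k (B : 'I_n -> set (measurableTypeR R)) :
  (forall i, measurable (B i)) ->
  Leb (dyadic_seq k `&` unit_label @^-1` rV_box B) =
  (\prod_(i < n) leb (B i `&` `]0%R, 1%R]%classic) * Leb (dyadic_seq k))%E.
Proof.
move=> mB; have [->|[p kp kE]] := dyadic_seq_box k.
  by rewrite set0I !measure0 mule0.
have mB1 i : measurable (B i `&` `]0%R, 1%R]%classic) by exact: measurableI.
have mpre i (A : set (measurableTypeR R)) : measurable A ->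
    measurable (dyadic_chart k i @^-1` A).
  by move=> mA; rewrite -[X in measurable X]setTI; exact: measurable_dyadic_chart.
have lpre i (A : set (measurableTypeR R)) : measurable A ->
    leb (dyadic_chart k i @^-1` A) = (((2 ^+ p.1)^-1)%:E * leb A)%E.
  move=> mA; rewrite /dyadic_chart kp; exact: lebesgue_measure_affine.
rewrite (_ : dyadic_seq k `&` _ =
    rV_box (fun i => dyadic_chart k i @^-1` (B i `&` `]0%R, 1%R]%classic))); last first.
  apply/seteqP; split => y.
    move=> [ky /= By] i; have := ky; rewrite {1}kE => /(_ i) h; split => //=.
    by rewrite -(unit_labelE i ky).
  move=> h; have ky : dyadic_seq k y by rewrite kE => i; have [] := h i.
  by split => //= i; rewrite (unit_labelE i ky); have [] := h i.
rewrite kE !rV_lebesgue_box//; first last.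
- by move=> i; exact: mpre.
- by move=> i; apply: mpre; exact: measurable_itv.
under eq_bigr do rewrite lpre//.
rewrite muleC -big_split/=; apply: eq_bigr => i _.
by rewrite lpre// lebesgue_measure_itv/= lte_fin ltr01 sube0 mule1 muleC.
Qed.

(** [unit_label] maps each maximal dyadic cube of [D] affinely onto the unit
    cube, so it transports Lebesgue measure on [D] to the uniform law. *)
Lemma unit_label_uniform (B : 'I_n -> set (measurableTypeR R)) :
  Leb D = 1%E -> (forall i, measurable (B i)) ->
  Leb (D `&` unit_label @^-1` rV_box B) =
  (\prod_(i < n) leb (B i `&` `]0%R, 1%R]%classic))%E.
Proof.
move=> D1 mB.
have mU : measurable (unit_label @^-1` rV_box B).
  rewrite -[X in measurable X]setTI; apply: measurable_unit_label => //.
  exact: measurable_rV_box.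
have tQ : trivIset [set: nat] dyadic_seq.
  by move=> i j _ _ [y [iy jy]]; exact: dyadic_seq_disjoint iy jy.
have mQ k : measurable (dyadic_seq k `&` unit_label @^-1` rV_box B).
  by apply: measurableI => //; exact: measurable_dyadic_seq.
rewrite {1}dyadic_seq_cover setI_bigcupl measure_semi_bigcup//; last 2 first.
- exact: trivIset_setIr.
- exact: bigcupT_measurable.
have [r rE] : exists r, (\prod_(i < n) leb (B i `&` `]0%R, 1%R]%classic))%E = r%:E.
  elim/big_ind : _ => [|x y [a ->] [b ->]|i _]; first by exists 1.
    by exists (a * b).
  exists (fine (leb (B i `&` `]0, 1]%classic))); rewrite fineK//.
  rewrite ge0_fin_numE//; apply: (@le_lt_trans _ _ (leb `]0, 1]%classic)).
    by apply: le_measure; rewrite ?inE//; exact: measurableI.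
  by rewrite lebesgue_measure_itv/= lte_fin ltr01 sube0 ltry.
transitivity (\sum_(0 <= k <oo) (r%:E * Leb (dyadic_seq k)))%E.
  by apply: eq_eseriesr => k _; rewrite -rE; exact: dyadic_seq_uniform.
rewrite nneseriesZl// rE -measure_semi_bigcup//.
- by rewrite -dyadic_seq_cover; transitivity (r%:E * Leb D)%E => //; rewrite D1 mule1.
- exact: measurable_dyadic_seq.
- by rewrite -dyadic_seq_cover; exact: measurable_open_rV.
Qed.

End uniform_labels.

(** * A smooth bump law and its quantile function *)

Section density_measure.
Context d (T : measurableType d) {R : realType}.
Variables (mu : {measure set T -> \bar R}) (f : T -> R).
Hypotheses (mf : measurable_fun setT f) (f0 : forall x, 0 <= f x).
Local Open Scope ereal_scope.

(** The hypotheses are arguments so that the measure structure can be attached to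
    the constant. *)
Definition density (_ : measurable_fun setT f) (_ : forall x, (0 <= f x)%R)
  (A : set T) : \bar R := \int[mu]_(x in A) (f x)%:E.

Import HBNNSimple.
Local Notation dens := (density mf f0).

Let dens0 : dens set0 = 0. Proof. by rewrite /density integral_set0. Qed.

Let dens_ge0 A : 0 <= dens A.
Proof. by apply: integral_ge0 => x _; rewrite lee_fin. Qed.

Let dens_sigma_additive : semi_sigma_additive dens.
Proof.
apply: semi_sigma_additive_nng_induced => //; exact/measurable_EFinP.
Qed.

HB.instance Definition _ := isMeasure.Build _ _ _ dens dens0 dens_ge0
  dens_sigma_additive.

(** Monotone approximation of [g] by simple functions. *)
Lemma ge0_integral_density (g : T -> \bar R) : measurable_fun setT g ->
  (forall x, 0 <= g x) -> \int[dens]_x g x = \int[mu]_x (g x * (f x)%:E).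
Proof.
move=> mg g0.
have mfE : measurable_fun setT (EFin \o f) by exact/measurable_EFinP.
pose g_ := nnsfun_approx measurableT mg.
have cg x : (g_ n x)%:E @[n --> \oo] --> g x.
  by apply: (cvg_nnsfun_approx measurableT mg) => // y _; exact: g0.
have ndg x : {homo (fun n => (g_ n x)%:E) : m n / (m <= n)%N >-> m <= n}.
  by move=> m n mn; rewrite lee_fin; exact/lefP/nd_nnsfun_approx.
transitivity (limn (fun n => \int[dens]_x (g_ n x)%:E)).
  rewrite -monotone_convergence//.
  - by apply: eq_integral => x _; apply/esym/cvg_lim => //; exact: cg.
  - by move=> n; exact/measurable_EFinP/measurable_funP.
  - by move=> n x _; rewrite lee_fin.
transitivity (limn (fun n => \int[mu]_x ((g_ n x)%:E * (f x)%:E))); last first.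
  rewrite -monotone_convergence//.
  - apply: eq_integral => x _; apply/cvg_lim => //.
    by apply: cvgeMr => //; exact: cg.
  - move=> n; apply: emeasurable_funM => //.
    exact/measurable_EFinP/measurable_funP.
  - by move=> n x _; rewrite mule_ge0// lee_fin.
  - by move=> x _ m n mn; rewrite lee_wpmul2r ?lee_fin//; exact: ndg.
congr (limn _); apply/funext => n; rewrite integralT_nnsfun sintegralE.
have m1 r : measurable_fun setT (fun x => (r * \1_(g_ n @^-1` [set r]) x)%:E).
  by apply/measurable_EFinP; apply: measurable_funM => //; exact: measurable_indic.
transitivity (\int[mu]_x (\sum_(r \in range (g_ n))
    ((r * \1_(g_ n @^-1` [set r]) x)%:E * (f x)%:E))); last first.
  apply: eq_integral => x _.
  rewrite -ge0_mule_fsuml; last by move=> r; exact: nnfun_muleindic_ge0.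
  by rewrite fsumEFin// -fimfunE.
rewrite ge0_integral_fsum//; last 2 first.
- by move=> r; apply: emeasurable_funM.
- by move=> r x _; apply: mule_ge0; [exact: nnfun_muleindic_ge0|rewrite lee_fin].
apply: eq_fsbigr => r /[1!inE] -[t _ tr].
under [RHS]eq_integral do rewrite EFinM -muleA.
have mA : measurable (g_ n @^-1` [set r]) by [].
rewrite ge0_integralZl_EFin//; last 3 first.
- by move=> x _; rewrite mule_ge0 ?lee_fin.
- by apply: emeasurable_funM => //; apply/measurable_EFinP; exact: measurable_indic.
- by rewrite -tr.
congr (_ * _); rewrite /= /density [LHS]integral_mkcond.
apply: eq_integral => x _; rewrite patchE indicE.
by case: (x \in _); rewrite ?mul1e ?mul0e.
Qed.

End density_measure.

Section law_on.
Context d1 d2 (T1 : measurableType d1) (T2 : measurableType d2) {R : realType}.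
Variables (mu : {measure set T1 -> \bar R}) (E : set T1) (f : T1 -> T2).
Hypotheses (mE : measurable E) (mf : measurable_fun setT f).

Definition law_on : {measure set T2 -> \bar R} := image_measure (mrestr mu mE) mf.

Lemma law_onE A : law_on A = mu (E `&` f @^-1` A).
Proof. by rewrite setIC. Qed.

Lemma ge0_integral_law_on (g : T2 -> \bar R) : measurable_fun setT g ->
  (forall x, (0 <= g x)%E) ->
  (\int[mu]_(x in E) g (f x) = \int[law_on]_x g x)%E.
Proof.
move=> mg g0; rewrite [RHS]ge0_integral_pushforward// preimage_setT.
have m1 : measurable_fun setT (\1_E : T1 -> R) by exact: measurable_indic.
have i0 (x : T1) : 0 <= \1_E x :> R by [].
rewrite [RHS](eq_measure_integral (density mu m1 i0)); last first.
  move=> A mA _; rewrite [RHS](_ : _ = \int[mu]_(x in A) (\1_E x)%:E)%E//.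
  by rewrite integral_indic// setIC.
rewrite [RHS]ge0_integral_density; last 2 first.
- exact: (measurableT_comp mg mf).
- by move=> x; exact: g0.
rewrite [LHS]integral_mkcond; apply: eq_integral => x _ /=.
by rewrite patchE indicE; case: (x \in _); rewrite ?mule1 ?mule0.
Qed.

End law_on.

Section bump.
Context {R : realType}.
Local Notation leb := (@lebesgue_measure R).

Definition bump0 (z : R) : R := flat_exp 0 (1 - z ^+ 2).

Lemma bump0_ge0 z : 0 <= bump0 z. Proof. exact: flat_exp_ge0. Qed.

Lemma bump0_out z : 1 <= `|z| -> bump0 z = 0.
Proof.
move=> z1; apply/eqP; rewrite eq_le bump0_ge0 andbT leNgt flat_exp_gt0 subr_gt0.
by rewrite -leNgt -[leRHS]real_normK ?num_real// exprn_ege1.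
Qed.

Lemma bump0_le1 z : bump0 z <= 1.
Proof.
rewrite /bump0 /flat_exp; case: ifPn => // z0.
by rewrite expr0 mul1r expR_le1 oppr_le0 invr_ge0 ltW.
Qed.

Lemma smooth_bump0 : smooth (bump0 : R^o -> R).
Proof.
move=> k; apply: (Ck_comp (h := flat_exp 0)); first exact: smooth_flat_exp.
have Cid : Ck k (fun z : R^o => z : R).
  by have := smooth_affine (1 : R) 0 k; under eq_fun do rewrite mul1r addr0.
have := CkD (Ck_cst k (1 : R)) (CkM (Ck_cst k (-1)) (CkM Cid Cid)).
rewrite (_ : (fun z => _) = (fun z : R^o => 1 - z ^+ 2))//.
by apply/funext => z /=; rewrite mulN1r expr2.
Qed.

Lemma measurable_bump0 : measurable_fun [set: measurableTypeR R] (bump0 : _ -> measurableTypeR R).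
Proof. exact: continuous_measurable_fun (smooth_bump0 0). Qed.

Lemma integral_bump0_bounds :
  (0 < \int[leb]_z (bump0 z)%:E < +oo)%E.
Proof.
apply/andP; split.
  (* On this interval [1 - z ^+ 2 >= 2^-1]. *)
  pose I : set (measurableTypeR R) := `[(-2^-1), 2^-1]%classic.
  have h1 : (0 < \int[leb]_(z in I) (expR (- 2))%:E)%E.
    rewrite integral_cst; last exact: measurable_itv.
    rewrite [X in (_ < _ * X)%E]lebesgue_measure_itv/= lte_fin.
    rewrite ifT; last by lra.
    by rewrite -EFinB -EFinM lte_fin mulr_gt0 ?expR_gt0//; lra.
  apply: (lt_le_trans h1).
  have h2 : (\int[leb]_(z in I) (expR (- 2))%:E <= \int[leb]_(z in I) (bump0 z)%:E)%E.
    apply: ge0_le_integral => //.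
    - exact: measurable_itv.
    - by apply/measurable_EFinP; exact: measurable_funTS measurable_bump0.
    move=> z; rewrite /I/= in_itv/= => /andP[z1 z2]; rewrite lee_fin /bump0 /flat_exp.
    have h : z ^+ 2 <= 4^-1.
      have : `|z| <= 2^-1 by rewrite ler_norml z1.
      rewrite -(ler_pXn2r (n := 2))// ?nnegrE ?normr_ge0//.
      by rewrite real_normK ?num_real// => h; apply: (le_trans h); rewrite expr2; lra.
    rewrite ifT; last by lra.
    rewrite expr0 mul1r ler_expR lerN2 -[leRHS]invrK lef_pV2 ?posrE; lra.
  apply: (le_trans h2); apply: ge0_subset_integral => //.
  - exact: measurable_itv.
  - by apply/measurable_EFinP; exact: measurable_bump0.
  - by move=> z _; rewrite lee_fin bump0_ge0.
rewrite (_ : \int[leb]_z _ = \int[leb]_(z in `[(-1)%R, 1%R]%classic) (bump0 z)%:E)%E; last first.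
  rewrite [RHS]integral_mkcond; apply: eq_integral => z _.
  rewrite patchE; case: ifPn => // /negP z1; rewrite bump0_out//.
  rewrite leNgt; apply/negP => h; apply: z1; rewrite inE/= in_itv/=.
  by rewrite -ler_norml ltW.
apply: (@le_lt_trans _ _ (\int[leb]_(z in `[(-1)%R, 1%R]%classic) (cst 1 z))%E).
  apply: ge0_le_integral => //.
  - by move=> z _; rewrite lee_fin bump0_ge0.
  - by apply/measurable_EFinP; exact: measurable_funTS measurable_bump0.
  - by move=> z _; rewrite lee_fin bump0_le1.
rewrite integral_cst// mul1e [X in (X < _)%E]lebesgue_measure_itv/= lte_fin.
by case: ifPn => _; rewrite ltry.
Qed.

Definition bump_mass : R := fine (\int[leb]_z (bump0 z)%:E)%E.

Lemma bump_massE : (\int[leb]_z (bump0 z)%:E = bump_mass%:E)%E.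
Proof.
by have /andP[h1 h2] := integral_bump0_bounds; rewrite fineK// ge0_fin_numE// ltW.
Qed.

Lemma bump_mass_gt0 : 0 < bump_mass.
Proof.
by have /andP[h1 _] := integral_bump0_bounds; rewrite -lte_fin -bump_massE.
Qed.

Definition bump (z : R) : R := bump_mass^-1 * bump0 z.

Lemma bump_ge0 z : 0 <= bump z.
Proof. by rewrite mulr_ge0 ?bump0_ge0// invr_ge0 ltW// bump_mass_gt0. Qed.

Lemma bump_le z : bump z <= bump_mass^-1.
Proof. by rewrite ler_piMr ?bump0_le1// invr_ge0 ltW// bump_mass_gt0. Qed.

Lemma bumpN z : bump (- z) = bump z.
Proof. by rewrite /bump /bump0 sqrrN. Qed.

Lemma bump_out z : 1 <= `|z| -> bump z = 0.
Proof. by move=> z1; rewrite /bump bump0_out// mulr0. Qed.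

Lemma smooth_bump : smooth (bump : R^o -> R).
Proof.
by move=> k; apply: (CkM (f := cst _)); [exact: Ck_cst|exact: smooth_bump0].
Qed.

Lemma measurable_bump : measurable_fun [set: measurableTypeR R] (bump : _ -> R).
Proof. by apply: measurable_funM => //; exact: measurable_bump0. Qed.

Definition bump_law : {measure set (measurableTypeR R) -> \bar R} :=
  density leb measurable_bump bump_ge0.

Lemma bump_lawE A : bump_law A = (\int[leb]_(z in A) (bump z)%:E)%E.
Proof. by []. Qed.

Lemma bump_lawT : bump_law setT = 1%E.
Proof.
rewrite bump_lawE; under eq_integral do rewrite EFinM.
rewrite ge0_integralZl_EFin//.
- by rewrite bump_massE -EFinM mulVf// gt_eqF// bump_mass_gt0.
- by move=> z _; rewrite lee_fin bump0_ge0.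
- by apply/measurable_EFinP; exact: measurable_bump0.
- by rewrite invr_ge0 ltW// bump_mass_gt0.
Qed.

Lemma bump_lawN (A : set (measurableTypeR R)) : measurable A ->
  bump_law (-%R @^-1` A) = bump_law A.
Proof.
move=> mA; rewrite !bump_lawE.
have mN : measurable_fun setT (-%R : measurableTypeR R -> measurableTypeR R).
  exact: oppr_measurable.
rewrite [RHS](eq_measure_integral (image_measure leb mN)); last first.
  by move=> B mB _; exact/esym/lebesgue_measureN.
rewrite ge0_integral_pushforward//.
- by apply: eq_integral => z _ /=; rewrite bumpN.
- by apply/measurable_EFinP; exact: measurable_funTS measurable_bump.
- by move=> z _; rewrite lee_fin bump_ge0.
Qed.

Let cdf_bump (z : R) : R := fine (bump_law `]-oo, z]%classic).

Lemma bump_law_le1 (A : set (measurableTypeR R)) : measurable A -> (bump_law A <= 1)%E.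
Proof. by move=> mA; rewrite -bump_lawT; apply: le_measure; rewrite ?inE. Qed.

Lemma cdf_bumpE z : bump_law `]-oo, z]%classic = (cdf_bump z)%:E.
Proof.
rewrite fineK// ge0_fin_numE//; apply: le_lt_trans (ltry 1).
by apply: bump_law_le1; exact: measurable_itv.
Qed.

Lemma bump_law_itv (a b : R) : a <= b ->
  bump_law `]a, b]%classic = (cdf_bump b - cdf_bump a)%:E.
Proof.
move=> ab; rewrite EFinB -!cdf_bumpE.
rewrite (_ : `]a, b]%classic = `]-oo, b]%classic `\` `]-oo, a]%classic); last first.
  apply/seteqP; split => z /=; rewrite !in_itv/=.
    by move=> /andP[az ->]; split => //; apply/negP; rewrite -ltNge.
  by move=> [-> /negP]; rewrite -ltNge => ->.
rewrite measureD; [|exact: measurable_itv|exact: measurable_itv|].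
  rewrite setIidr// => z /=; rewrite !in_itv/= => za; exact: le_trans ab.
by apply: le_lt_trans (bump_law_le1 _) (ltry 1); exact: measurable_itv.
Qed.

Lemma cdf_bump_lipschitz (a b : R) : a <= b ->
  cdf_bump a <= cdf_bump b <= cdf_bump a + bump_mass^-1 * (b - a).
Proof.
move=> ab; have := bump_law_itv ab; have := measure_ge0 bump_law `]a, b]%classic.
move=> + E; rewrite [X in (_ <= X)%E]E lee_fin subr_ge0 => -> /=.
rewrite -lerBlDl -lee_fin -[X in (X <= _)%E]E bump_lawE.
apply: (@le_trans _ _ (\int[leb]_(z in `]a, b]%classic) (bump_mass^-1)%:E)%E).
  apply: ge0_le_integral => //.
  - by move=> z _; rewrite lee_fin bump_ge0.
  - by apply/measurable_EFinP; exact: measurable_funTS measurable_bump.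
  - by move=> z _; rewrite lee_fin bump_le.
rewrite integral_cst; last exact: measurable_itv.
rewrite [X in (_ * X <= _)%E]lebesgue_measure_itv/= lte_fin.
case: ifPn => [_|]; first by rewrite -EFinB -EFinM.
rewrite -leNgt => ba; rewrite mule0 lee_fin mulr_ge0 ?subr_ge0//.
by rewrite invr_ge0 ltW// bump_mass_gt0.
Qed.

Lemma cdf_bump_left z : z < -1 -> cdf_bump z = 0.
Proof.
move=> z1; apply: EFin_inj; rewrite -cdf_bumpE bump_lawE.
apply: integral0_eq => x /=; rewrite in_itv/= => xz; rewrite bump_out//.
by rewrite -normrN; apply: le_trans (ler_norm _); lra.
Qed.

Lemma cdf_bump_right : cdf_bump 1 = 1.
Proof.
apply: EFin_inj; rewrite -cdf_bumpE -bump_lawT !bump_lawE.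
rewrite [LHS]integral_mkcond; apply: eq_integral => x _; rewrite patchE.
case: ifPn => // /negP x1; rewrite bump_out//.
apply: le_trans (ler_norm _); rewrite leNgt; apply/negP => h; apply: x1.
by rewrite inE/= in_itv/= ltW.
Qed.

Definition bump_quantile (u : R) : R :=
  if (0 < u <= 1) then inf [set z | u <= cdf_bump z] else 0.

Lemma bump_quantile_has_inf u : 0 < u <= 1 -> has_inf [set z | u <= cdf_bump z].
Proof.
move=> /andP[u0 u1]; split; first by exists 1; rewrite /= cdf_bump_right.
exists (-1) => z /= uz; rewrite leNgt; apply/negP => /cdf_bump_left h.
by move: uz; rewrite h leNgt u0.
Qed.

(** The infimum is attained because the distribution function is continuous. *)
Lemma bump_quantile_le u z : 0 < u <= 1 ->
  (bump_quantile u <= z) = (u <= cdf_bump z).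
Proof.
move=> u01; have hi := bump_quantile_has_inf u01; rewrite /bump_quantile u01.
apply/idP/idP => [h|uz]; last by apply: ge_inf => //; case: hi.
have {h} h e : 0 < e -> u <= cdf_bump z + bump_mass^-1 * e.
  move=> e0; have [w /= uw we] := inf_adherent e0 hi.
  have [zw|wz] := leP z w.
    have /andP[_ h2] := cdf_bump_lipschitz zw.
    apply: (le_trans uw); apply: (le_trans h2).
    by rewrite lerD2l ler_wpM2l// ?invr_ge0 ?(ltW bump_mass_gt0)//; lra.
  have /andP[h1 _] := cdf_bump_lipschitz (ltW wz).
  apply: (le_trans uw); apply: (le_trans h1).
  by rewrite lerDl mulr_ge0 ?(ltW e0)// invr_ge0 ltW// bump_mass_gt0.
apply/ler_addgt0Pr => e e0.
have := h (bump_mass * e) (mulr_gt0 bump_mass_gt0 e0).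
by rewrite mulKf// gt_eqF// bump_mass_gt0.
Qed.

Lemma bump_quantile_norm u : `|bump_quantile u| <= 1.
Proof.
have [u01|/negbTE nu] := boolP (0 < u <= 1); last by rewrite /bump_quantile nu normr0.
rewrite ler_norml bump_quantile_le// cdf_bump_right; have /andP[u0 ->] := u01.
rewrite andbT /bump_quantile u01; apply: lb_le_inf.
  by have [] := bump_quantile_has_inf u01.
move=> z /= uz; rewrite leNgt; apply/negP => /cdf_bump_left h.
by move: uz; rewrite h leNgt u0.
Qed.

Lemma measurable_bump_quantile :
  measurable_fun [set: measurableTypeR R] (bump_quantile : _ -> measurableTypeR R).
Proof.
move=> mT; apply: (measurability _ (RGenOInfty.measurableE R)) => //.
move=> _ [_ [z ->] <-]; rewrite setTI.
rewrite (_ : _ @^-1` _ = (`]0, 1]%classic `&` `]cdf_bump z, +oo[%classic) `|`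
    (if z < 0 then ~` `]0, 1]%classic else set0)).
  apply: measurableU; first by apply: measurableI; exact: measurable_itv.
  by case: ifP => _ //; apply: measurableC; exact: measurable_itv.
apply/seteqP; split => u /=; rewrite !in_itv/= !andbT.
  have [u01|nu] := boolP (0 < u <= 1).
    by rewrite ltNge bump_quantile_le// -ltNge => h; left.
  by rewrite /bump_quantile (negbTE nu) => ->; right => /=; rewrite in_itv/=; exact/negP.
case=> [[u01]|]; first by rewrite ltNge -bump_quantile_le// -ltNge.
case: ifPn => // z0 /=; rewrite in_itv/= => /negP nu.
by rewrite /bump_quantile (negbTE nu).
Qed.

(** By [bump_quantile_le] the preimages of intervals are intervals whose end points
    are values of the distribution function. *)
Lemma bump_quantile_law (A : set (measurableTypeR R)) : measurable A ->
  leb (bump_quantile @^-1` A `&` `]0, 1]%classic) = bump_law A.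
Proof.
move=> mA.
have mI : measurable (`]0, 1]%classic : set (measurableTypeR R)) by exact: measurable_itv.
pose m := image_measure (mrestr leb mI) measurable_bump_quantile.
have mE (B : set (measurableTypeR R)) :
    m B = leb (bump_quantile @^-1` B `&` `]0, 1]%classic) by [].
have Gm : @ocitv R `<=` @measurable _ (measurableTypeR R).
  by move=> B oB; exact: sub_sigma_algebra.
have Gg k : @ocitv R `](- k%:R), k%:R]%classic by exact: is_ocitv.
have cover : \bigcup_(k : nat) `](- k%:R : R), k%:R]%classic = setT.
  apply/seteqP; split => // z _.
  have [k hk] : exists k : nat, `|z| < k%:R.
    by exists (Num.truncn `|z|).+1; exact: truncnS_gt.
  exists k => //=; rewrite in_itv/=; move: hk; rewrite ltr_norml => /andP[-> h].
  exact: ltW.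
have key := @g_sigma_algebra_measure_unique _ R (measurableTypeR R) (@ocitv R) Gm _ Gg cover m bump_law.
apply: key => //.
- exact: ocitvI.
- move=> B /ocitvP[->|[[a b] /= ab ->]]; first by rewrite !measure0.
  rewrite mE bump_law_itv ?(ltW ab)//.
  have G01 z : 0 <= cdf_bump z <= 1.
    by rewrite -!lee_fin -cdf_bumpE measure_ge0/= bump_law_le1//; exact: measurable_itv.
  rewrite (_ : _ `&` _ = `](cdf_bump a), (cdf_bump b)]%classic).
    rewrite lebesgue_measure_itv/= lte_fin.
    have /andP[h _] := cdf_bump_lipschitz (ltW ab).
    move: h; rewrite le_eqVlt => /orP[/eqP ->|->//]; by rewrite ltxx subrr.
  apply/seteqP; split => u /=; rewrite !in_itv/=.
    by move=> [/andP[h1 h2] u01]; rewrite -bump_quantile_le// h2 ltNge -bump_quantile_le// -ltNge h1.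
  move=> /andP[h1 h2].
  have u01 : 0 < u <= 1.
    have /andP[a1 _] := G01 a; have /andP[_ b1] := G01 b.
    by rewrite (le_lt_trans a1 h1) (le_trans h2 b1).
  by split => //; rewrite bump_quantile_le// h2 andbT ltNge bump_quantile_le// -ltNge.
- move=> k; rewrite mE; apply: (@le_lt_trans _ _ (leb `]0, 1]%classic)).
    by apply: le_measure; rewrite ?inE//; apply: measurableI => //;
      rewrite -[X in measurable X]setTI; apply: measurable_bump_quantile => //; exact: measurable_itv.
  by rewrite lebesgue_measure_itv/= lte_fin ltr01 sube0 ltry.
Qed.

End bump.

(** * Labels distributed as a cascade of bumps *)

Lemma rV_norm_leP {R : realType} n (x : 'rV[R]_n) (M : R) : 0 <= M ->
  `|x| <= M <-> forall i, `|x ord0 i| <= M.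
Proof.
move=> M0; rewrite [`|x|]/Num.norm/= mx_normrE; split => [/bigmax_leP[_ h] i|h].
  exact: (h (ord0, i)).
by apply/bigmax_leP; split => // -[i j] _ /=; rewrite ord1.
Qed.

Section bump_affine.
Context {R : realType}.
Local Notation leb := (@lebesgue_measure R).

Definition bump_at (a r x : R) : R := r^-1 * bump (r^-1 * (x - a)).

Lemma bump_at_ge0 a r x : 0 < r -> 0 <= bump_at a r x.
Proof. by move=> r0; rewrite mulr_ge0 ?bump_ge0// invr_ge0 ltW. Qed.

Lemma measurable_bump_at a r :
  measurable_fun [set: measurableTypeR R] (bump_at a r : _ -> measurableTypeR R).
Proof.
apply: measurable_funM => //; apply: (measurableT_comp measurable_bump).
by apply: measurable_funM => //; exact: measurable_funB.
Qed.

(** Change of variables: [leb] is [r] times its image under the affine map. *)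
Lemma bump_law_affine a r (A : set (measurableTypeR R)) : 0 < r -> measurable A ->
  bump_law ((fun z => r * z + a) @^-1` A) = (\int[leb]_(x in A) (bump_at a r x)%:E)%E.
Proof.
move=> r0 mA; rewrite bump_lawE.
pose m := mscale (NngNum (ltW r0)) (image_measure leb (measurable_affine r a)).
rewrite [RHS](eq_measure_integral m); last first.
  move=> B mB _; rewrite /m/= /mscale/=.
  rewrite [X in (_ = _ * X)%E](_ : _ = leb ((fun s => r * s + a) @^-1` B))//.
  by rewrite lebesgue_measure_affine// muleA -EFinM mulfV ?gt_eqF// mul1e.
have mE : measurable_fun A (fun x => (bump_at a r x)%:E).
  by apply/measurable_EFinP; exact: measurable_funTS (measurable_bump_at a r).
rewrite ge0_integral_mscale//; last by move=> x _; rewrite lee_fin bump_at_ge0.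
have ma := measurable_affine r a.
rewrite ge0_integral_pushforward//; last first.
  by move=> x _; rewrite lee_fin bump_at_ge0.
rewrite -ge0_integralZl_EFin//; last 3 first.
- by rewrite -[X in measurable X]setTI; exact: measurable_affine.
- by move=> x _; rewrite lee_fin bump_at_ge0.
- apply: measurable_funTS; apply/measurable_EFinP.
  exact: (measurableT_comp (measurable_bump_at a r) (measurable_affine r a)).
apply: eq_integral => z _; rewrite -EFinM /bump_at addrK mulKf ?gt_eqF//.
by rewrite mulVKf ?gt_eqF.
Qed.

End bump_affine.

Section product_density.
Context {R : realType}.
Local Notation leb := (@lebesgue_measure R).
Local Open Scope ereal_scope.

Lemma measurable_prod_coord n (g : 'I_n -> R -> R) :
  (forall i, measurable_fun [set: measurableTypeR R] (g i : _ -> measurableTypeR R)) ->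
  measurable_fun [set: 'rV[R]_n]
    (fun x => (\prod_(i < n) g i (x ord0 i))%R : measurableTypeR R).
Proof.
move=> mg; apply: measurable_prod => i _.
exact: (measurableT_comp (mg i) (measurable_rV_coord i)).
Qed.

(** Tonelli's theorem along the recursive definition of [rV_lebesgue]. *)
Lemma integral_prod_coord n (g : 'I_n -> R -> R) :
  (forall i, measurable_fun [set: measurableTypeR R] (g i : _ -> measurableTypeR R)) ->
  (forall i x, (0 <= g i x)%R) ->
  \int[rV_lebesgue n]_x (\prod_(i < n) g i (x ord0 i))%:E =
  \prod_(i < n) \int[leb]_x (g i x)%:E.
Proof.
elim: n => [|n IH] in g * => mg g0.
  rewrite big_ord0 /=.
  under eq_integral do rewrite big_ord0.
  by rewrite integral_cst//= diracE mem_set// mul1e.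
have mp := measurable_prod_coord mg.
have p0 x : (0 <= \prod_(i < n.+1) g i (x ord0 i))%R by apply: prodr_ge0.
rewrite big_ord_recl/= -IH//.
transitivity (\int[(leb \x rV_lebesgue n)]_p
   (\prod_(i < n.+1) g i (rV_cons p ord0 i))%:E).
  rewrite ge0_integral_pushforward//.
  - exact: measurable_rV_cons.
  - exact/measurable_EFinP.
  - by move=> x _; rewrite lee_fin.
rewrite fubini_tonelli1; last 2 first.
- apply/measurable_EFinP; apply: (measurableT_comp mp); exact: measurable_rV_cons.
- by move=> p; rewrite lee_fin.
rewrite -ge0_integralZr//; last 3 first.
- by apply/measurable_EFinP; exact: mg.
- by move=> x _; rewrite lee_fin.
- by apply: integral_ge0 => x _; rewrite lee_fin prodr_ge0.
apply: eq_integral => s _; rewrite /fubini_F/=.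
rewrite -ge0_integralZl_EFin//; last 2 first.
- by move=> x _; rewrite lee_fin prodr_ge0.
- apply/measurable_EFinP.
  by apply: (measurable_prod_coord (g := fun i => g (lift ord0 i))) => i; exact: mg.
apply: eq_integral => y _; rewrite big_ord_recl rV_consE0 EFinM; congr (_ * _%:E).
by apply: eq_bigr => i _; rewrite rV_consES.
Qed.

Lemma integral_box_prod_coord n (g : 'I_n -> R -> R)
    (B : 'I_n -> set (measurableTypeR R)) :
  (forall i, measurable_fun [set: measurableTypeR R] (g i : _ -> measurableTypeR R)) ->
  (forall i x, (0 <= g i x)%R) -> (forall i, measurable (B i)) ->
  \int[rV_lebesgue n]_(x in rV_box B) (\prod_(i < n) g i (x ord0 i))%:E =
  \prod_(i < n) \int[leb]_(x in B i) (g i x)%:E.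
Proof.
move=> mg g0 mB.
transitivity (\int[rV_lebesgue n]_x
    (\prod_(i < n) (g i (x ord0 i) * \1_(B i) (x ord0 i)))%:E).
  rewrite [LHS]integral_mkcond; apply: eq_integral => x _; rewrite patchE.
  case: ifPn => [/[!inE] xB|xB].
    by congr (_%:E); apply: eq_bigr => i _; rewrite indicE mem_set ?mulr1//; exact: xB.
  have /existsNP[i xi] : ~ forall i, B i (x ord0 i).
    by move=> h; move/negP: xB; apply; rewrite inE.
  by rewrite (bigD1 i)//= indicE memNset// mulr0 mul0r.
rewrite (integral_prod_coord (g := fun i x => (g i x * \1_(B i) x)%R)).
- apply: eq_bigr => i _; rewrite [RHS]integral_mkcond; apply: eq_integral => x _.
  by rewrite patchE indicE; case: (x \in _); rewrite ?mulr1 ?mulr0.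
- by move=> i; apply: measurable_funM; [exact: mg|exact: measurable_indic].
- by move=> i x; rewrite mulr_ge0.
Qed.

End product_density.

Section blob_labels.
Context {R : realType} {n : nat}.
Variable D : set 'rV[R]_n.+1.
Hypotheses (oD : open D) (D1 : rV_lebesgue n.+1 D = 1%E).
Local Notation Leb := (rV_lebesgue n.+1).
Local Notation leb := (@lebesgue_measure R).
Local Notation tail := (@tail_mass R).
Local Notation mass := (@mass R).
Local Notation u := (unit_label D).

Lemma tail_mass_le j k : (j <= k)%N -> tail k <= tail j.
Proof.
elim: k => [|k IH]; first by rewrite leqn0 => /eqP ->.
rewrite leq_eqVlt => /orP[/eqP ->//|/IH]; apply: le_trans.
by have := @tail_mass_decay R k; have := @tail_mass_gt0 R k.+1; lra.
Qed.

(** The first coordinate of the label is uniform on [0, 1], so this slab carries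
    the mass [tail k - tail k.+1] of blob [k]. *)
Definition blob_cell k : set 'rV[R]_n.+1 := [set y | tail k.+1 < u y ord0 ord0 <= tail k].

Lemma blob_cell_disjoint y j k : blob_cell j y -> blob_cell k y -> j = k.
Proof.
move=> /andP[h1 h2] /andP[h3 h4]; apply/eqP; rewrite eqn_leq.
apply/andP; split; rewrite leqNgt; apply/negP => /tail_mass_le; lra.
Qed.

Lemma unit_label_itv y i : D y -> 0 < u y ord0 i <= 1.
Proof.
rewrite {1}(dyadic_seq_cover oD) => -[k _ ky]; rewrite (unit_labelE _ ky).
have [e|[p _ e]] := dyadic_seq_box D k; first by move: ky; rewrite e.
by move: ky; rewrite {1}e => /(_ i); rewrite /= in_itv.
Qed.

Lemma blob_cell_cover y : D y -> exists k, blob_cell k y.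
Proof.
move=> Dy; have /andP[s0 s1] := unit_label_itv ord0 Dy.
have [N hN] : exists N, tail N < u y ord0 ord0.
  have /cvgrPdist_lt/(_ _ s0)[N _ hN] := @cvg_tail_mass R.
  exists N; have := hN N (leqnn N); rewrite sub0r normrN gtr0_norm//.
  exact: tail_mass_gt0.
have [[|k] hk kmin] := ex_minnP (ex_intro (fun N => tail N < u y ord0 ord0) N hN).
  by move: hk; rewrite tail_mass0 ltNge s1.
exists k; rewrite /blob_cell/= hk leNgt; apply/negP => /kmin.
by rewrite ltnn.
Qed.

Lemma measurable_blob_cell k : measurable (blob_cell k).
Proof.
rewrite (_ : blob_cell k = (fun y => u y ord0 ord0) @^-1` `]tail k.+1, tail k]%classic).
  rewrite -[X in measurable X]setTI.
  by apply: (measurableT_comp (measurable_rV_coord ord0) (measurable_unit_label D)).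
by apply/seteqP; split => y /=; rewrite in_itv.
Qed.

(** The default value concerns labels outside [D] only. *)
Definition blob_index y : nat := xget 0%N (fun k => blob_cell k y).

Lemma blob_indexE y k : D y -> blob_index y = k <-> blob_cell k y.
Proof.
move=> Dy; rewrite /blob_index; have [k0 hk0] := blob_cell_cover Dy.
case: xgetP => [j _ jy|/(_ k0)//]; split; first by move=> <-.
exact: blob_cell_disjoint jy.
Qed.

Lemma measurable_blob_index k : measurable [set y | blob_index y = k].
Proof.
have E j : blob_cell j = [set y | blob_cell j y /\ blob_index y = j].
  apply/seteqP; split => y; last by case.
  move=> jy; split => //; rewrite /blob_index; case: xgetP => [i _ iy|/(_ j)//].
  exact: blob_cell_disjoint iy jy.
case: k => [|k].
  rewrite (_ : [set y | _] = ~` \bigcup_j blob_cell j.+1).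
    by apply: measurableC; apply: bigcupT_measurable => j; exact: measurable_blob_cell.
  apply/seteqP; split => y /=.
    by move=> y0 [j _]; rewrite E => -[_]; rewrite y0.
  move=> h; rewrite /blob_index; case: xgetP => // -[//|j] _ jy; case: h.
  by exists j.
rewrite (_ : [set y | _] = blob_cell k.+1); first exact: measurable_blob_cell.
apply/seteqP; split => y /=; last by rewrite E => -[].
by rewrite /blob_index; case: xgetP => // j _ jy <-.
Qed.

(** Within a cell the first coordinate of the uniform label is stretched back
    to [0, 1] before all coordinates are turned into bump-distributed ones. *)
Definition blob_offset_in k y : 'rV[R]_n.+1 := \row_i bump_quantile
  (if i == ord0 then (mass k)^-1 * u y ord0 ord0 + (- ((mass k)^-1 * tail k.+1))
   else u y ord0 i).

Definition blob_offset y := blob_offset_in (blob_index y) y.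

Lemma blob_offset_norm y : `|blob_offset y| <= 1.
Proof.
by apply/rV_norm_leP => // i; rewrite mxE bump_quantile_norm.
Qed.

Lemma measurable_blob_offset_in k : measurable_fun setT (blob_offset_in k).
Proof.
have mu i := measurableT_comp (measurable_rV_coord i) (measurable_unit_label D).
apply: measurable_fun_rVP => i; under eq_fun do rewrite mxE.
apply: (measurableT_comp (measurable_bump_quantile (R := R))).
case: (i == ord0); last exact: mu.
exact: (measurableT_comp (measurable_affine _ _) (mu ord0)).
Qed.

Lemma measurable_blob_offset i :
  measurable_fun setT (fun y => blob_offset y ord0 i : measurableTypeR R).
Proof.
apply: (measurable_select (f := fun k y => blob_offset_in k y ord0 i)) => k.
  exact: measurable_blob_index.
exact: (measurableT_comp (measurable_rV_coord i) (measurable_blob_offset_in k)).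
Qed.

Let Dk k := D `&` [set y | blob_index y = k].

Lemma measurable_blob_piece k : measurable (Dk k).
Proof.
by apply: measurableI; [exact: measurable_open_rV|exact: measurable_blob_index].
Qed.

(** Stretching the slab to [0, 1] in the first coordinate produces the factor
    [mass k]; the quantile functions produce the bump laws. *)
Lemma blob_offset_box k (B : 'I_n.+1 -> set (measurableTypeR R)) :
  (forall i, measurable (B i)) ->
  Leb (Dk k `&` blob_offset @^-1` rV_box B) =
  ((mass k)%:E * \prod_(i < n.+1) bump_law (B i))%E.
Proof.
move=> mB; have mk0 := @mass_gt0 R k.
pose L (s : R) := (mass k)^-1 * s + (- ((mass k)^-1 * tail k.+1)).
have mq (A : set (measurableTypeR R)) : measurable A ->
    measurable (bump_quantile (R := R) @^-1` A : set (measurableTypeR R)).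
  move=> mA; rewrite -[X in measurable X]setTI; exact: measurable_bump_quantile.
have mL (A : set (measurableTypeR R)) : measurable A ->
    measurable (L @^-1` A : set (measurableTypeR R)).
  by move=> mA; rewrite -[X in measurable X]setTI; exact: measurable_affine.
have mI : measurable (`]0, 1]%classic : set (measurableTypeR R)) by exact: measurable_itv.
pose B' (i : 'I_n.+1) : set (measurableTypeR R) := if i == ord0 then
    L @^-1` (bump_quantile (R := R) @^-1` B ord0 `&` `]0, 1]%classic)
  else bump_quantile (R := R) @^-1` B i.
have LE s : (0 < L s <= 1) = (tail k.+1 < s <= tail k).
  rewrite /L -mulrBr pmulr_rgt0 ?invr_gt0// ler_pdivrMl// mulr1 subr_gt0 lerBlDr.
  by rewrite /mass subrK.
rewrite (_ : _ `&` _ = D `&` u @^-1` rV_box B'); last first.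
  apply/seteqP; split => y.
    move=> [[Dy] /(blob_indexE k Dy) ky xB]; split => // i; rewrite /B'.
    have ik : blob_index y = k by exact/blob_indexE.
    have := xB i; rewrite /blob_offset ik mxE; case: eqP => // -> h; split => //=.
    by rewrite in_itv/= LE.
  move=> [Dy yB]; have ky : blob_cell k y.
    by have [_] := yB ord0; rewrite /= in_itv/= LE.
  have ik : blob_index y = k by exact/blob_indexE.
  split => //; rewrite /preimage/= => i; rewrite /blob_offset ik mxE.
  by have := yB i; rewrite /B'; case: eqP => [-> []|].
rewrite unit_label_uniform//; last first.
  by move=> i; rewrite /B'; case: ifP => _; [apply: mL; apply: measurableI|]; auto.
rewrite big_ord_recl [in RHS]big_ord_recl muleA; congr (_ * _)%E; last first.
  by apply: eq_bigr => i _; rewrite /B'/= bump_quantile_law.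
rewrite /B' eqxx -[X in (_ * X)%E]bump_quantile_law//.
rewrite -[in RHS](invrK (mass k)).
rewrite -(lebesgue_measure_affine (- ((mass k)^-1 * tail k.+1))) ?invr_gt0//; last first.
  by apply: measurableI; auto.
congr (leb _); apply/seteqP; split => s [] //; split => //.
have: 0 < L s <= 1 by move: b; rewrite /= in_itv.
rewrite LE /= in_itv/= => /andP[h1 h2].
rewrite (lt_trans (@tail_mass_gt0 R _) h1) (le_trans h2)//.
by rewrite -[leRHS](@tail_mass0 R) tail_mass_le.
Qed.

(** Both sides are integrals of [g] for finite measures that agree on boxes. *)
Lemma integral_blob k (a : 'rV[R]_n.+1) (r : R) (g : 'rV[R]_n.+1 -> \bar R) :
  0 < r -> measurable_fun setT g -> (forall x, (0 <= g x)%E) ->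
  (\int[Leb]_(y in Dk k) g (a + r *: blob_offset y)%R =
   \int[Leb]_x (g x * (mass k * \prod_(i < n.+1) bump_at (a ord0 i) r (x ord0 i))%R%:E))%E.
Proof.
move=> r0 mg g0.
have mX : measurable_fun setT (fun y => a + r *: blob_offset y).
  apply: measurable_fun_rVP => i; under eq_fun do rewrite mxE [X in _ + X]mxE.
  apply: measurable_funD => //; apply: measurable_funM => //.
  exact: measurable_blob_offset.
pose m := law_on Leb (measurable_blob_piece k) mX.
pose p (x : 'rV[R]_n.+1) := mass k * \prod_(i < n.+1) bump_at (a ord0 i) r (x ord0 i).
have mp : measurable_fun setT p.
  apply: measurable_funM => //.
  by apply: (measurable_prod_coord (g := fun i => bump_at (a ord0 i) r)) => i;
    exact: measurable_bump_at.
have p0 x : 0 <= p x.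
  rewrite mulr_ge0 ?(ltW (@mass_gt0 R k))//; apply: prodr_ge0 => i _; exact: bump_at_ge0.
have key A : measurable A -> m A = density Leb mp p0 A.
  apply: (rV_measure_unique (m1 := m) (m2 := density Leb mp p0)).
    rewrite law_onE//; apply: (@le_lt_trans _ _ (Leb D)); last by rewrite D1 ltry.
    apply: le_measure; rewrite ?inE//.
    - by rewrite setIT; exact: measurable_blob_piece.
    - exact: measurable_open_rV.
    - by move=> y [[]].
  move=> B mB; rewrite law_onE.
  rewrite (_ : _ @^-1` _ = blob_offset @^-1`
      rV_box (fun i => (fun z => r * z + a ord0 i) @^-1` B i)); last first.
    by apply/seteqP; split => y h i; have := h i; rewrite /= !mxE addrC.
  rewrite [LHS]blob_offset_box; last first.
    by move=> i; rewrite -[X in measurable X]setTI; exact: measurable_affine.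
  rewrite [RHS](_ : _ = \int[Leb]_(x in rV_box B) (p x)%:E)%E// /p.
  under [RHS]eq_integral do rewrite EFinM.
  rewrite ge0_integralZl_EFin//; last 4 first.
  - exact: measurable_rV_box.
  - by move=> x _; rewrite lee_fin prodr_ge0// => i _; exact: bump_at_ge0.
  - apply: measurable_funTS; apply/measurable_EFinP.
    by apply: (measurable_prod_coord (g := fun i => bump_at (a ord0 i) r)) => i;
      exact: measurable_bump_at.
  - exact: ltW (@mass_gt0 R k).
  rewrite (integral_box_prod_coord (g := fun i => bump_at (a ord0 i) r))//; last 2 first.
  - by move=> i; exact: measurable_bump_at.
  - by move=> i x; exact: bump_at_ge0.
  by congr (_ * _)%E; apply: eq_bigr => i _; rewrite bump_law_affine.
transitivity (\int[density Leb mp p0]_x g x)%E; last exact: ge0_integral_density.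
transitivity (\int[m]_x g x)%E; last first.
  by apply: eq_measure_integral => A mA _; exact: key.
exact: (ge0_integral_law_on Leb (measurable_blob_piece k) mX).
Qed.

End blob_labels.

(** * The initial density *)

Section blob_label_laws.
Context {R : realType} {n : nat}.
Variable D : set 'rV[R]_n.+1.
Hypotheses (oD : open D) (D1 : rV_lebesgue n.+1 D = 1%E).
Local Notation Leb := (rV_lebesgue n.+1).
Local Notation mass := (@mass R).
Local Notation kap := (blob_index D).
Local Notation xi := (blob_offset D).

Definition blob_piece k : set 'rV[R]_n.+1 := D `&` [set y | kap y = k].

Lemma blob_piece_cover : D = \bigcup_k blob_piece k.
Proof.
apply/seteqP; split => [y Dy|y [k _ []//]]; by exists (kap y).
Qed.

Lemma blob_piece_trivIset : trivIset setT blob_piece.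
Proof. by move=> j k _ _ [y [[_ <-] [_ <-]]]. Qed.

Lemma blob_offset_law k i (A : set (measurableTypeR R)) : measurable A ->
  Leb (blob_piece k `&` (fun y => xi y ord0 i) @^-1` A) = ((mass k)%:E * bump_law A)%E.
Proof.
move=> mA; pose B j : set (measurableTypeR R) := if j == i then A else setT.
have mB j : measurable (B j) by rewrite /B; case: ifP.
rewrite (_ : _ `&` _ = blob_piece k `&` xi @^-1` rV_box B); last first.
  congr (_ `&` _); apply/seteqP; split => y /=.
    by move=> yA j; rewrite /B; case: eqP => [->|].
  by move=> /(_ i); rewrite /B eqxx.
rewrite blob_offset_box//; congr (_ * _)%E.
rewrite (bigD1 i)//= big1; last by move=> j /negbTE ji; rewrite /B ji bump_lawT.
by rewrite mule1 /B eqxx.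
Qed.

Lemma blob_piece_mass k : Leb (blob_piece k) = (mass k)%:E.
Proof.
have := blob_offset_law k ord0 (@measurableT _ (measurableTypeR R)).
by rewrite preimage_setT setIT bump_lawT mule1.
Qed.

(** The bump is even. *)
Lemma integral_blob_offset k i : (\int[Leb]_(y in blob_piece k) (xi y ord0 i)%:E = 0)%E.
Proof.
have mD := measurable_blob_piece oD k.
have mx := measurable_blob_offset D i.
pose m := law_on Leb mD mx.
have mE (A : set (measurableTypeR R)) : measurable A -> m A = ((mass k)%:E * bump_law A)%E.
  by move=> mA; rewrite law_onE -(blob_offset_law k i mA).
have mN : measurable_fun setT (-%R : measurableTypeR R -> measurableTypeR R).
  exact: oppr_measurable.
pose h (s : measurableTypeR R) := (Num.max s 0)%:E : \bar R.
have mh : measurable_fun setT h.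
  by apply/measurable_EFinP; exact: measurable_funrpos.
have h0 s : (0 <= h s)%E by rewrite lee_fin le_max lexx orbT.
have E (g : measurableTypeR R -> \bar R) : measurable_fun setT g ->
    (forall s, (0 <= g s)%E) ->
    (\int[Leb]_(y in blob_piece k) g (xi y ord0 i) = \int[m]_s g s)%E.
  by move=> mg g0; exact: (ge0_integral_law_on Leb mD mx).
have hN : (\int[m]_s h s = \int[m]_s h (- s)%R)%E.
  rewrite (eq_measure_integral (image_measure m mN)); last first.
    move=> A mA _; rewrite mE// [RHS](_ : _ = m (-%R @^-1` A))//.
    rewrite mE ?bump_lawN//; by rewrite -[X in measurable X]setTI; exact: (mN measurableT A mA).
  by rewrite ge0_integral_pushforward// preimage_setT.
rewrite integralE.
rewrite (_ : \int[_]_(y in _) (_^\+)%E y = \int[m]_s h s)%E; last first.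
  rewrite -E//; apply: eq_integral => y _; by rewrite funeposE /h EFin_max.
rewrite (_ : \int[_]_(y in _) (_^\-)%E y = \int[m]_s h (- s)%R)%E; last first.
  rewrite -(E (fun s => h (- s)%R))//; last exact: measurableT_comp.
  by apply: eq_integral => y _; rewrite funenegE /h EFin_max EFinN.
rewrite -hN subee// ge0_fin_numE; last by apply: integral_ge0.
apply: (@le_lt_trans _ _ (\int[Leb]_(y in blob_piece k) 1)%E).
  rewrite -E//; apply: ge0_le_integral => //.
  - by apply: measurable_funTS; exact: measurableT_comp mh mx.
  - move=> y _; rewrite /h lee_fin ge_max ler01 andbT.
    apply: le_trans (ler_norm _) _.
    exact: (proj1 (rV_norm_leP _ ler01)) (blob_offset_norm D y) i.
by rewrite (integral_cst _ mD 1%E) mul1e [X in (X < _)%E]blob_piece_mass ltry.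
Qed.

End blob_label_laws.

Section initial_density.
Context {R : realType} {n : nat}.
Variable D : set 'rV[R]_n.+1.
Hypotheses (oD : open D) (D1 : rV_lebesgue n.+1 D = 1%E).
Variables (a : nat -> 'rV[R]_n.+1) (r : nat -> R).
Local Notation S := (fun k => [set x | `|x - a k| < 2 * r k]).
Hypothesis r0 : forall k, 0 < r k.
Hypothesis S_disj : forall x i j, S i x -> S j x -> i = j.
Local Notation Leb := (rV_lebesgue n.+1).
Local Notation mass := (@mass R).
Local Notation kap := (blob_index D).
Local Notation xi := (blob_offset D).

Definition cube_bump (x : 'rV[R]_n.+1) : R := \prod_(i < n.+1) bump (x ord0 i).

Lemma cube_bump_unit_supported : unit_supported cube_bump.
Proof.
move=> x x1; have [i xi1] : exists i, 1 < `|x ord0 i|.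
  apply/not_existsP => h; move: x1; rewrite ltNge => /negP; apply.
  by apply/rV_norm_leP => // i; rewrite leNgt; apply/negP => /h.
by rewrite /cube_bump (bigD1 i)//= bump_out ?mul0r// ltW.
Qed.

Lemma smooth_cube_bump : smooth cube_bump.
Proof.
move=> k; apply: Ck_prod => i _.
by apply: (Ck_comp (h := bump)); [exact: smooth_bump|exact: Ck_coord].
Qed.

(** The height at which the bump of radius [r k] has mass [mass k]. *)
Definition blob_height k : R := mass k * (r k)^-1 ^+ n.+1.

Definition blob_density : 'rV[R]_n.+1 -> R := glue S (blob_term a r blob_height cube_bump).

Definition blob_start (y : 'rV[R]_n.+1) : 'rV[R]_n.+1 := a (kap y) + r (kap y) *: xi y.

Let p k (x : 'rV[R]_n.+1) : R := mass k * \prod_(i < n.+1) bump_at (a k ord0 i) (r k) (x ord0 i).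

Let pE k x : p k x = blob_term a r blob_height cube_bump k x.
Proof.
rewrite /p /blob_term /blob_height /cube_bump -mulrA; congr (_ * _).
rewrite big_split/= prodr_const card_ord; congr (_ * _).
by apply: eq_bigr => i _; rewrite !mxE.
Qed.

Let p0 k x : 0 <= p k x.
Proof.
rewrite mulr_ge0 ?(ltW (mass_gt0 k))//; apply: prodr_ge0 => i _; exact: bump_at_ge0.
Qed.

Let mp k : measurable_fun setT (p k).
Proof.
apply: measurable_funM => //.
by apply: (measurable_prod_coord (g := fun i => bump_at (a k ord0 i) (r k))) => i;
  exact: measurable_bump_at.
Qed.

Let psum (c : \bar R) x : (0 <= c)%E ->
  (\sum_(k <oo) (c * (p k x)%:E) = c * (blob_density x)%:E)%E.
Proof.
move=> c0; have pnS j : ~ S j x -> p j x = 0.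
  by move=> Sj; rewrite pE (@blob_term0 _ _ a r)//; exact: cube_bump_unit_supported.
rewrite /blob_density; have [[k Sk ->]|[nS ->]] :=
  glueP S (blob_term a r blob_height cube_bump) x; last first.
  by rewrite mule0; apply: eseries0 => k _ _; rewrite pnS// mule0.
rewrite (@nneseriesD1 _ _ k)//; last by move=> j _; rewrite mule_ge0// lee_fin.
rewrite eseries0 ?adde0 ?pE// => j _ /= jk; rewrite pnS ?mule0// => Sj.
by move/eqP: jk; apply; exact: S_disj Sj Sk.
Qed.

Lemma blob_density_ge0 x : 0 <= blob_density x.
Proof.
rewrite -lee_fin -[leRHS]mul1e -psum//.
by apply: nneseries_ge0 => k _ _; rewrite mul1e lee_fin.
Qed.

Lemma measurable_blob_start : measurable_fun setT blob_start.
Proof.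
apply: measurable_fun_rVP => i; under eq_fun do rewrite mxE [X in _ + X]mxE.
apply: (measurable_select (idx := kap)
  (f := fun k y => a k ord0 i + r k * xi y ord0 i)) => k.
  exact: measurable_blob_index.
apply: measurable_funD => //; apply: measurable_funM => //.
exact: measurable_blob_offset.
Qed.

Lemma ge0_integral_blob_start (g : 'rV[R]_n.+1 -> \bar R) :
  measurable_fun setT g -> (forall x, (0 <= g x)%E) ->
  (\int[Leb]_(y in D) g (blob_start y) = \int[Leb]_x (g x * (blob_density x)%:E))%E.
Proof.
move=> mg g0; rewrite {1}(blob_piece_cover D) ge0_integral_bigcup; last 4 first.
- by move=> k; exact: measurable_blob_piece.
- apply: measurable_funTS; exact: (measurableT_comp mg measurable_blob_start).
- by move=> y _.
- exact: blob_piece_trivIset.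
transitivity (\sum_(k <oo) \int[Leb]_x (g x * (p k x)%:E))%E.
  apply: eq_eseriesr => k _; rewrite -(integral_blob oD D1)//.
  by apply: eq_integral => y /[1!inE] -[_ <-].
rewrite -integral_nneseries//; last 2 first.
- by move=> k; apply: emeasurable_funM => //; exact/measurable_EFinP.
- by move=> k x _; rewrite mule_ge0// lee_fin.
by apply: eq_integral => x _; rewrite psum.
Qed.

(** Positive and negative parts are transported separately, so no integrability
    is required. *)
Lemma integral_blob_start (f : 'rV[R]_n.+1 -> R) : measurable_fun setT f ->
  (\int[Leb]_(y in D) (f (blob_start y))%:E = \int[Leb]_x (f x * blob_density x)%:E)%E.
Proof.
move=> mf; pose h (s : R) := (Num.max s 0)%:E : \bar R.
have mh : measurable_fun setT (fun x => h (f x)).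
  by apply/measurable_EFinP; exact: measurable_funrpos.
have mhN : measurable_fun setT (fun x => h (- f x)).
  by apply/measurable_EFinP; apply: measurable_funrpos; exact: measurable_funN.
have h0 s : (0 <= h s)%E by rewrite lee_fin le_max lexx orbT.
rewrite integralE [RHS]integralE; congr (_ - _)%E.
  transitivity (\int[Leb]_(y in D) h (f (blob_start y)))%E.
    by apply: eq_integral => y _; rewrite funeposE /h EFin_max.
  rewrite (ge0_integral_blob_start mh)//; apply: eq_integral => x _.
  by rewrite funeposE /h -EFin_max -EFinM maxr_pMl ?blob_density_ge0// mul0r.
transitivity (\int[Leb]_(y in D) h (- f (blob_start y))%R)%E.
  by apply: eq_integral => y _; rewrite funenegE /h EFin_max EFinN.
rewrite (ge0_integral_blob_start mhN)//; apply: eq_integral => x _.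
by rewrite funenegE /h -EFinN -EFin_max -EFinM maxr_pMl ?blob_density_ge0// mul0r mulNr.
Qed.

Lemma integral_blob_density : (\int[Leb]_x (blob_density x)%:E = 1)%E.
Proof.
have := integral_blob_start (f := cst 1) (@measurable_cst _ _ _ _ _ _).
under [X in _ = X -> _]eq_integral do rewrite mul1r.
move=> <-; rewrite [LHS](_ : _ = \int[Leb]_(y in D) cst 1 y)%E//.
by rewrite integral_cst ?mul1e//; exact: measurable_open_rV.
Qed.

End initial_density.

(** * Density of test functions on R^n and on space-time *)

Section test_function_density.
Context {R : realType} {n : nat} d (S : measurableType d).
Variables (mu : {measure set S -> \bar R}) (A : set S).
Hypotheses (mA : measurable A) (muA : (mu A < +oo)%E).

Lemma measurable_invr :
  measurable_fun [set: measurableTypeR R] (fun x : R => x^-1 : measurableTypeR R).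
Proof.
pose Z : set (measurableTypeR R) := [set 0].
have mZ : measurable Z by exact: measurable_set1.
rewrite -(setvU Z); apply/measurable_funU => //; first exact: measurableC.
split; last exact: measurable_fun_set1.
apply: open_continuous_measurable_fun; first by apply: closed_openC; exact: closed_eq.
by move=> x /[1!inE] /eqP x0; exact: inv_continuous.
Qed.

Lemma L2_approximation_rV (H : S -> 'rV[R]_n) (f : 'rV[R]_n -> R) (C : R) :
  measurable_fun A H -> measurable_fun setT (f : _ -> measurableTypeR R) ->
  (forall x, `|f x| <= C) ->
  exists phi : nat -> 'rV[R]_n -> R,
    (forall k, Ck 1 (phi k) /\ compactly_supported (phi k)) /\
    L2norm mu A (fun p => f (H p) - phi k (H p)) @[k --> \oo] --> 0%E.
Proof.
move=> mH mf fC; pose c (i : 'I_n) (x : 'rV[R]_n) := x ord0 i.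
apply: (@L2_approximation _ _ _ mu A mA muA _ n c H _ _ _ f C) => //.
- by move=> i; exact: Ck_coord.
- by move=> i; exact: (measurableT_comp (measurable_rV_coord i) mH).
- move=> M; apply: (@subclosed_compact _ _ [set x | `|x| <= `|M|]).
  + rewrite (_ : [set v | _] = \bigcap_(i in [set: 'I_n]) (fun v => `|c i v|) @^-1` [set y | y <= M]).
      apply: closed_bigI => i _; apply: closed_comp; last exact: closed_le.
      move=> x _; apply: (continuous_comp ((Ck_coord 0%N i : continuous (c i)) x)); exact: norm_continuous.
    by apply/seteqP; split => v /= h i //; [move=> _; exact: h|exact: h].
  + exact: compact_norm_le.
  + by move=> x /= h; apply/rV_norm_leP => // i; apply: le_trans (h i) (ler_norm M).
- apply: (measurableT_comp mf).
  by apply: measurable_fun_rVP => i; have := @box_measurable_coord _ _ _ c i.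
- exact: measurableT_comp mH.
Qed.

Lemma L2_approximation_spacetime (H : S -> R * 'rV[R]_n) (f : R * 'rV[R]_n -> R) (C : R) :
  measurable_fun setT (fun p => (H p).1 : measurableTypeR R) ->
  measurable_fun setT (fun p => (H p).2) ->
  measurable_fun setT
    (fun p : measurableTypeR R * 'rV[R]_n => f p : measurableTypeR R) ->
  (forall x, `|f x| <= C) ->
  exists phi : nat -> R * 'rV[R]_n -> R,
    (forall k, Ck 1 (phi k) /\ compactly_supported (phi k)) /\
    L2norm mu A (fun p => f (H p) - phi k (H p)) @[k --> \oo] --> 0%E.
Proof.
move=> mH1 mH2 mf fC.
pose c (i : 'I_n.+1) (x : R * 'rV[R]_n) : R :=
  if unlift ord0 i is Some j then x.2 ord0 j else x.1.
have Cc k i : Ck k (c i).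
  rewrite /c; case: (unlift _ _) => [j|].
    apply: (Ck_comp_linear (l := snd) (f := fun x : 'rV[R]_n => x ord0 j)).
      by move=> x; exact: cvg_snd.
    exact: Ck_coord.
  by apply: (@Ck_linear _ _ k fst) => x; exact: cvg_fst.
apply: (@L2_approximation _ _ _ mu A mA muA _ n.+1 c H _ _ _ f C) => //.
- move=> i; apply: measurable_funTS; rewrite /c; case: (unlift _ _) => [j|//].
  exact: (measurableT_comp (measurable_rV_coord j) mH2).
- move=> M; apply: (@subclosed_compact _ _
    ([set x : R | `|x| <= `|M|] `*` [set x : 'rV[R]_n | `|x| <= `|M|])).
  + rewrite (_ : [set v | _] = \bigcap_(i in [set: 'I_n.+1]) (fun v => `|c i v|) @^-1` [set y | y <= M]).
      apply: closed_bigI => i _; apply: closed_comp; last exact: closed_le.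
      move=> x _; apply: (continuous_comp ((Cc 0%N i : continuous (c i)) x)); exact: norm_continuous.
    by apply/seteqP; split => v /= h i //; [move=> _; exact: h|exact: h].
  + apply: compact_setX; last exact: compact_norm_le.
    rewrite (_ : [set x | _] = `[(- `|M|), `|M|]%classic); first exact: segment_compact.
    by apply/seteqP; split => x /=; rewrite in_itv/= ler_norml.
  + move=> x /= h; split => /=.
      by have := h ord0; rewrite /c unlift_none => /le_trans; apply; exact: ler_norm.
    apply/rV_norm_leP => // j; have := h (lift ord0 j).
    by rewrite /c liftK => /le_trans; apply; exact: ler_norm.
- apply: (measurableT_comp mf); apply/measurable_fun_pairP; split.
    by have := @box_measurable_coord _ _ _ c ord0; rewrite /box_measurable /c unlift_none.
  apply: measurable_fun_rVP => j.
  by have := @box_measurable_coord _ _ _ c (lift ord0 j); rewrite /box_measurable /c liftK.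
- rewrite (_ : f \o H = fun p => f ((H p).1, (H p).2)).
    have mp : measurable_fun setT
        (fun p => ((H p).1, (H p).2) : measurableTypeR R * 'rV[R]_n).
      exact: measurable_fun_pair mH1 mH2.
    by apply: measurable_funTS; exact: (measurableT_comp mf mp).
  by apply/funext => p /=; case: (H p).
Qed.

End test_function_density.

(** * Flows of shrinking blobs *)

Section right_affine.
Context {R : realType} {W : lmodType R}.
Implicit Types (F G : R -> W) (t : R) (v w : W).

(** Motion at constant velocity immediately after time [t]: the forward quotients
    are eventually constant, so their limit comes for free. *)
Definition right_affine F t v := exists2 e : R, 0 < e &
  forall h, 0 < h < e -> F (t + h) = F t + h *: v.

Lemma right_affine_cst w t : right_affine (fun=> w) t 0.
Proof. by exists 1 => // h _; rewrite scaler0 addr0. Qed.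

Lemma right_affineD F G t v w : right_affine F t v -> right_affine G t w ->
  right_affine (fun t => F t + G t) t (v + w).
Proof.
move=> [e e0 he] [d d0 hd]; exists (Num.min e d); first by rewrite lt_min e0.
move=> h /andP[h0]; rewrite lt_min => /andP[h1 h2].
by rewrite he ?h0// hd ?h0// scalerDr addrACA.
Qed.

Lemma right_affine_sum N (F : nat -> R -> W) t (v : nat -> W) :
  (forall j, right_affine (F j) t (v j)) ->
  right_affine (fun t => \sum_(j < N) F j t) t (\sum_(j < N) v j).
Proof.
move=> h; elim: N => [|N IH].
  by rewrite big_ord0; under [X in right_affine X]eq_fun do rewrite big_ord0;
    exact: right_affine_cst.
rewrite big_ord_recr; under [X in right_affine X]eq_fun do rewrite big_ord_recr.
exact: right_affineD.
Qed.

Lemma right_affine_scale (f : R -> R) t (d : R) w :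
  (exists2 e : R, 0 < e & forall h, 0 < h < e -> f (t + h) = f t + h * d) ->
  right_affine (fun t => f t *: w) t (d *: w).
Proof.
by move=> [e e0 he]; exists e => // h h0; rewrite he// scalerDl scalerA.
Qed.

End right_affine.

Lemma glue_coord {R : realType} (S : Type) n (B : nat -> set S) (f : nat -> S -> 'rV[R]_n) p i :
  glue B f p ord0 i = glue B (fun k p => f k p ord0 i) p.
Proof. by rewrite /glue; case: ifP => // _; rewrite mxE. Qed.

Lemma measurable_continuous_rV {R : realType} n (f : 'rV[R]_n -> R) : continuous f ->
  measurable_fun setT (f : _ -> measurableTypeR R).
Proof.
move=> /continuousP cf; apply: (measurability _ (RGenOpens.measurableE R)).
move=> _ [_ [a [b ->] <-]]; rewrite setTI; apply: measurable_open_rV; apply: cf.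
exact: interval_open.
Qed.

Section integrability.
Context {R : realType} d (S : measurableType d).
Variables (mu : {measure set S -> \bar R}) (A : set S).
Hypotheses (mA : measurable A) (muA : (mu A < +oo)%E).

Lemma bounded_integrable (f : S -> R) (M : R) : measurable_fun A f ->
  (forall x, A x -> `|f x| <= M) -> mu.-integrable A (fun x => (f x)%:E).
Proof.
move=> mf fM; apply: (measurable_bounded_integrable mA) => //.
exists M; split; first exact: num_real.
by move=> N MN x Ax; apply: le_trans (fM x Ax) (ltW MN).
Qed.

(** [`|f| <= (f - g) ^+ 2 + 1 + B]. *)
Lemma L2_near_bounded_integrable (f g : S -> R) (B : R) : measurable_fun A f ->
  measurable_fun A g -> (forall x, A x -> `|g x| <= B) ->
  (L2norm mu A (fun x => f x - g x)%R < +oo)%E ->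
  mu.-integrable A (fun x => (f x)%:E).
Proof.
move=> mf mg gB h.
have mfg : measurable_fun A (fun x => f x - g x) by exact: measurable_funB.
have foo : (\int[mu]_(x in A) ((f x - g x) ^+ 2)%:E < +oo)%E.
  rewrite ltNge leye_eq; apply/eqP => e; move: h.
  by rewrite /L2norm e ltxx.
have i2 : mu.-integrable A (fun x => ((f x - g x) ^+ 2 + (1 + B))%:E).
  under eq_fun do rewrite EFinD; apply: integrableD => //; last first.
    exact: (@bounded_integrable (cst (1 + B)) `|1 + B|).
  apply/integrableP; split.
    by apply/measurable_EFinP; exact: measurable_funX.
  by under eq_integral do rewrite gee0_abs ?lee_fin ?sqr_ge0//.
apply: le_integrable i2 => //; first exact/measurable_EFinP.
move=> x Ax; rewrite /= lee_fin; apply: le_trans (ler_norm _).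
have h1 : `|f x| <= `|f x - g x| + B.
  have := ler_normD (f x - g x) (g x); rewrite subrK => /le_trans; apply.
  by rewrite lerD2l gB.
have h2 : `|f x - g x| <= (f x - g x) ^+ 2 + 1.
  rewrite -[X in _ <= X + 1]real_normK ?num_real//.
  set s := `|_|; have := sqr_ge0 (s - 1).
  by have : 0 <= s := normr_ge0 _; rewrite sqrrB1 expr2; nra.
lra.
Qed.

End integrability.

Section blob_flow.
Context {R : realType} {n : nat}.
Variables (T : R) (D : set 'rV[R]_n.+1) (P V : nat -> R -> 'rV[R]_n.+1) (C : R).
Local Notation Leb := (rV_lebesgue n.+1).
Local Notation leb := (@lebesgue_measure R).
Local Notation kap := (blob_index D).
Local Notation xi := (blob_offset D).
Local Notation piece := (blob_piece D).
Local Notation tau := (tau T).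
Local Notation rad := (rad T).

Definition blob_size k (t : R) : R := shrink T k t * rad k.

(** The right derivative of [blob_size k], up to sign. *)
Definition gather_rate k (t : R) : R := if t < tau k then rad k / tau k else 0.

Definition blob_flow (t : R) (y : 'rV[R]_n.+1) : 'rV[R]_n.+1 :=
  P (kap y) t + blob_size (kap y) t *: xi y.

Definition blob_speed (t : R) (y : 'rV[R]_n.+1) : 'rV[R]_n.+1 :=
  V (kap y) t - gather_rate (kap y) t *: xi y.

Definition blob_tube k : set (measurableTypeR R * 'rV[R]_n.+1) :=
  [set p | `|p.2 - P k p.1| <= blob_size k p.1].

(** The velocity of blob [k] as a function of the position: [blob_size k] vanishes
    linearly at time [tau k], so the speed of contraction towards [P k] is the
    distance divided by the remaining time. *)
Definition tube_velocity k (p : measurableTypeR R * 'rV[R]_n.+1) : 'rV[R]_n.+1 :=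
  V k p.1 - (tau k - p.1)^-1 *: (p.2 - P k p.1).

(** Tubes overlap only once their blobs have gathered and merged, and then their
    velocities agree; [seqDU] makes a measurable choice among them. *)
Definition blob_velocity (t : R) (z : 'rV[R]_n.+1) : 'rV[R]_n.+1 :=
  glue (seqDU blob_tube) tube_velocity (t, z).

Hypotheses (T0 : 0 < T) (oD : open D) (D1 : Leb D = 1%E).
Hypothesis P_cont : forall k, continuous (P k).
Hypothesis P_step : forall k t, right_affine (P k) t (V k t).
Hypothesis V_bound : forall k t, `|V k t| <= C.
Hypothesis V_meas : forall k i, measurable_fun [set: measurableTypeR R]
  (fun t => V k t ord0 i : measurableTypeR R).
Hypothesis V_free : forall k t, t < tau k -> V k t = V k 0.
Hypothesis tubes_meet : forall j k t z, j <> k -> 0 <= t <= T ->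
  blob_tube j (t, z) -> blob_tube k (t, z) ->
  [/\ tau j <= t, tau k <= t, V j t = V k t &
      forall t', t <= t' <= T -> P j t' = P k t'].
(** The momentum gained since time 0, tested against functions of the position of
    the gathered blobs, adds up to 0. *)
Hypothesis momentum : forall t i (psi : 'rV[R]_n.+1 -> R), 0 <= t <= T ->
  \sum_(k < N) mass k * (V k t ord0 i - V k 0 ord0 i) * psi (P k t) @[N --> \oo]
    --> (0 : R).

Let rad0 k : 0 < rad k. Proof. exact: rad_gt0. Qed.
Let tau0 k : 0 < tau k. Proof. exact: tau_gt0. Qed.

Lemma blob_size_ge0 k t : 0 <= blob_size k t.
Proof. by rewrite mulr_ge0 ?shrink_ge0 ?ltW. Qed.

Lemma blob_size_gathered k t : tau k <= t -> blob_size k t = 0.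
Proof. by move=> h; rewrite /blob_size shrink_gathered// mul0r. Qed.

Lemma blob_size_gathering k t : t < tau k -> blob_size k t = (tau k - t) * (rad k / tau k).
Proof. by move=> h; rewrite /blob_size shrink_gathering//; field; rewrite gt_eqF. Qed.

Lemma gather_rate_ge0 k t : 0 <= gather_rate k t.
Proof. by rewrite /gather_rate; case: ifP => // _; rewrite divr_ge0 ?ltW. Qed.

Lemma gather_rate_le k t : gather_rate k t <= T.
Proof.
rewrite /gather_rate; case: ifP => _; last exact: ltW.
rewrite (_ : rad k / tau k = hit T k / 2); last first.
  by rewrite /rad /tau; field; rewrite gt_eqF ?hit_gt0.
have := hit_le T0 (leq0n k); rewrite hit0; have := hit_gt0 T0 k; lra.
Qed.

Lemma blob_size_step k (t : R) : exists2 e : R, 0 < e & forall h, 0 < h < e ->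
  blob_size k (t + h) = blob_size k t - h * gather_rate k t.
Proof.
have [tt|tt] := ltP t (tau k); last first.
  exists 1 => // h /andP[h0 _]; rewrite /gather_rate ltNge tt/= mulr0 subr0.
  by rewrite !blob_size_gathered//; lra.
exists (tau k - t); first by rewrite subr_gt0.
move=> h /andP[h0 h1]; rewrite /gather_rate tt !blob_size_gathering//; last by lra.
by ring.
Qed.

Lemma blob_size_continuous k : continuous (blob_size k).
Proof.
rewrite (_ : blob_size k = fun t => Num.max 0 (1 - t / tau k) * rad k)// => t.
apply: cvgM; last exact: cvg_cst.
have h : {for t, continuous (fun t : R => 1 - t / tau k)}.
  by apply: cvgB; [exact: cvg_cst|apply: cvgM; [exact: cvg_id|exact: cvg_cst]].
exact: (continuous_max (f := cst 0) (cvg_cst _) h).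
Qed.

Lemma blob_offset_coord y i : `|xi y ord0 i| <= 1.
Proof. exact: (proj1 (rV_norm_leP _ ler01)) (blob_offset_norm D y) i. Qed.

Lemma blob_flow_tube t y : blob_tube (kap y) (t, blob_flow t y).
Proof.
rewrite /blob_tube/= /blob_flow addrC addKr normrZ ger0_norm ?blob_size_ge0//.
by rewrite ler_piMr ?blob_size_ge0// blob_offset_norm.
Qed.

Lemma blob_flow_gathered t y : tau (kap y) <= t -> blob_flow t y = P (kap y) t.
Proof. by move=> h; rewrite /blob_flow blob_size_gathered// scale0r addr0. Qed.

Lemma cvg_forward_quotient t y :
  forward_quotient blob_flow t y h @[h --> 0^'+] --> blob_speed t y.
Proof.
apply: cvg_near_cst.
have [e1 e10 h1] := P_step (kap y) t; have [e2 e20 h2] := blob_size_step (kap y) t.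
near=> h.
have h0 : 0 < h by near: h; exact: nbhs_right_gt.
have he1 : h < e1 by near: h; exact: nbhs_right_lt.
have he2 : h < e2 by near: h; exact: nbhs_right_lt.
rewrite /forward_quotient /blob_flow h1 ?h0// h2 ?h0//.
rewrite (_ : _ - _ = h *: blob_speed t y).
  by rewrite scalerA mulVf ?scale1r// gt_eqF.
rewrite /blob_speed; move: (P _ _) (V _ _) (xi y) (blob_size _ _) => p v x s.
by apply/rowP => i; rewrite !mxE; ring.
Unshelve. all: by end_near. Qed.

Lemma forward_derivative_blob_flow t y :
  forward_derivative blob_flow t y = blob_speed t y.
Proof. by apply: cvg_lim => //; exact: cvg_forward_quotient. Qed.

Lemma tube_velocity_flow t y : tube_velocity (kap y) (t, blob_flow t y) = blob_speed t y.
Proof.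
rewrite /tube_velocity /blob_speed /blob_flow/= [P _ _ + _]addrC addrK scalerA; congr (_ - _ *: _).
rewrite /gather_rate; case: ltP => h; last by rewrite blob_size_gathered// mulr0.
by rewrite blob_size_gathering// mulKf// subr_eq0 gt_eqF.
Qed.

Lemma seqDU_tube t z k : blob_tube k (t, z) ->
  exists2 j, seqDU blob_tube j (t, z) & blob_tube j (t, z).
Proof.
move=> h; have : (\bigcup_k blob_tube k) (t, z) by exists k.
by rewrite seqDU_bigcup_eq => -[j _ hj]; exists j => //; case: hj.
Qed.

Lemma seqDU_tube_disjoint p i j : seqDU blob_tube i p -> seqDU blob_tube j p -> i = j.
Proof.
by move=> hi hj; apply: (@trivIset_seqDU _ blob_tube i j I I); exists p.
Qed.

(** Two tubes that contain the position of [y] have the same velocity there, so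
    the choice made by [seqDU] is immaterial. *)
Lemma blob_velocityE t y : 0 <= t <= T ->
  blob_velocity t (blob_flow t y) = blob_speed t y.
Proof.
move=> tT; rewrite -tube_velocity_flow; have h := blob_flow_tube t y.
have [j Sj hj] := seqDU_tube h.
rewrite /blob_velocity (glueE _ (k := j))//; last by move=> a b; exact: seqDU_tube_disjoint.
have [->//|/eqP jk] := eqVneq j (kap y).
have [tj tk Vjk _] := tubes_meet jk tT hj h.
rewrite /tube_velocity Vjk; congr (_ - _).
have z0 k : tau k <= t -> blob_tube k (t, blob_flow t y) -> blob_flow t y - P k t = 0.
  move=> tk' h'; apply/eqP; rewrite -normr_le0; apply: le_trans h' _.
  by rewrite blob_size_gathered.
by rewrite /= (z0 j)// (z0 (kap y))// !scaler0.
Qed.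

Lemma blob_velocity_bound t z : `|blob_velocity t z| <= C + T.
Proof.
have C0 : 0 <= C by apply: le_trans (V_bound 0 0).
rewrite /blob_velocity; have [[k [hk _] ->]|[_ ->]] :=
  glueP (seqDU blob_tube) tube_velocity (t, z); last by rewrite normr0 addr_ge0// ltW.
apply: le_trans (ler_normB _ _) _; apply: lerD => //=.
rewrite normrZ; move: hk; rewrite /blob_tube/=.
have [tt|tt] := ltP t (tau k); last first.
  rewrite blob_size_gathered// normr_le0 => /eqP ->.
  by rewrite normr0 mulr0 ltW.
rewrite blob_size_gathering// => hk.
rewrite normfV gtr0_norm ?subr_gt0// ler_pdivrMl ?subr_gt0//.
apply: le_trans hk _; rewrite ler_pM2l ?subr_gt0//.
by have := gather_rate_le k t; rewrite /gather_rate tt.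
Qed.

Lemma blob_speed_coord t y i : blob_speed t y ord0 i =
  V (kap y) t ord0 i - gather_rate (kap y) t * xi y ord0 i.
Proof. by rewrite mxE [X in _ + X]mxE [X in - X]mxE. Qed.

Lemma blob_speed_bound t y i : `|blob_speed t y ord0 i| <= C + T.
Proof.
rewrite blob_speed_coord; apply: le_trans (ler_normB _ _) _; apply: lerD.
  by apply: (proj1 (rV_norm_leP _ _)) => //; apply: le_trans (V_bound 0 0).
rewrite normrM ger0_norm ?gather_rate_ge0//.
apply: le_trans (gather_rate_le (kap y) t).
by rewrite ler_piMr ?gather_rate_ge0// blob_offset_coord.
Qed.

Section measurability.

Let mt : measurable_fun setT (fun p : measurableTypeR R * 'rV[R]_n.+1 => p.1).
Proof. exact: measurable_fst. Qed.

Let mz i : measurable_fun setT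
  (fun p : measurableTypeR R * 'rV[R]_n.+1 => p.2 ord0 i : measurableTypeR R).
Proof. exact: (measurableT_comp (measurable_rV_coord i) measurable_snd). Qed.

Let mxi i : measurable_fun setT
  (fun p : measurableTypeR R * 'rV[R]_n.+1 => xi p.2 ord0 i : measurableTypeR R).
Proof. exact: (measurableT_comp (measurable_blob_offset D i) measurable_snd). Qed.

Let mP k i : measurable_fun [set: measurableTypeR R]
  (fun t => P k t ord0 i : measurableTypeR R).
Proof.
apply: continuous_measurable_fun => t.
exact: (@continuous_comp _ _ _ (P k) (fun x : 'rV[R]_n.+1 => x ord0 i) t
  (@P_cont k t) (@coord_continuous _ _ _ ord0 i _)).
Qed.

Let ms k : measurable_fun [set: measurableTypeR R]
  (fun t => blob_size k t : measurableTypeR R).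
Proof. exact: continuous_measurable_fun (@blob_size_continuous k). Qed.

Lemma measurable_spacetime_blob_flow : measurable_fun setT
  (fun p : measurableTypeR R * 'rV[R]_n.+1 => blob_flow p.1 p.2).
Proof.
apply: measurable_fun_rVP => i; under eq_fun do rewrite mxE [X in _ + X]mxE.
apply: (measurable_select (idx := fun p => kap p.2)
  (f := fun k p => P k p.1 ord0 i + blob_size k p.1 * xi p.2 ord0 i)) => k.
  rewrite (_ : [set p | _] = snd @^-1` [set y | kap y = k])//.
  by rewrite -[X in measurable X]setTI; apply: measurable_snd => //; exact: measurable_blob_index.
apply: measurable_funD; first exact: (measurableT_comp (mP k i) mt).
by apply: measurable_funM; [exact: (measurableT_comp (ms k) mt)|exact: mxi].
Qed.

Lemma measurable_blob_flow t : measurable_fun setT (blob_flow t).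
Proof.
exact: (measurableT_comp (measurable_spacetime_blob_flow)
  (pair1_measurable (t : measurableTypeR R))).
Qed.

Lemma measurable_blob_speed t i :
  measurable_fun setT (fun y => blob_speed t y ord0 i : measurableTypeR R).
Proof.
under eq_fun do rewrite blob_speed_coord.
apply: (measurable_select (idx := kap)
  (f := fun k y => V k t ord0 i - gather_rate k t * xi y ord0 i)) => k.
  exact: measurable_blob_index.
apply: measurable_funB => //; apply: measurable_funM => //.
exact: measurable_blob_offset.
Qed.

Lemma measurable_blob_tube k : measurable (blob_tube k).
Proof.
rewrite (_ : blob_tube k = \bigcap_(i in [set: 'I_n.+1])
    (fun p : measurableTypeR R * 'rV[R]_n.+1 =>
       `|p.2 ord0 i - P k p.1 ord0 i| - blob_size k p.1) @^-1` `]-oo, 0]%classic).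
  apply: (@fin_bigcap_measurable _ _ _ [set: 'I_n.+1]) => [|i _]; first exact: finite_finset.
  rewrite -[X in measurable X]setTI.
  suff : measurable_fun setT (fun p : measurableTypeR R * 'rV[R]_n.+1 =>
     `|p.2 ord0 i - P k p.1 ord0 i| - blob_size k p.1 : measurableTypeR R).
    by apply => //; exact: measurable_itv.
  apply: measurable_funB; last exact: (measurableT_comp (ms k) mt).
  apply: measurableT_comp => //; apply: measurable_funB; first exact: mz.
  exact: (measurableT_comp (mP k i) mt).
apply/seteqP; split => p.
  move=> /(rV_norm_leP _ (blob_size_ge0 k p.1)) h i _ /=.
  by rewrite in_itv/= subr_le0; have := h i; rewrite !mxE.
move=> h; apply/rV_norm_leP; first exact: blob_size_ge0.
by move=> i; have := h i I; rewrite /= in_itv/= subr_le0 !mxE.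
Qed.

Lemma measurable_blob_velocity i : measurable_fun setT
  (fun p : measurableTypeR R * 'rV[R]_n.+1 =>
     blob_velocity p.1 p.2 ord0 i : measurableTypeR R).
Proof.
rewrite (_ : (fun p => _) = glue (seqDU blob_tube) (fun k p =>
    V k p.1 ord0 i - (tau k - p.1)^-1 * (p.2 ord0 i - P k p.1 ord0 i))).
  apply: measurable_glue => //.
  - move=> k; rewrite setTI; apply: measurableD; first exact: measurable_blob_tube.
    by apply: bigsetU_measurable => j _; exact: measurable_blob_tube.
  - move=> k; apply: measurable_funB; first exact: (measurableT_comp (V_meas k i) mt).
    apply: measurable_funM; last first.
      by apply: measurable_funB; [exact: mz|exact: (measurableT_comp (mP k i) mt)].
    apply: (measurableT_comp measurable_invr); exact: measurable_funB.
  - by move=> p j k _; exact: seqDU_tube_disjoint.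
apply/funext => -[t z]; rewrite /blob_velocity glue_coord/=; congr (glue _ _ _).
by apply/funext => k; apply/funext => p; rewrite /tube_velocity !mxE.
Qed.

Lemma measurable_blob_velocity_at t i : measurable_fun setT
  (fun z => blob_velocity t z ord0 i : measurableTypeR R).
Proof.
exact: (measurableT_comp (measurable_blob_velocity i)
  (pair1_measurable (t : measurableTypeR R))).
Qed.

End measurability.

Let mD : measurable D. Proof. exact: measurable_open_rV. Qed.
Let Doo : (Leb D < +oo)%E. Proof. by rewrite D1 ltry. Qed.

Lemma Jt_blob_velocity t i : Jt D blob_flow t (fun x => blob_velocity t x ord0 i).
Proof.
split; first exact: measurable_blob_velocity_at.
apply: (L2_approximation_rV mD Doo (H := blob_flow t)
    (f := fun x => blob_velocity t x ord0 i) (C := C + T)).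
- by apply: measurable_funTS; exact: measurable_blob_flow.
- exact: measurable_blob_velocity_at.
- move=> x; apply: (proj1 (rV_norm_leP _ _)); last exact: blob_velocity_bound.
  by rewrite addr_ge0 ?(ltW T0)//; apply: le_trans (V_bound 0 0).
Qed.

Lemma J_blob_velocity i : J T D blob_flow (fun t x => blob_velocity t x ord0 i).
Proof.
split; first by apply: measurable_funTS; exact: measurable_blob_velocity.
have m0T : measurable (`[0, T]%classic : set (measurableTypeR R)) by exact: measurable_itv.
have mA : measurable ((`[0, T]%classic : set (measurableTypeR R)) `*` D).
  exact: measurableX.
apply: (@L2_approximation_spacetime R n.+1 _ _ (leb \x Leb)%E _ mA _
    (fun p : measurableTypeR R * 'rV[R]_n.+1 => (p.1 : R, blob_flow p.1 p.2))
    (fun p => blob_velocity p.1 p.2 ord0 i) (C + T)).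
- rewrite [X in (X < _)%E](product_measure1E _ _ m0T mD).
  rewrite [X in (_ * X < _)%E]D1 mule1 [X in (X < _)%E]lebesgue_measure_itv/= lte_fin T0.
  by rewrite -EFinB ltry.
- exact: measurable_fst.
- exact: measurable_spacetime_blob_flow.
- exact: measurable_blob_velocity.
- move=> x; apply: (proj1 (rV_norm_leP _ _)); last exact: blob_velocity_bound.
  by rewrite addr_ge0 ?(ltW T0)//; apply: le_trans (V_bound 0 0).
Qed.

(** A limit of bounded functions for the L2 norm of a finite measure. *)
Lemma Jt_integrable t phi : Jt D blob_flow t phi ->
  Leb.-integrable D (fun y => (phi (blob_flow t y))%:E).
Proof.
move=> [mphi [f [hf cvf]]].
have [N _ hN] : \forall k \near \oo, (normJt D blob_flow t (fun x => (phi x - f k x)%R) < 1)%E.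
  apply: (cvf [set e | (e < 1)%E]); apply: open_nbhs_nbhs; split => /=.
    exact: open_ereal_lt_ereal.
  by rewrite lte_fin.
have [Cf sf] := hf N; have cN : continuous (f N) := CkW Cf.
have [B hB] : exists B, forall x, `|f N x| <= B.
  have : bounded_set (f N @` closure [set x | f N x != 0]).
    by apply: compact_bounded; apply: continuous_compact => //; exact: continuous_subspaceT.
  move=> [M [_ hM]]; exists (`|M| + 1) => x.
  have [->|x0] := eqVneq (f N x) 0; first by rewrite normr0 addr_ge0.
  apply: hM; first by rewrite (le_lt_trans (ler_norm M))// ltrDl.
  by exists x => //; exact: subset_closure.
have mX := @measurable_funTS _ _ _ _ D _ (measurable_blob_flow t).
apply: (@L2_near_bounded_integrable _ _ _ _ _ mD Doo (phi \o blob_flow t)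
  (f N \o blob_flow t) B).
- exact: measurableT_comp mX.
- exact: (measurableT_comp (measurable_continuous_rV cN) mX).
- by move=> y _; exact: hB.
- by apply: (lt_trans (hN N (leqnn N))); rewrite ltry.
Qed.

(** Before it has gathered, a blob keeps its initial velocity.  Afterwards the test
    function is constant on it and the offset has mean zero, so that only the
    momentum gained since time 0 remains. *)
Lemma orthogonal_blob_velocity t i w : 0 <= t <= T -> Kt D blob_flow t w ->
  (\int[Leb]_(y in D)
     ((blob_velocity t (blob_flow t y) ord0 i - blob_speed 0 y ord0 i) * w y)%:E = 0)%E.
Proof.
move=> tT [phi Jphi <-] {w}; have iphi := Jt_integrable Jphi.
have [mphi _] := Jphi.
have CT0 : 0 <= C + T by rewrite addr_ge0 ?(ltW T0)//; apply: le_trans (V_bound 0 0).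
pose E y := blob_speed t y ord0 i - blob_speed 0 y ord0 i.
have mE : measurable_fun setT (E : _ -> measurableTypeR R).
  by apply: measurable_funB; exact: measurable_blob_speed.
have EC y : `|E y| <= 2 * (C + T).
  apply: le_trans (ler_normB _ _) _; rewrite mulr_natl mulr2n.
  by apply: lerD; exact: blob_speed_bound.
have mpX : measurable_fun setT (fun y => phi (blob_flow t y) : measurableTypeR R).
  exact: (measurableT_comp mphi (measurable_blob_flow t)).
rewrite (eq_integral (fun y => (E y * phi (blob_flow t y))%:E)); last first.
  by move=> y _; rewrite blob_velocityE.
have iE : Leb.-integrable D (fun y => (E y * phi (blob_flow t y))%:E).
  apply: (le_integrable mD _ _ (integrableZl mD (2 * (C + T)) iphi)).
    by apply/measurable_EFinP; apply: measurable_funTS; exact: measurable_funM.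
  move=> y _; rewrite /= lee_fin !normrM; apply: ler_wpM2r => //.
  by apply: le_trans (EC y) _; rewrite ger0_norm ?mulr_ge0// ?ger0_norm// mulr_ge0.
rewrite (blob_piece_cover D) integral_bigcup; last 3 first.
- exact: blob_piece_trivIset.
- by move=> k; exact: measurable_blob_piece.
- by rewrite -blob_piece_cover.
pose c k := mass k * (V k t ord0 i - V k 0 ord0 i) * phi (P k t).
rewrite (eq_eseriesr (g := fun k => (c k)%:E)); last first.
  move=> k _; have mk := measurable_blob_piece oD k.
  have koo : (Leb (piece k) < +oo)%E by rewrite blob_piece_mass// ltry.
  have [tk|tk] := ltP t (tau k).
    rewrite /c (V_free tk) subrr mulr0 mul0r integral0_eq// => y [_ ky].
    rewrite /E /blob_speed ky (V_free tk) /gather_rate tk tau0.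
    by rewrite subrr mul0r.
  pose g := gather_rate k 0; pose v := V k t ord0 i - V k 0 ord0 i.
  transitivity (\int[Leb]_(y in piece k)
      ((v * phi (P k t))%:E + (g * phi (P k t))%:E * (xi y ord0 i)%:E))%E.
    apply: eq_integral => y /[1!inE] -[_ ky].
    rewrite blob_flow_gathered ?ky// -EFinM -EFinD; congr (_%:E).
    rewrite /E !blob_speed_coord ky -/g /v [gather_rate k t]/gather_rate ltNge tk/=.
    by ring.
  have ixi : Leb.-integrable (piece k) (fun y => (xi y ord0 i)%:E).
    apply: (bounded_integrable mk koo (M := 1)); last by move=> y _; exact: blob_offset_coord.
    by apply: measurable_funTS; exact: measurable_blob_offset.
  rewrite integralD//; last 2 first.
  - apply: (bounded_integrable mk koo (f := cst _) (M := `|v * phi (P k t)|)) => //.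
  - exact: integrableZl.
  rewrite integralZl// integral_blob_offset// mule0 adde0 integral_cst//.
  by rewrite [X in (_ * X)%E](blob_piece_mass oD D1 k) -EFinM /c -/v; congr (_%:E); ring.
apply: cvg_lim => //.
rewrite (_ : (fun N => _) = EFin \o (fun N => \sum_(k < N) c k)); last first.
  by apply/funext => N /=; rewrite big_mkord sumEFin.
by apply: cvg_EFin; [exact: nearW|exact: momentum].
Qed.

(** The norm bound is orthogonality tested against the velocity itself, because
    [f ^+ 2 <= g ^+ 2 + 2 * (f - g) * f]. *)
Lemma isW_blob_velocity i :
  isW T D blob_flow (fun y => forward_derivative blob_flow 0 y ord0 i)
    (fun t x => blob_velocity t x ord0 i).
Proof.
rewrite (_ : (fun y => _) = fun y => blob_speed 0 y ord0 i); last first.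
  by apply/funext => y; rewrite forward_derivative_blob_flow.
split; first exact: J_blob_velocity.
move=> t tT; split; [exact: Jt_blob_velocity| |by move=> w; exact: orthogonal_blob_velocity].
pose g y := blob_speed 0 y ord0 i.
pose f y := blob_velocity t (blob_flow t y) ord0 i.
have fE y : f y = blob_speed t y ord0 i by rewrite /f blob_velocityE.
have mg : measurable_fun D g by apply: measurable_funTS; exact: measurable_blob_speed.
have mf : measurable_fun D f.
  apply: (eq_measurable_fun (fun y => blob_speed t y ord0 i)) => [y _|].
    by rewrite fE.
  by apply: measurable_funTS; exact: measurable_blob_speed.
have fC y : `|f y| <= C + T by rewrite fE blob_speed_bound.
have gC y : `|g y| <= C + T by rewrite blob_speed_bound.
have orth : (\int[Leb]_(y in D) ((f y - g y) * f y)%:E = 0)%E.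
  apply: orthogonal_blob_velocity => //.
  by exists (fun x => blob_velocity t x ord0 i) => //; exact: Jt_blob_velocity.
have ib (a b : 'rV[R]_n.+1 -> R) (A B : R) : measurable_fun D a -> measurable_fun D b ->
    (forall y, `|a y| <= A) -> (forall y, `|b y| <= B) ->
    Leb.-integrable D (fun y => (a y * b y)%:E).
  move=> ma mb aA bB; apply: (bounded_integrable mD Doo (M := A * B)).
    exact: measurable_funM.
  by move=> y _; rewrite normrM ler_pM.
have fgC y : `|f y - g y| <= (C + T) + (C + T).
  by apply: le_trans (ler_normB _ _) _; exact: lerD.
have igg := ib _ _ _ _ mg mg gC gC.
have iff := ib _ _ _ _ mf mf fC fC.
have ifg := ib _ _ _ _ (measurable_funB mf mg) mf fgC fC.
rewrite /normJt /L2norm lee_sqrt; last first.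
  by apply: integral_ge0 => y _; rewrite lee_fin sqr_ge0.
apply: (@le_trans _ _ (\int[Leb]_(y in D)
   ((g y * g y)%:E + 2%:E * ((f y - g y) * f y)%:E))%E).
  apply: le_integral => //.
  - by apply: integrableD => //; exact: integrableZl.
  - move=> y _; rewrite -EFinM -EFinD lee_fin -subr_ge0.
    by rewrite (_ : _ - _ = (f y - g y) ^+ 2) ?sqr_ge0// /f; ring.
rewrite integralD//; last exact: integrableZl.
by rewrite integralZl// orth mule0 adde0.
Qed.

Lemma associated_velocity_blob_flow : associated_velocity T D blob_flow blob_velocity.
Proof. exact: isW_blob_velocity. Qed.

Lemma weak_solution_blob_flow : weak_solution T D blob_flow.
Proof.
exists blob_velocity; split; first exact: associated_velocity_blob_flow.
apply: aeW => -[t y] [/= + Dy]; rewrite in_itv/= => tT.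
by rewrite forward_derivative_blob_flow blob_velocityE.
Qed.

Lemma flow_mapping_blob_flow : flow_mapping T D blob_flow.
Proof.
split.
- by move=> t _; apply: measurable_funTS; exact: measurable_blob_flow.
- move=> y _; apply: continuous_subspaceT => t; apply: cvgD; first exact: P_cont.
  by apply: cvgZl; exact: blob_size_continuous.
- by move=> t y _ _; apply/cvg_ex; exists (blob_speed t y); exact: cvg_forward_quotient.
exists (n.+1%:R * (C + T) ^+ 2) => t _.
apply: (@le_trans _ _ (\int[Leb]_(y in D) (cst (n.+1%:R * (C + T) ^+ 2)%:E y))%E).
  apply: ge0_le_integral => //.
  - by move=> y _; rewrite lee_fin sumr_ge0// => i _; exact: sqr_ge0.
  - apply/measurable_EFinP; apply: measurable_funTS; apply: measurable_sum => i.
    apply: measurable_funX; under eq_fun do rewrite forward_derivative_blob_flow.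
    exact: measurable_blob_speed.
  move=> y _; rewrite /= lee_fin -[X in X%:R * _](card_ord n.+1) -sum1_card natr_sum mulr_suml.
  apply: ler_sum => i _; rewrite mul1r forward_derivative_blob_flow -[leLHS]real_normK ?num_real//.
  have := blob_speed_bound t y i; have := normr_ge0 (blob_speed t y ord0 i).
  by move=> h1 h2; rewrite ler_sqr// nnegrE (le_trans h1).
by rewrite integral_cst// [X in (_ * X)%E]D1 mule1.
Qed.

(** Labels of one blob separate no more once it has gathered, and while it gathers
    their trajectories are distinct unless they coincide for ever. *)
Lemma sticky_blob_flow : sticky T D blob_flow.
Proof.
move=> y1 y2 t0 _ _ t0T e t tT.
have tT' : 0 <= t <= T by move: tT t0T => /andP[h1 ->] /andP[h2 _]; rewrite (le_trans h2).
have [ek|/eqP nk] := eqVneq (kap y1) (kap y2); last first.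
  have h1 := blob_flow_tube t0 y1; have h2 := blob_flow_tube t0 y2; rewrite e in h1.
  have [t1 t2 _ h] := tubes_meet nk t0T h1 h2.
  have /andP[t0t _] := tT.
  by rewrite !blob_flow_gathered ?h//; exact: le_trans t0t.
have [tt|tt] := leP (tau (kap y1)) t0.
  by have /andP[t0t _] := tT; rewrite !blob_flow_gathered -?ek//; exact: le_trans t0t.
move: e; rewrite /blob_flow -ek => /addrI/scalerI -> //.
have : 0 < blob_size (kap y1) t0.
  rewrite blob_size_gathering//; apply: mulr_gt0; last exact: divr_gt0.
  by rewrite subr_gt0.
by move=> /lt0r_neq0.
Qed.

Lemma initial_data_blob_flow (rhob : 'rV[R]_n.+1 -> R) (vb : 'rV[R]_n.+1 -> 'rV[R]_n.+1) :
  (forall x i j, `|x - P i 0| < 2 * rad i -> `|x - P j 0| < 2 * rad j -> i = j) ->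
  rhob = blob_density (fun k => P k 0) rad ->
  (forall i, measurable_fun setT (fun x => vb x ord0 i : measurableTypeR R)) ->
  (forall y, vb (blob_flow 0 y) = blob_speed 0 y) ->
  initial_data D rhob vb blob_flow.
Proof.
move=> disj -> mvb vbE phi [mphi _].
have startE : blob_flow 0 = blob_start D (fun k => P k 0) rad.
  apply/funext => y; rewrite /blob_flow /blob_start; congr (_ + _ *: _).
  by rewrite /blob_size shrink_gathering ?tau0// mul0r subr0 mul1r.
split; first by rewrite startE; exact: integral_blob_start.
move=> i; rewrite -(integral_blob_start oD D1 _ disj (f := fun x => vb x ord0 i * phi x))//.
- by apply: eq_integral => y _; rewrite forward_derivative_blob_flow -vbE startE.
- by apply: measurable_funM; [exact: mvb|exact: mphi].
Qed.

Lemma sticky_weak_solution_blob_flow (rhob : 'rV[R]_n.+1 -> R)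
    (vb : 'rV[R]_n.+1 -> 'rV[R]_n.+1) :
  (forall x i j, `|x - P i 0| < 2 * rad i -> `|x - P j 0| < 2 * rad j -> i = j) ->
  rhob = blob_density (fun k => P k 0) rad -> continuous vb ->
  (forall y, vb (blob_flow 0 y) = blob_speed 0 y) ->
  sticky_weak_solution T D rhob vb blob_flow.
Proof.
move=> disj rE cvb vbE; split.
- exact: flow_mapping_blob_flow.
- exact: weak_solution_blob_flow.
- apply: initial_data_blob_flow => // i; apply: measurable_continuous_rV => x.
  exact: (@continuous_comp _ _ _ vb (fun x : 'rV[R]_n.+1 => x ord0 i) x (cvb x)
    (@coord_continuous _ _ _ ord0 i _)).
- exact: sticky_blob_flow.
Qed.

End blob_flow.

(** * The free and the merging paths *)

Section clocks.
Context {R : realType}.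
Implicit Types (t c a b : R).

Lemma min_right_affine c t : exists2 e : R, 0 < e & forall h, 0 < h < e ->
  Num.min (t + h) c = Num.min t c + h * (t < c)%R%:R.
Proof.
have [tc|ct] := ltP t c.
  exists (c - t); first by rewrite subr_gt0.
  by move=> h /andP[h0 h1]; rewrite mulr1 min_l//; lra.
by exists 1 => // h /andP[h0 _]; rewrite mulr0 addr0 min_r//; lra.
Qed.

(** The time elapsed in the interval from [a] to [b] at time [t]. *)
Definition ramp a b t : R := Num.max 0 (Num.min t b - a).

Lemma ramp_before a b t : t <= a -> ramp a b t = 0.
Proof. by move=> h; apply/max_idPl; rewrite subr_le0 ge_min h. Qed.

Lemma ramp_during a b t : a <= t <= b -> ramp a b t = t - a.
Proof. by move=> /andP[h1 h2]; rewrite /ramp (min_idPl h2); apply/max_idPr; rewrite subr_ge0. Qed.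

Lemma ramp_after a b t : a <= b -> b <= t -> ramp a b t = b - a.
Proof. by move=> h1 h2; rewrite /ramp (min_idPr h2); apply/max_idPr; rewrite subr_ge0. Qed.

Lemma ramp_right_affine a b t : a <= b -> exists2 e : R, 0 < e & forall h, 0 < h < e ->
  ramp a b (t + h) = ramp a b t + h * (a <= t < b)%R%:R.
Proof.
move=> ab; have [ta|at_] := ltP t a.
  exists (a - t); first by rewrite subr_gt0.
  by move=> h /andP[h0 h1]; rewrite mulr0 addr0 !ramp_before//; lra.
have [tb|bt] := ltP t b.
  exists (b - t); first by rewrite subr_gt0.
  move=> h /andP[h0 h1]; rewrite mulr1 !ramp_during//; [lra| |]; apply/andP; split; lra.
by exists 1 => // h /andP[h0 _]; rewrite mulr0 addr0 !ramp_after//; lra.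
Qed.

Lemma continuous_minr c : continuous (fun t => Num.min t c).
Proof.
move=> t; exact: (@continuous_min _ _ (fun t : R => t) (cst c) t cvg_id (cvg_cst _)).
Qed.

Lemma continuous_ramp a b : continuous (ramp a b).
Proof.
move=> t; have h : {for t, continuous (fun t => Num.min t b - a)}.
  by apply: cvgB; [exact: continuous_minr|exact: cvg_cst].
exact: (continuous_max (f := cst 0) (cvg_cst _) h).
Qed.

End clocks.

Section plane_vectors.
Context {R : realType} {n : nat}.

(** The motion takes place in the plane of the first two coordinates. *)
Definition planar (p q : R) : 'rV[R]_n.+2 :=
  \row_i (if i == ord0 then p else if i == lift ord0 ord0 then q else 0).

Lemma planar0 p q : planar p q ord0 ord0 = p.
Proof. by rewrite mxE. Qed.

Lemma planar1 p q : planar p q ord0 (lift ord0 ord0) = q.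
Proof. by rewrite mxE. Qed.

Lemma planarD p q p' q' : planar p q + planar p' q' = planar (p + p') (q + q').
Proof. by apply/rowP => i; rewrite !mxE; do 2?case: ifP => // _; rewrite addr0. Qed.

Lemma planarZ c p q : c *: planar p q = planar (c * p) (c * q).
Proof. by apply/rowP => i; rewrite !mxE; do 2?case: ifP => // _; rewrite mulr0. Qed.

Lemma planarB p q p' q' : planar p q - planar p' q' = planar (p - p') (q - q').
Proof. by rewrite -scaleN1r planarZ planarD !mulN1r. Qed.

Lemma planar_norm_le p q M : `|p| <= M -> `|q| <= M -> `|planar p q| <= M.
Proof.
move=> pM qM; have M0 : 0 <= M by apply: le_trans pM.
by apply/rV_norm_leP => // i; rewrite mxE; do 2?case: ifP => // _; rewrite normr0.
Qed.

Lemma coord_le_norm (x : 'rV[R]_n) i : `|x ord0 i| <= `|x|.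
Proof. exact: (proj1 (rV_norm_leP x (normr_ge0 x))). Qed.

End plane_vectors.

Section two_flows.
Context {R : realType} {n : nat}.
Variable T : R.
Hypothesis T0 : 0 < T.
Local Notation hit := (hit T).
Local Notation tau := (tau T).
Local Notation rad := (rad T).
Local Notation mass := (@mass R).
Local Notation tail := (@tail_mass R).
Implicit Types (j k : nat) (t : R).

Definition centre k : 'rV[R]_n.+2 := planar (ctr0 T k) (ctr1 T k).
Definition blob_vel k : 'rV[R]_n.+2 := planar (vel0 T k) (vel1 T k).
Definition cluster_vel k : 'rV[R]_n.+2 := planar (clu0 T k) (clu1 T k).
Definition meeting_point k : 'rV[R]_n.+2 := planar (hit k ^+ 2) (hit k ^+ 3).

Definition free_path k t : 'rV[R]_n.+2 := centre k + t *: blob_vel k.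

Definition free_vel k (t : R) : 'rV[R]_n.+2 := blob_vel k.

(** Blob [k] is free until [hit k]; from [hit j] to [2 * hit j], for [j <= k], it
    moves with the cluster whose last member is blob [j]. *)
Definition merging_path k t : 'rV[R]_n.+2 := centre k + Num.min t (hit k) *: blob_vel k +
  \sum_(j < k.+1) ramp (hit j) (2 * hit j) t *: cluster_vel j.

Definition merging_vel k t : 'rV[R]_n.+2 := (t < hit k)%R%:R *: blob_vel k +
  \sum_(j < k.+1) (hit j <= t < 2 * hit j)%R%:R *: cluster_vel j.

Let hit0_ k : 0 < hit k := hit_gt0 T0 k.

Lemma arrival k : centre k + hit k *: blob_vel k = meeting_point k.
Proof. by rewrite planarZ planarD position_hit0 position_hit1. Qed.

Lemma cluster_arrival k : meeting_point k.+1 + hit k.+1 *: cluster_vel k.+1 = meeting_point k.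
Proof.
rewrite planarZ planarD /clu0 /clu1 /meeting_point (hitS T k).
by congr planar; ring.
Qed.

Lemma cluster_momentum k :
  mass k *: blob_vel k = tail k *: cluster_vel k - tail k.+1 *: cluster_vel k.+1.
Proof. by rewrite !planarZ planarB momentum0 momentum1. Qed.

Lemma merging_path_free k t : t <= hit k -> merging_path k t = free_path k t.
Proof.
move=> tk; rewrite /merging_path (min_idPl tk) big1 ?addr0// => j _.
by rewrite ramp_before ?scale0r//; apply: le_trans tk (hit_le T0 _); rewrite -ltnS.
Qed.

Lemma merging_vel_free k t : t < hit k -> merging_vel k t = blob_vel k.
Proof.
move=> tk; rewrite /merging_vel tk scale1r big1 ?addr0// => j _.
have hj : hit k <= hit j by apply: hit_le => //; rewrite -ltnS.
by rewrite leNgt (lt_le_trans tk hj) scale0r.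
Qed.

(** Between [hit k.+1] and [hit k] the cluster travels from one meeting point to the
    next, where blob [k] arrives at the same time. *)
Lemma merging_pathS k t : hit k <= t -> merging_path k.+1 t = merging_path k t.
Proof.
move=> kt; have hk := hit0_ k.+1; have hS := hitS T k.
have kt1 : hit k.+1 <= t by lra.
rewrite /merging_path (min_idPr kt1) (min_idPr kt) arrival arrival.
rewrite big_ord_recr/= ramp_after; [|lra|lra].
rewrite (_ : 2 * hit k.+1 - hit k.+1 = hit k.+1); last by ring.
by rewrite [_ + _ *: cluster_vel _]addrC addrA cluster_arrival.
Qed.

Lemma merging_path_merged j k t : (j <= k)%N -> hit j <= t ->
  merging_path k t = merging_path j t.
Proof.
elim: k => [|k IH]; first by rewrite leqn0 => /eqP ->.
rewrite leq_eqVlt => /orP[/eqP ->//|jk] jt; rewrite merging_pathS ?IH//.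
by apply: le_trans jt; exact: hit_le.
Qed.

Lemma merging_path_stage j k t : hit j <= t < 2 * hit j -> (j <= k)%N ->
  merging_path k t = meeting_point j + (t - hit j) *: cluster_vel j.
Proof.
move=> /andP[jt tj] jk; rewrite (merging_path_merged jk)// /merging_path.
rewrite (min_idPr jt) arrival big_ord_recr/= ramp_during ?jt ?ltW//.
rewrite big1 ?add0r// => i _; rewrite ramp_before ?scale0r//.
by apply: le_trans (hit_half T0 (ltn_ord i)); exact: ltW.
Qed.

Lemma merging_vel_stage j k t : hit j <= t < 2 * hit j -> (j <= k)%N ->
  merging_vel k t = cluster_vel j.
Proof.
move=> tj jk; have /andP[jt _] := tj.
rewrite /merging_vel ltNge (le_trans (hit_le T0 jk))// scale0r add0r.
have jk1 : (j < k.+1)%N by [].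
rewrite (bigD1 (Ordinal jk1))//= tj scale1r big1 ?addr0// => i ij.
case: (boolP (hit i <= t < 2 * hit i)) => [ti|_]; last by rewrite scale0r.
by move/eqP: ij; case; apply: val_inj; exact: hit_stage_uniq ti tj.
Qed.

Lemma hit_leT k : hit k <= T.
Proof. by rewrite -[leRHS](hit0 T) hit_le. Qed.

Lemma blob_vel_le k : `|blob_vel k| <= (4 + 8 * T) * hit k.
Proof.
have h0 := hit0_ k; have hT := hit_leT k; have /andP[g1 g2] := @gain_bounds R k.
apply: planar_norm_le; rewrite ger0_norm /vel0 /vel1.
- apply: ler_wpM2r; lra.
- apply: mulr_ge0; lra.
- rewrite expr2 mulrA; apply: ler_wpM2r; first exact: ltW.
  have : 7 / 2 * gain k * hit k <= 8 * T by apply: ler_pM => //; lra.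
  lra.
- by rewrite mulr_ge0 ?sqr_ge0//; lra.
Qed.

Lemma cluster_vel_le k : `|cluster_vel k| <= (4 + 8 * T) * hit k.
Proof.
have h0 := hit0_ k; have hT := hit_leT k.
apply: planar_norm_le; rewrite ger0_norm /clu0 /clu1.
- apply: ler_wpM2r; lra.
- apply: mulr_ge0; lra.
- by rewrite expr2 mulrA; apply: ler_wpM2r; [exact: ltW|lra].
- by rewrite mulr_ge0 ?sqr_ge0.
Qed.

Let speed_bound : R := (4 + 8 * T) * T.

Lemma blob_vel_bound k : `|blob_vel k| <= speed_bound.
Proof.
apply: le_trans (blob_vel_le k) _; apply: ler_wpM2l; last exact: hit_leT.
by have := T0; lra.
Qed.

Lemma cluster_vel_bound k : `|cluster_vel k| <= speed_bound.
Proof.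
apply: le_trans (cluster_vel_le k) _; apply: ler_wpM2l; last exact: hit_leT.
by have := T0; lra.
Qed.

Lemma merging_vel_bound k t : `|merging_vel k t| <= speed_bound.
Proof.
have [tk|kt] := ltP t (hit k); first by rewrite merging_vel_free ?blob_vel_bound.
have [[j jk tj]|h] := pselect (exists2 j, (j <= k)%N & hit j <= t < 2 * hit j).
  by rewrite (merging_vel_stage tj jk) cluster_vel_bound.
rewrite /merging_vel ltNge kt scale0r add0r big1 ?normr0.
  by apply: le_trans (blob_vel_bound 0).
move=> j _; case: (boolP (hit j <= t < 2 * hit j)) => [tj|_]; last by rewrite scale0r.
by case: h; exists j => //; rewrite -ltnS.
Qed.

Lemma free_path_continuous k : continuous (free_path k).
Proof. by move=> t; apply: cvgD; [exact: cvg_cst|apply: cvgZl; exact: cvg_id]. Qed.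

Lemma merging_path_continuous k : continuous (merging_path k).
Proof.
move=> t; apply: cvgD.
  by apply: cvgD; [exact: cvg_cst|apply: cvgZl; exact: continuous_minr].
elim: k.+1 => [|N IH].
  by rewrite big_ord0; under eq_fun do rewrite big_ord0; exact: cvg_cst.
rewrite big_ord_recr; under eq_fun do rewrite big_ord_recr.
by apply: cvgD => //; apply: cvgZl; exact: continuous_ramp.
Qed.

Lemma free_path_right_affine k t : right_affine (free_path k) t (free_vel k t).
Proof.
by exists 1 => // h _; rewrite /free_path /free_vel scalerDl addrA.
Qed.

Lemma merging_path_right_affine k t : right_affine (merging_path k) t (merging_vel k t).
Proof.
apply: right_affineD.
  rewrite -[X in right_affine _ _ X]add0r; apply: right_affineD.
    exact: right_affine_cst.
  by apply: right_affine_scale; exact: min_right_affine.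
apply: (@right_affine_sum _ _ k.+1
  (fun j t => ramp (hit j) (2 * hit j) t *: cluster_vel j) t
  (fun j => (hit j <= t < 2 * hit j)%R%:R *: cluster_vel j)) => j.
apply: right_affine_scale; apply: ramp_right_affine.
by have := hit0_ j; lra.
Qed.

Lemma measurable_merging_vel k i : measurable_fun [set: measurableTypeR R]
  (fun t => merging_vel k t ord0 i : measurableTypeR R).
Proof.
have ind (A : interval R) (c : R) :
    measurable_fun [set: measurableTypeR R]
      (fun t : R => \1_[set` A] t * c : measurableTypeR R).
  apply: measurable_funM => //; apply: measurable_indic; exact: measurable_itv.
rewrite (_ : (fun t => _) = fun t => \1_(`]-oo, hit k[%classic) t * blob_vel k ord0 i +
  \sum_(j < k.+1) \1_(`[hit j, (2 * hit j)[%classic) t * cluster_vel j ord0 i).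
  apply: measurable_funD; first exact: ind.
  by apply: measurable_sum => j; exact: ind.
apply/funext => t; rewrite /merging_vel mxE [X in X + _]mxE summxE; congr (_ * _ + _).
  by rewrite indicE; congr ((_ : bool)%:R); rewrite mem_setE in_itv.
apply: eq_bigr => j _; rewrite mxE; congr (_ * _).
by rewrite indicE; congr ((_ : bool)%:R); rewrite mem_setE in_itv.
Qed.

Lemma free_path_gap k t (z : 'rV[R]_n.+2) :
  (z - free_path k t) ord0 ord0 = z ord0 ord0 - (ctr0 T k + t * vel0 T k).
Proof. by rewrite /free_path planarZ planarD mxE [X in _ + X]mxE planar0. Qed.

(** Until the outer blob has gathered, first coordinates tell the blobs apart;
    from then on both are points. *)
Lemma free_blobs_disjoint j k t z : (j < k)%N -> 0 <= t ->
  `|z - free_path j t| <= blob_size T j t -> `|z - free_path k t| <= blob_size T k t -> False.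
Proof.
move=> jk t0 zj zk.
have [tj|tj] := ltP t (tau j).
  have h l := le_trans (coord_le_norm (z - free_path l t) ord0).
  have := blobs_separated T0 jk (t := t) (u := z ord0 ord0) (w := z ord0 ord0).
  rewrite t0 tj ltxx => H; apply: notF; apply: H => //.
    by rewrite -free_path_gap; exact: h zj.
  by rewrite -free_path_gap; exact: h zk.
have tk : tau k <= t by apply: le_trans tj; rewrite /tau ler_wpM2r// hit_le// ltnW.
move: zj zk; rewrite !blob_size_gathered// !normr_le0 !subr_eq0 => /eqP -> /eqP.
rewrite /free_path !planarZ !planarD => e.
apply: (@centres_never_meet _ T T0 j k t); first by rewrite ltn_eqF.
  by have := congr1 (fun x : 'rV[R]_n.+2 => x ord0 ord0) e; rewrite !planar0.
by have := congr1 (fun x : 'rV[R]_n.+2 => x ord0 (lift ord0 ord0)) e; rewrite !planar1.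
Qed.

Lemma free_tubes_disjoint j k t z : j <> k -> 0 <= t ->
  `|z - free_path j t| <= blob_size T j t -> `|z - free_path k t| <= blob_size T k t -> False.
Proof.
move=> jk t0 hj hk; case: (ltngtP j k) => [lt|lt|//].
  exact: free_blobs_disjoint lt t0 hj hk.
exact: free_blobs_disjoint lt t0 hk hj.
Qed.

(** Before the outer blob arrives, the inner one is either free as well or part of
    the cluster, which is ahead of the outer blob. *)
Lemma merging_tubes_meet_lt j k t z : (j < k)%N -> 0 <= t <= T ->
  `|z - merging_path j t| <= blob_size T j t ->
  `|z - merging_path k t| <= blob_size T k t -> hit j <= t.
Proof.
move=> jk /andP[t0 tT] zj zk; rewrite leNgt; apply/negP => tj.
move: (zj); rewrite merging_path_free ?(ltW tj)// => zj'.
have [tk|kt] := ltP t (hit k).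
  apply: (free_blobs_disjoint jk t0 zj'); move: zk.
  by rewrite merging_path_free// ltW.
have [i ti] : exists i, hit i <= t < 2 * hit i.
  by apply: hit_stage => //; rewrite tT andbT (lt_le_trans (hit0_ k)).
have ik : (i <= k)%N.
  by rewrite leqNgt; apply/negP => /(hit_half T0); case/andP: ti; lra.
move: zk; rewrite blob_size_gathered//; last first.
  by apply: le_trans kt; apply/ltW/tau_lt_hit.
rewrite normr_le0 subr_eq0 (merging_path_stage ti ik) => /eqP zE.
have := cluster_ahead T0 ti tj (u := z ord0 ord0).
rewrite (_ : _ < _ = false); last first.
  apply/negbTE; rewrite -leNgt zE planarZ planarD planar0; exact: lexx.
move=> H; apply: notF; apply: H.
apply: le_trans zj'; apply: le_trans (coord_le_norm _ ord0).
by rewrite free_path_gap.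
Qed.

Lemma merging_tubes_meet j k t z : j <> k -> 0 <= t <= T ->
  `|z - merging_path j t| <= blob_size T j t ->
  `|z - merging_path k t| <= blob_size T k t ->
  [/\ tau j <= t, tau k <= t, merging_vel j t = merging_vel k t &
      forall t', t <= t' <= T -> merging_path j t' = merging_path k t'].
Proof.
wlog jk : j k / (j < k)%N => [wl|] nk tT zj zk.
  case: (ltngtP j k) => [jk|kj|//]; first exact: wl.
  have [tk tj v p] := wl _ _ kj (fun e => nk (esym e)) tT zk zj.
  by split=> // t' h; rewrite p.
have jt := merging_tubes_meet_lt jk tT zj zk.
have /andP[t0 tT'] := tT.
have kt : hit k <= t by apply: le_trans jt; apply: hit_le => //; exact: ltnW.
have th l : hit l <= t -> tau l <= t.
  by move=> h; apply: le_trans h; apply/ltW/tau_lt_hit.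
split; [exact: th|exact: th| |].
  have [i ti] : exists i, hit i <= t < 2 * hit i.
    by apply: hit_stage => //; rewrite tT' andbT (lt_le_trans (hit0_ j)).
  have ij : (i <= j)%N.
    by rewrite leqNgt; apply/negP => /(hit_half T0); case/andP: ti; lra.
  by rewrite (merging_vel_stage ti ij) (merging_vel_stage ti (leq_trans ij (ltnW jk))).
move=> t' /andP[tt' _]; rewrite (merging_path_merged (ltnW jk))//.
exact: le_trans jt tt'.
Qed.

(** Telescoping: the first [N] blobs lack exactly the momentum that the tail brings
    along. *)
Lemma merging_momentum_partial j N t (i : 'I_n.+2) : hit j <= t < 2 * hit j -> (j <= N)%N ->
  \sum_(k < N) mass k * (merging_vel k t ord0 i - merging_vel k 0 ord0 i) =
  tail N * (cluster_vel N ord0 i - cluster_vel j ord0 i).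
Proof.
move=> tj; elim: N => [|N IH].
  by rewrite leqn0 => /eqP ->; rewrite big_ord0 subrr mulr0.
have free k : (k < j)%N -> merging_vel k t = merging_vel k 0.
  move=> kj; rewrite !merging_vel_free//.
  by apply: lt_le_trans (hit_half T0 kj); case/andP: tj.
rewrite leq_eqVlt => /orP[/eqP jN|jN].
  rewrite big1 ?jN ?subrr ?mulr0// => k _; rewrite free ?subrr ?mulr0//.
  by rewrite jN.
rewrite big_ord_recr/= IH// (merging_vel_stage tj)// merging_vel_free//.
have e : mass N * blob_vel N ord0 i =
    tail N * cluster_vel N ord0 i - tail N.+1 * cluster_vel N.+1 ord0 i.
  have := congr1 (fun x : 'rV[R]_n.+2 => x ord0 i) (cluster_momentum N).
  by rewrite mxE [X in _ = X]mxE [X in _ = X + _]mxE [X in _ = _ + X]mxE [X in - X]mxE.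
rewrite [X in _ + X]mulrBr e /mass; ring.
Qed.

(** The mass of the tail tends to 0. *)
Lemma merging_momentum t (i : 'I_n.+2) (psi : 'rV[R]_n.+2 -> R) : 0 <= t <= T ->
  \sum_(k < N) mass k * (merging_vel k t ord0 i - merging_vel k 0 ord0 i) *
    psi (merging_path k t) @[N --> \oo] --> (0 : R).
Proof.
move=> /andP[]; rewrite le_eqVlt => /orP[/eqP <- _|t0 tT].
  rewrite (_ : (fun N => _) = fun=> 0); first exact: cvg_cst.
  by apply/funext => N; rewrite big1// => k _; rewrite subrr mulr0 mul0r.
have [j tj] : exists j, hit j <= t < 2 * hit j by apply: hit_stage => //; rewrite t0.
pose Q := psi (meeting_point j + (t - hit j) *: cluster_vel j).
have E N : (j <= N)%N ->
    \sum_(k < N) mass k * (merging_vel k t ord0 i - merging_vel k 0 ord0 i) *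
      psi (merging_path k t) = tail N * (cluster_vel N ord0 i - cluster_vel j ord0 i) * Q.
  move=> jN; rewrite -(merging_momentum_partial i tj jN) mulr_suml.
  apply: eq_bigr => k _; have [jk|kj] := leqP j k.
    by rewrite (merging_path_stage tj jk).
  rewrite !merging_vel_free ?subrr ?mulr0 ?mul0r//.
  by apply: lt_le_trans (hit_half T0 kj); case/andP: tj.
apply/norm_cvg0P; pose K := (speed_bound + speed_bound) * `|Q|.
apply: (@squeeze_cvgr _ _ _ _ (cst 0) (fun N => tail N * K)); last 2 first.
- exact: cvg_cst.
- rewrite -[X in _ --> X](mul0r K); apply: cvgM; last exact: cvg_cst.
  exact: cvg_tail_mass.
exists j => // N /= jN; rewrite normr_ge0/= (E N jN) !normrM -mulrA.
rewrite ger0_norm ?(ltW (tail_mass_gt0 N))//.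
apply: ler_wpM2l; first exact: ltW (tail_mass_gt0 N).
apply: ler_wpM2r => //; apply: le_trans (ler_normB _ _) _.
by apply: lerD; apply: le_trans (coord_le_norm _ _) (cluster_vel_bound _).
Qed.

End two_flows.

(** * Two solutions with the same data *)

Section cascade_data.
Context {R : realType} {n : nat}.
Variable T : R.
Hypothesis T0 : 0 < T.
Local Notation hit := (hit T).
Local Notation tau := (tau T).
Local Notation rad := (rad T).
Local Notation centre := (@centre R n T).
Local Notation blob_vel := (@blob_vel R n T).
Local Notation S := (fun k => [set x | `|x - centre k| < 2 * rad k]).

Let hit0_ k : 0 < hit k := hit_gt0 T0 k.
Let rad0 k : 0 < rad k := rad_gt0 T0 k.

Lemma centre_gap k (x : 'rV[R]_n.+2) :
  (x - centre k) ord0 ord0 = x ord0 ord0 - ctr0 T k.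
Proof. by rewrite mxE [X in _ + X]mxE planar0. Qed.

Lemma start_disjoint x j k : S j x -> S k x -> j = k.
Proof.
have lt i l : (i < l)%N -> S i x -> S l x -> False.
  move=> il hi hl.
  have := initial_blobs_separated T0 il (u := x ord0 ord0) (w := x ord0 ord0).
  rewrite ltxx => H; apply: notF; apply: H.
    by rewrite -centre_gap; exact: le_lt_trans (coord_le_norm _ _) hi.
  by rewrite -centre_gap; exact: le_lt_trans (coord_le_norm _ _) hl.
move=> hj hk; case: (ltngtP j k) => [jk|kj|//]; first by case: (lt _ _ jk).
by case: (lt _ _ kj).
Qed.

Lemma start_far k x : S k x -> 14 * rad k <= `|x|.
Proof.
move=> h; apply: le_trans (coord_le_norm x ord0); apply: initial_blob_far => //.
apply: le_lt_trans h; apply: le_trans (coord_le_norm _ ord0).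
by rewrite centre_gap.
Qed.

Lemma centre_le k : `|centre k| <= 8 * (3 + 8 * T) * rad k.
Proof.
have h0 := hit0_ k; have hT := hit_leT T0 k; have /andP[g1 g2] := @gain_bounds R k.
have -> : 8 * (3 + 8 * T) * rad k = (3 + 8 * T) * hit k ^+ 2.
  by rewrite /rad; field.
apply: planar_norm_le; rewrite normrN ger0_norm.
- by apply: ler_wpM2r; [exact: sqr_ge0|lra].
- by rewrite mulr_ge0 ?sqr_ge0//; lra.
- rewrite exprS mulrA; apply: ler_wpM2r; first exact: sqr_ge0.
  have : (7 / 2 * gain k - 1) * hit k <= 8 * T by apply: ler_pM => //; lra.
  lra.
- by rewrite mulr_ge0 ?exprn_ge0//; lra.
Qed.

Lemma start_near k x : S k x -> `|x| <= (8 * (3 + 8 * T) + 2) * rad k.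
Proof.
move=> h; have := ler_normD (x - centre k) (centre k); rewrite subrK.
move=> /le_trans; apply; have := centre_le k; move: h => /=; lra.
Qed.

Lemma cvg_rad : rad @ \oo --> (0 : R).
Proof.
have h : (fun k => hit k * hit k * 8^-1) @ \oo --> (0 * 0 * 8^-1 : R).
  by apply: cvgM; [apply: cvgM; exact: cvg_hit|exact: cvg_cst].
by rewrite 2!mul0r in h.
Qed.

Definition rhob : 'rV[R]_n.+2 -> R := blob_density centre rad.

(** 1 on the unit ball and 0 outside the ball of radius 2, when applied to norms:
    it makes the velocity field continuous without changing it on the blobs. *)
Definition cutoff (s : R) : R := ramp 0 1 (2 - s).

Definition vb_term k (x : 'rV[R]_n.+2) : 'rV[R]_n.+2 :=
  cutoff (`|x - centre k| / rad k) *: (blob_vel k - (tau k)^-1 *: (x - centre k)).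

Definition vb : 'rV[R]_n.+2 -> 'rV[R]_n.+2 := glue S vb_term.

Lemma cutoff_bounds s : 0 <= cutoff s <= 1.
Proof. by rewrite /cutoff /ramp subr0 le_max lexx ge_max ler01 ge_min lexx orbT. Qed.

Lemma smooth_rhob : smooth rhob.
Proof.
apply: (smooth_blob_sum (c0 := 14) (C0 := 8 * (3 + 8 * T) + 2)) => //.
- exact: cvg_rad.
- exact: start_far.
- exact: start_near.
- exact: start_disjoint.
- move=> N; have [C hC] := mass_flat T0 (2 * (N + n.+2)).
  exists (C * 8 ^+ (N + n.+2)) => k.
  rewrite /blob_height ger0_norm; last first.
    by rewrite mulr_ge0 ?exprn_ge0 ?invr_ge0 ?(ltW (rad0 k))// ltW// mass_gt0.
  rewrite exprVn ler_pdivrMr ?exprn_gt0// -!mulrA -exprD -exprMn.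
  by rewrite (_ : 8 * rad k = hit k ^+ 2) -?exprM//; rewrite /rad; field.
- exact: smooth_cube_bump.
- exact: cube_bump_unit_supported.
Qed.

Lemma compactly_supported_rhob : compactly_supported rhob.
Proof.
apply: (compactly_supported_blob_sum (C0 := 8 * (3 + 8 * T) + 2)) => //.
- exact: cvg_rad.
- exact: start_near.
Qed.

Lemma compactly_supported_vb : compactly_supported vb.
Proof.
apply: (compactly_supported_blob_sum (C0 := 8 * (3 + 8 * T) + 2)) => //.
- exact: cvg_rad.
- exact: start_near.
Qed.

Lemma continuous_vb : continuous vb.
Proof.
apply: (@continuous_blob_sum _ _ centre rad 14 (8 * (3 + 8 * T) + 2)
  _ _ _ _ _ _ _ (fun k => (5 + 8 * T) * hit k)) => //.
- exact: cvg_rad.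
- exact: start_far.
- exact: start_near.
- exact: start_disjoint.
- rewrite -[X in _ --> X](mulr0 (5 + 8 * T)); apply: cvgM; first exact: cvg_cst.
  exact: cvg_hit.
- move=> k x; have cB : {for x, continuous (fun x : 'rV[R]_n.+2 => x - centre k)}.
    exact: (cvgB cvg_id (cvg_cst _)).
  have h : {for x, continuous (fun x : 'rV[R]_n.+2 => 2 - `|x - centre k| / rad k)}.
    exact: (cvgB (cvg_cst _) (cvgM (cvg_norm cB) (cvg_cst _))).
  have hc : {for x, continuous (fun x : 'rV[R]_n.+2 => cutoff (`|x - centre k| / rad k))}.
    exact: (continuous_comp h (@continuous_ramp _ 0 1 _)).
  have hv : {for x, continuous (fun x : 'rV[R]_n.+2 =>
      blob_vel k - (tau k)^-1 *: (x - centre k))}.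
    exact: (cvgB (cvg_cst _) (cvgZr cB)).
  exact: (cvgZ hc hv).
- move=> k x /negP; rewrite -leNgt => h; rewrite /vb_term /cutoff.
  by rewrite ramp_before ?scale0r// subr_le0 ler_pdivlMr.
move=> k x /= h; rewrite /vb_term normrZ; have /andP[c0 c1] := cutoff_bounds (`|x - centre k| / rad k).
rewrite ger0_norm//; apply: le_trans (_ : `|blob_vel k - (tau k)^-1 *: (x - centre k)| <= _).
  by rewrite ler_piMl.
apply: le_trans (ler_normB _ _) _.
have h1 : `|(tau k)^-1 *: (x - centre k)| <= hit k.
  rewrite normrZ ger0_norm ?invr_ge0 ?(ltW (tau_gt0 T0 k))//.
  rewrite ler_pdivrMl ?tau_gt0//; apply: le_trans (ltW h) _.
  by rewrite /rad /tau; have := sqr_ge0 (hit k); rewrite expr2; lra.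
have := @blob_vel_le R n T T0 k; lra.
Qed.

Lemma vb_start k (xi : 'rV[R]_n.+2) : `|xi| <= 1 ->
  vb (centre k + rad k *: xi) = blob_vel k - (rad k / tau k) *: xi.
Proof.
move=> xi1; rewrite /vb (glueE _ (k := k)); last 2 first.
- by move=> i j; exact: start_disjoint.
- rewrite /= addrC addKr normrZ gtr0_norm//.
  by have : rad k * `|xi| <= rad k * 1 by [rewrite ler_wpM2l// ltW]; have := rad0 k; lra.
rewrite /vb_term addrC addKr normrZ gtr0_norm// mulrAC divff ?gt_eqF// mul1r.
rewrite (_ : cutoff _ = 1).
  by rewrite scale1r scalerA mulrC.
by rewrite /cutoff ramp_after ?subr0//; lra.
Qed.

End cascade_data.

Section cascade_flows.
Context {R : realType} {n : nat}.
Variables (T : R) (D : set 'rV[R]_n.+2).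
Hypotheses (T0 : 0 < T) (oD : open D) (D1 : rV_lebesgue n.+2 D = 1%E).
Local Notation Leb := (rV_lebesgue n.+2).
Local Notation free_flow := (blob_flow T D (free_path T)).
Local Notation merging_flow := (blob_flow T D (merging_path T)).
Local Notation free_velocity := (blob_velocity T (free_path T) (@free_vel R n T)).
Local Notation merging_velocity := (blob_velocity T (merging_path T) (@merging_vel R n T)).

Let C : R := (4 + 8 * T) * T.

Lemma vb_blob_flow (P V : nat -> R -> 'rV[R]_n.+2) y :
  (forall k, P k 0 = centre T k) -> (forall k, V k 0 = blob_vel T k) ->
  vb T (blob_flow T D P 0 y) = blob_speed T D V 0 y.
Proof.
move=> P0 V0; rewrite /blob_flow /blob_speed P0 V0 /blob_size /gather_rate tau_gt0//.
rewrite shrink_gathering ?tau_gt0// mul0r subr0 mul1r vb_start//.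
exact: blob_offset_norm.
Qed.

Lemma free_flow_solution :
  sticky_weak_solution T D (rhob T) (vb T) free_flow /\
  associated_velocity T D free_flow free_velocity.
Proof.
have P0 k : @free_path R n T k 0 = centre T k by rewrite /free_path scale0r addr0.
have Pc := @free_path_continuous R n T.
have Ps := @free_path_right_affine R n T.
have Vb k t : `|@free_vel R n T k t| <= C by exact: blob_vel_bound.
have Vm k i : measurable_fun [set: measurableTypeR R]
  (fun t => @free_vel R n T k t ord0 i : measurableTypeR R) by [].
have Vf k t : t < tau T k -> @free_vel R n T k t = free_vel T k 0 by [].
have meet j k t z : j <> k -> 0 <= t <= T ->
    blob_tube T (free_path T) j (t, z) -> blob_tube T (@free_path R n T) k (t, z) ->
    [/\ tau T j <= t, tau T k <= t, free_vel T j t = @free_vel R n T k t &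
      forall t', t <= t' <= T -> free_path T j t' = @free_path R n T k t'].
  by move=> jk /andP[t0 _] zj zk; case: (free_tubes_disjoint T0 jk t0 zj zk).
have mom t i (psi : 'rV[R]_n.+2 -> R) : 0 <= t <= T ->
    \sum_(k < N) mass k * (@free_vel R n T k t ord0 i - free_vel T k 0 ord0 i) *
      psi (free_path T k t) @[N --> \oo] --> (0 : R).
  move=> _; rewrite (_ : (fun N => _) = fun=> 0); first exact: cvg_cst.
  by apply/funext => N; rewrite big1// => k _; rewrite subrr mulr0 mul0r.
split; last exact: (associated_velocity_blob_flow T0 oD D1 Pc Ps Vb Vm Vf meet mom).
apply: (sticky_weak_solution_blob_flow T0 oD D1 Pc Ps Vb Vm Vf meet mom).
- by move=> x i j; rewrite !P0; exact: start_disjoint.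
- exact: (congr1 (fun a => blob_density a (rad T)) (esym (funext P0))).
- exact: continuous_vb.
- by move=> y; apply: vb_blob_flow.
Qed.

Lemma merging_flow_solution :
  sticky_weak_solution T D (rhob T) (vb T) merging_flow /\
  associated_velocity T D merging_flow merging_velocity.
Proof.
have P0 k : @merging_path R n T k 0 = centre T k.
  by rewrite merging_path_free ?(ltW (hit_gt0 T0 k))// /free_path scale0r addr0.
have Pc := @merging_path_continuous R n T.
have Ps := @merging_path_right_affine R n T T0.
have Vb := @merging_vel_bound R n T T0.
have Vm := @measurable_merging_vel R n T.
have Vf k t : t < tau T k -> @merging_vel R n T k t = merging_vel T k 0.
  move=> tk; rewrite !merging_vel_free// ?hit_gt0//.
  exact: lt_trans tk (tau_lt_hit T0 k).
have meet := @merging_tubes_meet R n T T0.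
have mom := @merging_momentum R n T T0.
split; last exact: (associated_velocity_blob_flow T0 oD D1 Pc Ps Vb Vm Vf meet mom).
apply: (sticky_weak_solution_blob_flow T0 oD D1 Pc Ps Vb Vm Vf meet mom).
- by move=> x i j; rewrite !P0; exact: start_disjoint.
- exact: (congr1 (fun a => blob_density a (rad T)) (esym (funext P0))).
- exact: continuous_vb.
- by move=> y; apply: vb_blob_flow => // k; rewrite merging_vel_free// hit_gt0.
Qed.

(** At time [T] the merging flow has gathered all the mass in one point, the free
    flow only the mass of the outermost blob. *)
Lemma flows_differ : ~ same_pair T D free_flow free_velocity merging_flow merging_velocity.
Proof.
move=> [h _]; have TT : 0 <= T <= T by rewrite lexx ltW.
pose q : 'rV[R]_n.+2 := meeting_point T 0.
have tT k : tau T k <= T.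
  by apply: le_trans (ltW (tau_lt_hit T0 k)) (hit_leT T0 k).
have stage0 : hit T 0 <= T < 2 * hit T 0 by rewrite hit0 lexx; have := T0; lra.
have free0 : free_path T 0 T = q.
  by rewrite /free_path -[X in X *: _](hit0 T) arrival.
have mA : measurable [set q].
  rewrite (_ : [set q] = rV_box (fun i => [set q ord0 i])).
    by apply: (@measurable_rV_box R _ (fun i => [set q ord0 i])) => i; exact: measurable_set1.
  apply/seteqP; split => x /=; first by move=> ->.
  by move=> e; apply/rowP => i; exact: e.
have := h T TT _ mA; rewrite /associated_density.
rewrite (_ : D `&` merging_flow T @^-1` [set q] = D); last first.
  apply/setIidPl => y _; rewrite /preimage/= blob_flow_gathered//.
  rewrite (merging_path_stage T0 stage0)// hit0 subrr scale0r addr0//.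
rewrite D1 => e.
have : (Leb (D `&` free_flow T @^-1` [set q]) <= (mass 0)%:E)%E.
  rewrite -(blob_piece_mass oD D1); apply: le_measure; rewrite ?inE.
  - apply: measurableI; first exact: measurable_open_rV.
    have mX : measurable_fun setT (free_flow T).
      by apply: measurable_blob_flow => k; exact: (@free_path_continuous R n T k).
    by rewrite -[X in measurable X]setTI; exact: mX.
  - exact: measurable_blob_piece.
  move=> y [Dy]; rewrite /preimage/= blob_flow_gathered// -free0 => yq; split => //.
  have [//|/eqP k0] := eqVneq (blob_index D y) 0%N.
  exfalso; apply: (@free_tubes_disjoint R n T T0 _ _ T (free_path T 0 T) k0 (ltW T0)).
    by rewrite [X in _ - X]yq subrr normr0 blob_size_ge0.
  by rewrite subrr normr0 blob_size_ge0.
rewrite e lee_fin leNgt => /negP; apply; rewrite /mass tail_mass0.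
by have := @tail_mass_gt0 R 1; lra.
Qed.

End cascade_flows.

Theorem theorem2 (R : realType) (n : nat) (T : R) (D : set 'rV[R]_n)
    (hn : (2 <= n)%N) (hT : 0 < T) (oD : open D)
    (D1 : rV_lebesgue n D = 1%E) :
  exists (rhob : 'rV[R]_n -> R) (vb : 'rV[R]_n -> 'rV[R]_n),
    [/\ smooth rhob, compactly_supported rhob, (forall x, 0 <= rhob x) &
        (\int[rV_lebesgue n]_x (rhob x)%:E = 1)%E] /\
    (continuous vb /\ compactly_supported vb) /\
    exists (X1 X2 : R -> 'rV[R]_n -> 'rV[R]_n)
           (v1 v2 : R -> 'rV[R]_n -> 'rV[R]_n),
      [/\ sticky_weak_solution T D rhob vb X1,
          sticky_weak_solution T D rhob vb X2,
          associated_velocity T D X1 v1,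
          associated_velocity T D X2 v2 &
          ~ same_pair T D X1 v1 X2 v2].
Proof.
case: n hn D oD D1 => [//|[//|n]] _ D oD D1.
exists (rhob T), (vb T); split; [split|split; [split|]].
- exact: smooth_rhob.
- exact: compactly_supported_rhob.
- by apply: blob_density_ge0 => //; [move=> k; exact: rad_gt0|exact: start_disjoint].
- by apply: (integral_blob_density oD D1) => //; [move=> k; exact: rad_gt0|exact: start_disjoint].
- exact: continuous_vb.
- exact: compactly_supported_vb.
have [s1 a1] := free_flow_solution hT oD D1; have [s2 a2] := merging_flow_solution hT oD D1.
by exists (blob_flow T D (free_path T)), (blob_flow T D (merging_path T)),
  (blob_velocity T (free_path T) (free_vel T)),
  (blob_velocity T (merging_path T) (merging_vel T)); split => //; exact: flows_differ.
Qed.
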